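(* Let $-\infty<a<b<\infty$, $l\in\mathbb N$, let $\alpha\in\mathbb C$ and $\alpha_0,\dots,\alpha_l\in\mathbb C$ satisfy $0=\alpha_0<\operatorname{Re}\alpha_1<\cdots<\operatorname{Re}\alpha_l<\operatorname{Re}\alpha$, and let $n=[\operatorname{Re}\alpha]+1$ if $\alpha\notin\mathbb N$ and $n=\alpha$ if $\alpha\in\mathbb N$. Let $a_j\in C[a,b]$ $(j=0,\dots,l)$ be complex-valued, $g\in L(a,b)$, $b_1,\dots,b_n\in\mathbb C$, and let $k_0$ be the largest $k\in\{1,\dots,n\}$ such that $a_j(x)\frac{(x-a)^{\alpha-\alpha_j-k}}{\Gamma(\alpha-\alpha_j-k+1)}\in L(a,b)$ for all $j=0,\dots,l$. Then the unique solution $y\in L^{\alpha}(a,b)$ of the Cauchy type problem $$(D_{a+}^{\alpha}y)(x)+\sum_{j=0}^{l}a_j(x)(D_{a+}^{\alpha_j}y)(x)=g(x),\qquad (D_{a+}^{\alpha-k}y)(a+)=b_kH(k_0-k)\quad(k=1,\dots,n)$$ is represented as $$y(x)=\sum_{i=1}^{k_0}b_i\,y_i(x)+\int_a^xG(x;\xi)\,g(\xi)\,d\xi,$$ where $\{y_i\}_{i=1}^{k_0}$ is the canonical fundamental system of solutions of the corresponding homogeneous equation, $$y_i(x)=\frac{(x-a)^{\alpha-i}}{\Gamma(\alpha-i+1)}+\sum_{k=0}^{\infty}(-1)^{k+1}I_{a+}^{\alpha}\left(\sum_{j=0}^{l}a_j(x)I_{a+}^{\alpha-\alpha_j}\right)^{k}\sum_{j=0}^{l}a_j(x)\frac{(x-a)^{\alpha-\alpha_j-i}}{\Gamma(\alpha-\alpha_j-i+1)},$$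 and $G(x;\xi)$ is the Green's function of the corresponding problem with zero initial data, $$G(x;\xi)=\frac{(x-\xi)^{\alpha-1}}{\Gamma(\alpha)}+\sum_{k=0}^{\infty}(-1)^{k+1}I_{\xi+}^{\alpha}\left(\sum_{j=0}^{l}a_j(x)I_{\xi+}^{\alpha-\alpha_j}\right)^{k}\sum_{j=0}^{l}a_j(x)\frac{(x-\xi)^{\alpha-\alpha_j-1}}{\Gamma(\alpha-\alpha_j)}.$$
   Context: The canonical fundamental system of the homogeneous equation $(D_{a+}^{\alpha}y)(x)+\sum_{j}a_j(x)(D_{a+}^{\alpha_j}y)(x)=0$ is the system $\{y_i\in L^{\alpha}(a,b): i=1,\dots,k_0\}$ where $y_i$ is its solution satisfying $(D_{a+}^{\alpha-k}y_i)(a+)=\delta_{ik}$ for $k=1,\dots,n$. The Green's function $G(\cdot;\xi)\in L^\alpha(\xi,b)$, $\xi>a$, is the solution of $(D_{\xi+}^{\alpha}G)(x;\xi)+\sum_{j}a_j(x)(D_{\xi+}^{\alpha_j}G)(x;\xi)=0$, $x>\xi$, with $(D_{\xi+}^{\alpha-k}G)(x;\xi)|_{x=\xi+}=1$ for $k=1$ and $=0$ for $k=2,\dots,n$. The $k$-th power of $\sum_{j}a_j(x)I_{c+}^{\alpha-\alpha_j}$ ($c=a$ or $c=\xi$) is the $k$-fold composition of the operator $\varphi\mapsto\sum_j a_j\, I_{c+}^{\alpha-\alpha_j}\varphi$ (identity for $k=0$). The series converge in $L(a,b)$, respectively $L(\xi,b)$. All equalities between functions hold almost everywhere. $L(c,b)$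 is the space of complex-valued Lebesgue integrable functions on $(c,b)$. $H(k)=1$ for $k\ge 0$ and $H(k)=0$ for $k<0$. $[\cdot]$ is the integer part, and $1/\Gamma(z)=0$ at the poles $z=0,-1,-2,\dots$ of $\Gamma$. As the paper assumes, $n-1<\operatorname{Re}\alpha<n$ when $\alpha\notin\mathbb N$. For $a\le c<b$ and $\operatorname{Re}\beta>0$, $(I_{c+}^{\beta}f)(x)=\frac1{\Gamma(\beta)}\int_c^x(x-t)^{\beta-1}f(t)\,dt$, and $I_{c+}^0$ is the identity. The Riemann-Liouville derivative for $\operatorname{Re}\beta\ge 0$ is $(D_{c+}^{\beta}y)(x)=\left(\frac{d}{dx}\right)^{m}(I_{c+}^{m-\beta}y)(x)$ with $m=[\operatorname{Re}\beta]+1$; for $\beta=m$ a nonnegative integer, $D_{c+}^{m}y=y^{(m)}$ (so $D_{c+}^{0}y=y$). For $k=n$ and $\alpha\notin\mathbb N$, $D_{c+}^{\alpha-n}y:=I_{c+}^{n-\alpha}y$. The value at $c+$ denotes the limit as $x\to c+$. $AC^n[c,b]$ is the space of functions with continuous derivatives up to order $n-1$ on $[c,b]$ whose $(n-1)$-st derivative is absolutely continuous. $L^{\alpha}(c,b)=\{y\in L(c,b):D_{c+}^{\alpha}y\in L(c,b)\}$, where $D_{c+}^{\alpha}y\in L(c,b)$ is read as: $I_{c+}^{n-\alpha}y\in AC^n[c,b]$ (so $D_{c+}^{\alpha}y=\left(\frac{d}{dx}\right)^n I_{c+}^{n-\alpha}y$ exists a.e. and is integrable). *)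

(* Defs.v *)
From HB Require Import structures.
From mathcomp Require Import all_boot all_order all_algebra.
From mathcomp Require Import all_classical all_reals all_analysis.
From mathcomp Require Import complex.
Set Implicit Arguments.
Unset Strict Implicit.
Unset Printing Implicit Defensive.
Import Order.TTheory GRing.Theory Num.Theory.
Import numFieldNormedType.Exports.
Local Open Scope classical_set_scope.
Local Open Scope ring_scope.
Local Open Scope complex_scope.

(* R[i] carries no topology or measurable structure over R in the libraries, so
   limits, continuity, integrability and integrals of complex-valued functions
   of a real variable are taken on real and imaginary parts. *)

Section ComplexValuedFunctions.
Variable R : realType.
Implicit Types (A D : set R) (f g : R -> R[i]) (z d : R[i]) (x c b : R).

Local Notation mu := (@lebesgue_measure R).

Definition reals f : R -> R := fun x => complex.Re (f x).
Definition imags f : R -> R := fun x => complex.Im (f x).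

Definition ccvg (F : set_system R) f d : Prop :=
  (reals f @ F --> complex.Re d) /\ (imags f @ F --> complex.Im d).

Definition ccontinuous A f : Prop :=
  {within A, continuous (reals f)} /\ {within A, continuous (imags f)}.

(* d is the derivative of f at x relative to A (one-sided if x is an endpoint
   of the interval A). *)
Definition cderiv A f x d : Prop :=
  ccvg (within A x^') (fun t => (f t - f x) / (t - x)%:C) d.

Definition cint D f : R[i] :=
  Rintegral mu D (reals f) +i* Rintegral mu D (imags f).

(* L(c,b).  Integrability includes Borel measurability on ]c, b[; every
   Lebesgue class has Borel representatives. *)
Definition L1 c b f : Prop :=
  mu.-integrable `]c, b[ (EFin \o reals f) /\
  mu.-integrable `]c, b[ (EFin \o imags f).

Definition aeeq c b f g : Prop :=
  {ae mu, forall x, x \in `]c, b[ -> f x = g x}.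

(* s is the sum of the series of the u k, with convergence in L(c,b). *)
Definition L1_series c b (u : nat -> R -> R[i]) (s : R -> R[i]) : Prop :=
  [/\ forall k, L1 c b (u k), L1 c b s &
      (fun N : nat => \int[mu]_(x in `]c, b[)
         (complex.Re `|s x - \sum_(k < N) u k x|)%:E)%E @ \oo --> 0%E].

(* x ^ z = exp (z ln x), meaningful for x > 0. *)
Definition cpow x z : R[i] :=
  (x `^ complex.Re z)%:C *
  (cos (complex.Im z * ln x) +i* sin (complex.Im z * ln x)).

(* Euler's integral, for Re z > 0. *)
Definition cGamma z : R[i] :=
  cint `]0, +oo[ (fun t => (expR (- t))%:C * cpow t (z - 1)).

(* The entire function 1 / Gamma: off Re z > 0 it is obtained from
   Gamma (z + m) = z (z + 1) ... (z + m - 1) Gamma z, with Re (z + m) > 0; the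
   product vanishes exactly at the poles of Gamma. *)
Definition rGamma z : R[i] :=
  if 0 < complex.Re z then (cGamma z)^-1 else
  let m := (Num.truncn (- complex.Re z)).+1 in
  (\prod_(k < m) (z + k%:R)) / cGamma (z + m%:R).

Definition is_natC z : bool := z == (Num.truncn (complex.Re z))%:R.

Definition abs_cont c b f : Prop :=
  forall e : R, 0 < e -> exists2 d : R, 0 < d &
    forall (N : nat) (u v : 'I_N -> R),
      (forall i, c <= u i /\ u i < v i /\ v i <= b) ->
      (forall i j, i != j -> v i <= u j \/ v j <= u i) ->
      \sum_i (v i - u i) < d ->
      \sum_i complex.Re `|f (v i) - f (u i)| < e.

(* AC^n[c,b] for n >= 1; F i is the i-th derivative of f. *)
Definition ACn (n : nat) c b f : Prop :=
  exists F : nat -> R -> R[i],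
    [/\ forall x, x \in `[c, b] -> F 0%N x = f x,
        forall i : nat, (i < n)%N -> ccontinuous `[c, b] (F i),
        forall i : nat, (i.+1 < n)%N ->
          forall x, x \in `[c, b] -> cderiv `[c, b] (F i) x (F i.+1 x) &
        abs_cont c b (F n.-1)].

End ComplexValuedFunctions.

Section RiemannLiouville.
Variable R : realType.
Implicit Types (f u w y : R -> R[i]) (beta : R[i]) (c b : R).

(* I_{c+}^beta for beta = 0 or Re beta > 0. *)
Definition RLint c beta f : R -> R[i] := fun x =>
  if beta == 0 then f x else
  rGamma beta * cint `]c, x[ (fun t => cpow (x - t) (beta - 1) * f t).

(* w = (d/dx)^m u a.e. on (c,b), where u is a class of functions modulo a.e.
   equality: some representative F 0 of u has pointwise derivatives F i of
   order i < m on the whole of (c,b), and F m.-1 has derivative w a.e.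
   Such a w is unique up to a.e. equality. *)
Definition nth_deriv c b (m : nat) u w : Prop :=
  exists F : nat -> R -> R[i],
    [/\ aeeq c b (F 0%N) u,
        aeeq c b (F m) w,
        forall i : nat, (i.+1 < m)%N ->
          forall x, x \in `]c, b[ -> cderiv `]c, b[ (F i) x (F i.+1 x) &
        forall i : nat, i.+1 = m ->
          {ae @lebesgue_measure R, forall x, x \in `]c, b[ ->
             cderiv `]c, b[ (F i) x (F i.+1 x)}].

(* w = D_{c+}^beta y a.e. on (c,b); D_{c+}^beta = I_{c+}^{-beta} if
   Re beta < 0. *)
Definition RLderiv c b beta y w : Prop :=
  let m := Num.truncn (complex.Re beta) in
  if is_natC beta then nth_deriv c b m y w
  else if 0 <= complex.Re beta then
    nth_deriv c b m.+1 (RLint c (m.+1%:R - beta) y) w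
  else aeeq c b w (RLint c (- beta) y).

(* (D_{c+}^beta y)(c+) = v: the class D_{c+}^beta y has a representative with
   limit v at c+. *)
Definition RLderiv_init c b beta y (v : R[i]) : Prop :=
  exists2 w, RLderiv c b beta y w & ccvg c^'+ w v.

Definition RLorder (alpha : R[i]) : nat :=
  if is_natC alpha then Num.truncn (complex.Re alpha)
  else (Num.truncn (complex.Re alpha)).+1.

(* L^alpha(c,b). *)
Definition Lalpha (alpha : R[i]) c b y : Prop :=
  let n := RLorder alpha in
  L1 c b y /\
  exists2 F, ACn n c b F & aeeq c b F (RLint c (n%:R - alpha) y).

End RiemannLiouville.

Section CauchyProblem.
Variables (R : realType) (l : nat).
Variables (alpha : R[i]) (alphas : 'I_l.+1 -> R[i]).
Variable (aj : 'I_l.+1 -> R -> R[i]).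
Implicit Types (c b xi : R) (g y phi : R -> R[i]) (bb : nat -> R[i]).

Local Notation n := (RLorder alpha).

(* y in L^alpha(c,b) solves the equation with right-hand side g and data
   (D_{c+}^{alpha-k} y)(c+) = bb k, k = 1..n. *)
Definition cauchy_solution c b g bb y : Prop :=
  [/\ Lalpha alpha c b y,
      (exists (w : R -> R[i]) (v : 'I_l.+1 -> R -> R[i]),
        [/\ RLderiv c b alpha y w,
            forall j, RLderiv c b (alphas j) y (v j) &
            aeeq c b (fun x => w x + \sum_j aj j x * v j x) g]) &
      forall k : nat, (1 <= k <= n)%N ->
        RLderiv_init c b (alpha - k%:R) y (bb k)].

(* Y i, i = 1..k0, is the canonical fundamental system on (c,b). *)
Definition canonical_system c b (k0 : nat) (Y : nat -> R -> R[i]) : Prop :=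
  forall i : nat, (1 <= i <= k0)%N ->
    cauchy_solution c b (fun=> 0) (fun k => (i == k)%:R) (Y i).

(* G x xi is the Green's function at xi.  The joint measurability on
   a < xi < x < b makes the integral of G x xi * g xi in xi independent, for
   a.e. x, of the choice of representatives of the classes G(.; xi). *)
Definition green_function a b (G : R -> R -> R[i]) : Prop :=
  let R2 := (measurableTypeR R * measurableTypeR R)%type in
  let T := [set p : R2 | (a : R) < p.2 /\ (p.2 : R) < p.1 /\ (p.1 : R) < b] in
  [/\ measurable_fun T (fun p : R2 => complex.Re (G p.1 p.2)),
      measurable_fun T (fun p : R2 => complex.Im (G p.1 p.2)) &
      forall xi, xi \in `]a, b[ ->
        cauchy_solution xi b (fun=> 0) (fun k => (k == 1%N)%:R)
          (fun x => G x xi)].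

(* (x-c)^{alpha-i} / Gamma(alpha-i+1). *)
Definition power_fun c (i : nat) : R -> R[i] := fun x =>
  cpow (x - c) (alpha - i%:R) * rGamma (alpha - i%:R + 1).

(* a_j(x) (x-c)^{alpha-alpha_j-i} / Gamma(alpha-alpha_j-i+1). *)
Definition coef_power c (i : nat) (j : 'I_l.+1) : R -> R[i] := fun x =>
  aj j x * (cpow (x - c) (alpha - alphas j - i%:R) *
            rGamma (alpha - alphas j - i%:R + 1)).

(* The operator sum_j a_j(x) I_{c+}^{alpha-alpha_j}. *)
Definition sum_op c phi : R -> R[i] := fun x =>
  \sum_j aj j x * RLint c (alpha - alphas j) phi x.

(* k-th term of the series representing y_i (c = a), and, for i = 1, of the
   series representing G(.; c). *)
Definition series_term c (i k : nat) : R -> R[i] := fun x =>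
  (-1) ^+ k.+1 *
  RLint c alpha (iter k (sum_op c) (fun t => \sum_j coef_power c i j t)) x.

(* k0 is the largest k in {1..n} such that all coef_power a k j are in
   L(a,b). *)
Definition largest_index a b (k0 : nat) : Prop :=
  let P k := (1 <= k <= n)%N /\ forall j, L1 a b (coef_power a k j) in
  P k0 /\ forall k, P k -> (k <= k0)%N.

End CauchyProblem.

(* Main.v *)
Require Import Defs.
From HB Require Import structures.
From mathcomp Require Import all_boot all_order all_algebra.
From mathcomp Require Import all_classical all_reals all_analysis.
From mathcomp Require Import complex.
From mathcomp Require Import measurable_realfun.
From mathcomp Require Import ring lra zify.
Set Implicit Arguments.
Unset Strict Implicit.
Unset Printing Implicit Defensive.
Import Order.TTheory GRing.Theory Num.Theory.
Import numFieldNormedType.Exports.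
Local Open Scope classical_set_scope.
Local Open Scope ring_scope.
Local Open Scope complex_scope.

(* The unknown is phi = D_{a+}^alpha y.  A function y solves the Cauchy type
   problem iff y = sum_i b_i (x-a)^(alpha-i) / Gamma(alpha-i+1) + I_{a+}^alpha phi
   with phi in L(a,b) a solution of the Volterra equation phi + T phi = f, where
   T = sum_j a_j I_{a+}^(alpha-alpha_j) and f is g minus the sum of the b_i times
   sum_j a_j (x-a)^(alpha-alpha_j-i) / Gamma(alpha-alpha_j-i+1).  In the norm of
   L(a,b) weighted by exp(-lambda (x-a)), lambda large, T is a contraction, so
   phi is the Neumann series of f; this gives the series of the y_i and of the
   Green's function.  The resolvent kernel is r(., xi) = - (I + T)^(-1) T(., xi),
   jointly measurable, the Green's function is the kernel of I^alpha (I + r), and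
   its integral against g is I^alpha of the solution of phi + T phi = g.
   The equivalence rests on the semigroup law of the fractional integrals (the
   Beta integral), on the injectivity of I^beta, and on the fact that an
   absolutely continuous function with an a.e. derivative is the integral of
   that derivative. *)

(** * Complex-valued integrals *)

(** Functions are extended by 0 to the whole line, and the kernels of the fractional integrals are
    cut to a < t < x < b. On functions supported in (xi,b) the integral based at a agrees with the
    one based at xi, so one operator T and one Neumann series serve the problem at a and the
    problems at all xi. Truncating the data at k0 keeps f in L(a,b). Each column T(., xi) is
    integrable, so r(., xi) exists for every xi and not only for almost every one, as the definition
    of the Green's function demands. That definition fixes G(., xi) only up to a null set of x
    depending on xi; joint measurability and Tonelli exchange the quantifiers before G is integrated
    in xi. The semigroup law is read off from Fubini applied to Gamma(z) Gamma(w); normalising it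
    requires that Gamma have no zero in Re z > 0. Derivatives are those of representatives of
    classes, so the passage from y to phi rests on the uniqueness of differentiable
    representatives. *)

Section ComplexAlgebra.
Variable R : realType.
Implicit Types (z w : R[i]) (r : R).

Lemma complexP z w : complex.Re z = complex.Re w -> complex.Im z = complex.Im w -> z = w.
Proof. by case: z w => [a b] [c d] /= -> ->. Qed.

Lemma cReD z w : complex.Re (z + w) = complex.Re z + complex.Re w.
Proof. by case: z w => [a b] [c d]. Qed.
Lemma cImD z w : complex.Im (z + w) = complex.Im z + complex.Im w.
Proof. by case: z w => [a b] [c d]. Qed.
Lemma cReN z : complex.Re (- z) = - complex.Re z.
Proof. by case: z. Qed.
Lemma cImN z : complex.Im (- z) = - complex.Im z.
Proof. by case: z. Qed.
Lemma cReB z w : complex.Re (z - w) = complex.Re z - complex.Re w.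
Proof. by rewrite cReD cReN. Qed.
Lemma cImB z w : complex.Im (z - w) = complex.Im z - complex.Im w.
Proof. by rewrite cImD cImN. Qed.
Lemma cReM z w : complex.Re (z * w) =
  complex.Re z * complex.Re w - complex.Im z * complex.Im w.
Proof. by case: z w => [a b] [c d]. Qed.
Lemma cImM z w : complex.Im (z * w) =
  complex.Re z * complex.Im w + complex.Im z * complex.Re w.
Proof. by case: z w => [a b] [c d]. Qed.
Lemma ReR r : complex.Re r%:C = r. Proof. by []. Qed.
Lemma ImR r : complex.Im r%:C = 0. Proof. by []. Qed.
Lemma Re0 : complex.Re (0 : R[i]) = 0. Proof. by []. Qed.
Lemma Im0 : complex.Im (0 : R[i]) = 0. Proof. by []. Qed.
Lemma Re1 : complex.Re (1 : R[i]) = 1. Proof. by []. Qed.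
Lemma Im1 : complex.Im (1 : R[i]) = 0. Proof. by []. Qed.
Lemma natC n : (n%:R : R[i]) = (n%:R : R)%:C.
Proof. by elim: n => // n IH; rewrite -!natr1 IH; apply/complexP; rewrite !(cReD, cImD)//= addr0. Qed.
Lemma Re_nat n : complex.Re (n%:R : R[i]) = n%:R.
Proof. by rewrite natC. Qed.
Lemma Im_nat n : complex.Im (n%:R : R[i]) = 0.
Proof. by rewrite natC. Qed.
Lemma Re_sum (I : Type) (s : seq I) (P : pred I) (F : I -> R[i]) :
  complex.Re (\sum_(i <- s | P i) F i) = \sum_(i <- s | P i) complex.Re (F i).
Proof. by apply: (big_morph (@complex.Re R)) => // x y; rewrite cReD. Qed.
Lemma Im_sum (I : Type) (s : seq I) (P : pred I) (F : I -> R[i]) :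
  complex.Im (\sum_(i <- s | P i) F i) = \sum_(i <- s | P i) complex.Im (F i).
Proof. by apply: (big_morph (@complex.Im R)) => // x y; rewrite cImD. Qed.

Definition ReImE := (cReD, cImD, cReN, cImN, cReM, cImM, ReR, ImR, Re0, Im0, Re1, Im1,
  Re_nat, Im_nat).

(* Equivalent to the modulus, but integrals of complex functions split into real
   and imaginary parts without any square root. *)
Definition n1 z : R := `|complex.Re z| + `|complex.Im z|.

Lemma n1_ge0 z : 0 <= n1 z. Proof. exact: addr_ge0. Qed.
Lemma n1_0 : n1 0 = 0. Proof. by rewrite /n1 /= normr0 addr0. Qed.
Lemma n1D z w : n1 (z + w) <= n1 z + n1 w.
Proof.
rewrite /n1 !ReImE addrACA; apply: lerD; exact: ler_normD.
Qed.
Lemma n1N z : n1 (- z) = n1 z.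
Proof. by rewrite /n1 !ReImE !normrN. Qed.
Lemma n1M z w : n1 (z * w) <= n1 z * n1 w.
Proof.
rewrite /n1 !ReImE mulrDl !mulrDr -!normrM.
rewrite (le_trans (lerD (ler_normB _ _) (ler_normD _ _)))//; lra.
Qed.
Lemma n1_real r : n1 r%:C = `|r|.
Proof. by rewrite /n1 /= normr0 addr0. Qed.
Lemma n1_eq0 z : n1 z = 0 -> z = 0.
Proof.
move=> /eqP; rewrite paddr_eq0// !normr_eq0 => /andP[/eqP a /eqP b].
exact: complexP.
Qed.
Lemma n1_sum (I : Type) (s : seq I) (P : pred I) (F : I -> R[i]) :
  n1 (\sum_(i <- s | P i) F i) <= \sum_(i <- s | P i) n1 (F i).
Proof.
elim/big_rec2: _ => [|i x y _ h]; first by rewrite n1_0.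
by rewrite (le_trans (n1D _ _))// lerD2l.
Qed.
Lemma Re_norm_ge0 z : 0 <= complex.Re `|z|.
Proof. by rewrite normc_def /= sqrtr_ge0. Qed.
Lemma Re_norm_le z : complex.Re `|z| <= n1 z.
Proof.
rewrite normc_def /= -(ger0_norm (n1_ge0 z)) -sqrtr_sqr ler_sqrt ?sqr_ge0//.
rewrite /n1 sqrrD !real_normK ?num_real// lerD2r lerDl.
by rewrite mulrn_wge0// mulr_ge0.
Qed.
Lemma ler_Re_norm z : `|complex.Re z| <= complex.Re `|z|.
Proof. by rewrite normc_def /= -sqrtr_sqr ler_sqrt ?lerDl ?addr_ge0 ?sqr_ge0. Qed.
Lemma ler_Im_norm z : `|complex.Im z| <= complex.Re `|z|.
Proof. by rewrite normc_def /= -sqrtr_sqr ler_sqrt ?lerDr ?addr_ge0 ?sqr_ge0. Qed.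
Lemma ler_Re_n1 z : `|complex.Re z| <= n1 z. Proof. by rewrite lerDl. Qed.
Lemma ler_Im_n1 z : `|complex.Im z| <= n1 z. Proof. by rewrite lerDr. Qed.

End ComplexAlgebra.

Section ComplexIntegral.
Context d (T : measurableType d) (R : realType).
Variable mu : {measure set T -> \bar R}.
Implicit Types (f g : T -> R[i]) (z : R[i]).

Definition cmeas f := measurable_fun setT (fun x => complex.Re (f x)) /\
  measurable_fun setT (fun x => complex.Im (f x)).

Lemma cmeas_cst z : cmeas (fun=> z).
Proof. by split; exact: measurable_cst. Qed.

Lemma cmeasD f g : cmeas f -> cmeas g -> cmeas (fun x => f x + g x).
Proof.
move=> [f1 f2] [g1 g2]; split.
- by under eq_fun do rewrite cReD; exact: measurable_funD.
- by under eq_fun do rewrite cImD; exact: measurable_funD.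
Qed.

Lemma cmeasN f : cmeas f -> cmeas (fun x => - f x).
Proof.
move=> [f1 f2]; split.
- by under eq_fun do rewrite cReN; exact: measurableT_comp.
- by under eq_fun do rewrite cImN; exact: measurableT_comp.
Qed.

Lemma cmeasB f g : cmeas f -> cmeas g -> cmeas (fun x => f x - g x).
Proof. by move=> mf /cmeasN; exact: cmeasD. Qed.

Lemma cmeasM f g : cmeas f -> cmeas g -> cmeas (fun x => f x * g x).
Proof.
move=> [f1 f2] [g1 g2]; split.
- under eq_fun do rewrite cReM; apply: measurable_funB; exact: measurable_funM.
- under eq_fun do rewrite cImM; apply: measurable_funD; exact: measurable_funM.
Qed.

Lemma cmeas_sum (I : Type) (s : seq I) (F : I -> T -> R[i]) :
  (forall i, cmeas (F i)) -> cmeas (fun x => \sum_(i <- s) F i x).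
Proof.
move=> mF; elim: s => [|i s IH].
  by under eq_fun do rewrite big_nil; exact: cmeas_cst.
by under eq_fun do rewrite big_cons; exact: cmeasD.
Qed.

Lemma cmeas_real (h : T -> R) : measurable_fun setT h -> cmeas (fun x => (h x)%:C).
Proof. by move=> mh; split => //=; exact: measurable_cst. Qed.

Lemma cmeas_if (b : T -> bool) f g : measurable_fun setT b ->
  cmeas f -> cmeas g -> cmeas (fun x => if b x then f x else g x).
Proof.
move=> mb [f1 f2] [g1 g2]; split.
- rewrite (_ : (fun x => _) = (fun x => if b x then complex.Re (f x) else complex.Re (g x))).
    exact: measurable_fun_ifT.
  by apply/funext => x; case: (b x).
- rewrite (_ : (fun x => _) = (fun x => if b x then complex.Im (f x) else complex.Im (g x))).
    exact: measurable_fun_ifT.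
  by apply/funext => x; case: (b x).
Qed.

Lemma cmeas_n1 f : cmeas f -> measurable_fun setT (fun x => n1 (f x)).
Proof. by move=> [f1 f2]; apply: measurable_funD; exact: measurableT_comp. Qed.

Lemma cmeas_n1E f : cmeas f -> measurable_fun setT (fun x => (n1 (f x))%:E).
Proof. by move=> /cmeas_n1 ?; exact/measurable_EFinP. Qed.

Definition cintg f := cmeas f /\ (\int[mu]_x (n1 (f x))%:E < +oo)%E.

Definition cI f : R[i] := Rintegral mu setT (fun x => complex.Re (f x)) +i*
  Rintegral mu setT (fun x => complex.Im (f x)).

Lemma cintg_le f (h : T -> R) : cmeas f -> (forall x, n1 (f x) <= h x) ->
  measurable_fun setT h -> (\int[mu]_x (h x)%:E < +oo)%E -> cintg f.
Proof.
move=> mf fh mh ih; split => //; apply: le_lt_trans ih.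
apply: ge0_le_integral => //.
- by move=> x _; rewrite lee_fin n1_ge0.
- exact: cmeas_n1E.
- exact/measurable_EFinP.
- by move=> x _; rewrite lee_fin.
Qed.

Lemma cintg_Re f : cintg f -> mu.-integrable setT (EFin \o (fun x => complex.Re (f x))).
Proof.
move=> [mf fi]; apply/integrableP; split; first exact/measurable_EFinP/(proj1 mf).
apply: le_lt_trans fi; apply: ge0_le_integral => //.
- by apply: measurableT_comp => //; exact/measurable_EFinP/(proj1 mf).
- exact: cmeas_n1E.
- by move=> x _; rewrite /= lee_fin ler_Re_n1.
Qed.

Lemma cintg_Im f : cintg f -> mu.-integrable setT (EFin \o (fun x => complex.Im (f x))).
Proof.
move=> [mf fi]; apply/integrableP; split; first exact/measurable_EFinP/(proj2 mf).
apply: le_lt_trans fi; apply: ge0_le_integral => //.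
- by apply: measurableT_comp => //; exact/measurable_EFinP/(proj2 mf).
- exact: cmeas_n1E.
- by move=> x _; rewrite /= lee_fin ler_Im_n1.
Qed.

Lemma cintgP f : cintg f <-> mu.-integrable setT (EFin \o (fun x => complex.Re (f x))) /\
  mu.-integrable setT (EFin \o (fun x => complex.Im (f x))).
Proof.
split=> [h|[hr hi]]; first by split; [exact: cintg_Re|exact: cintg_Im].
have mf : cmeas f.
  by split; apply/measurable_EFinP; [case/integrableP: hr|case/integrableP: hi].
split => //.
have /integrableP[_ h] := integrableD measurableT (integrable_abse hr) (integrable_abse hi).
apply: le_lt_trans h; apply: ge0_le_integral => //=.
- by move=> x _; rewrite lee_fin n1_ge0.
- exact: cmeas_n1E.
- by apply/measurable_EFinP; apply: measurableT_comp => //; exact: cmeas_n1.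
- by move=> x _; rewrite lee_fin ger0_norm// addr_ge0.
Qed.

Lemma cintgD f g : cintg f -> cintg g -> cintg (fun x => f x + g x).
Proof.
move=> [mf fi] [mg gi]; apply: (@cintg_le _ (fun x => n1 (f x) + n1 (g x))).
- exact: cmeasD.
- by move=> x; exact: n1D.
- by apply: measurable_funD; exact: cmeas_n1.
- under eq_integral do rewrite EFinD.
  rewrite ge0_integralD//; first exact: lte_add_pinfty.
  + by move=> x _; rewrite lee_fin n1_ge0.
  + exact: cmeas_n1E.
  + by move=> x _; rewrite lee_fin n1_ge0.
  + exact: cmeas_n1E.
Qed.

Lemma cintgN f : cintg f -> cintg (fun x => - f x).
Proof.
move=> [mf fi]; split; first exact: cmeasN.
by under eq_integral do rewrite n1N.
Qed.

Lemma cintgB f g : cintg f -> cintg g -> cintg (fun x => f x - g x).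
Proof. by move=> mf /cintgN; exact: cintgD. Qed.

Lemma cintgZl z f : cintg f -> cintg (fun x => z * f x).
Proof.
move=> [mf fi]; apply: (@cintg_le _ (fun x => n1 z * n1 (f x))).
- by apply: cmeasM => //; exact: cmeas_cst.
- by move=> x; exact: n1M.
- by apply: measurable_funM => //; exact: cmeas_n1.
- under eq_integral do rewrite EFinM.
  rewrite ge0_integralZl_EFin//.
  + by apply: lte_mul_pinfty => //; rewrite lee_fin n1_ge0.
  + by move=> x _; rewrite lee_fin n1_ge0.
  + exact: cmeas_n1E.
  + exact: n1_ge0.
Qed.

Lemma cintgZr z f : cintg f -> cintg (fun x => f x * z).
Proof. by move=> /(cintgZl z); under eq_fun do rewrite mulrC. Qed.

Lemma cintg0 : cintg (fun=> 0).
Proof.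
split; first exact: cmeas_cst.
by under eq_integral do rewrite n1_0; rewrite integral0.
Qed.

Lemma cintg_sum (I : Type) (s : seq I) (F : I -> T -> R[i]) :
  (forall i, cintg (F i)) -> cintg (fun x => \sum_(i <- s) F i x).
Proof.
move=> mF; elim: s => [|i s IH].
  by under eq_fun do rewrite big_nil; exact: cintg0.
by under eq_fun do rewrite big_cons; exact: cintgD.
Qed.

Lemma Re_cI f : complex.Re (cI f) = Rintegral mu setT (fun x => complex.Re (f x)).
Proof. by []. Qed.
Lemma Im_cI f : complex.Im (cI f) = Rintegral mu setT (fun x => complex.Im (f x)).
Proof. by []. Qed.

Lemma eq_cI f g : f =1 g -> cI f = cI g.
Proof. by move=> /funext ->. Qed.

Lemma cID f g : cintg f -> cintg g -> cI (fun x => f x + g x) = cI f + cI g.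
Proof.
move=> fi gi; apply/complexP; rewrite !(ReImE, Re_cI, Im_cI).
- under eq_Rintegral do rewrite cReD.
  by rewrite RintegralD//; exact: cintg_Re.
- under eq_Rintegral do rewrite cImD.
  by rewrite RintegralD//; exact: cintg_Im.
Qed.

Lemma cIZl z f : cintg f -> cI (fun x => z * f x) = z * cI f.
Proof.
move=> fi; have fr := cintg_Re fi; have fm := cintg_Im fi.
have Z r (h : T -> R) : mu.-integrable setT (EFin \o h) ->
   mu.-integrable setT (EFin \o (fun x => r * h x)).
  by move=> hi; exact: (@integrableZl _ _ _ mu setT measurableT r (EFin \o h)).
apply/complexP; rewrite !(ReImE, Re_cI, Im_cI).
- under eq_Rintegral do rewrite cReM.
  by rewrite RintegralB ?RintegralZl//; exact: Z.
- under eq_Rintegral do rewrite cImM.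
  by rewrite RintegralD ?RintegralZl//; exact: Z.
Qed.

Lemma cIZr z f : cintg f -> cI (fun x => f x * z) = cI f * z.
Proof. by move=> fi; rewrite mulrC -cIZl//; apply: eq_cI => x; rewrite mulrC. Qed.

Lemma cIN f : cintg f -> cI (fun x => - f x) = - cI f.
Proof.
by move=> fi; rewrite -mulN1r -cIZl//; apply: eq_cI => x; rewrite mulN1r.
Qed.

Lemma cIB f g : cintg f -> cintg g -> cI (fun x => f x - g x) = cI f - cI g.
Proof. by move=> fi gi; rewrite cID ?cIN//; exact: cintgN. Qed.

Lemma cI0 : cI (fun=> 0) = 0.
Proof. by apply/complexP; rewrite /= /Rintegral integral0. Qed.

Lemma cI_sum (I : Type) (s : seq I) (F : I -> T -> R[i]) :
  (forall i, cintg (F i)) -> cI (fun x => \sum_(i <- s) F i x) = \sum_(i <- s) cI (F i).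
Proof.
move=> iF; elim: s => [|i s IH].
  by rewrite big_nil; under eq_cI do rewrite big_nil; exact: cI0.
rewrite big_cons -IH -cID//; last exact: cintg_sum.
by apply: eq_cI => x; rewrite big_cons.
Qed.

Lemma ae_eq_cI f g : cmeas f -> cmeas g -> {ae mu, forall x, f x = g x} -> cI f = cI g.
Proof.
move=> [f1 f2] [g1 g2] fg.
apply/complexP => /=; congr fine; apply: ae_eq_integral => //; try exact/measurable_EFinP;
 by apply: filterS fg => x /= -> .
Qed.

Lemma ae_cintg f g : cmeas f -> cintg g -> {ae mu, forall x, f x = g x} -> cintg f.
Proof.
move=> mf [mg ig] fg; split => //.
rewrite (@ae_eq_integral _ _ _ mu setT (fun x => (n1 (g x))%:E)) //.
- exact: cmeas_n1E.
- exact: cmeas_n1E.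
- by apply: filterS fg => x /= -> .
Qed.

Lemma normr_fine_le (e : \bar R) : (`|fine e|%:E <= `|e|)%E.
Proof. by case: e => //= [|]; rewrite normr0 leey. Qed.

(** Componentwise, since [n1] splits an integral into its real and imaginary parts. Where an
    integral is infinite, [fine] returns 0, so the bound persists. *)
Lemma le_n1_cI f : cmeas f -> ((n1 (cI f))%:E <= \int[mu]_x (n1 (f x))%:E)%E.
Proof.
move=> [f1 f2]; rewrite /n1 /= EFinD.
under [leRHS]eq_integral do rewrite EFinD.
rewrite ge0_integralD//; last 2 first.
- by apply/measurable_EFinP; exact: measurableT_comp.
- by apply/measurable_EFinP; exact: measurableT_comp.
apply: leeD; (apply: le_trans (normr_fine_le _) _;
  apply: le_trans (le_abse_integral _ _ _) _ => //; exact/measurable_EFinP).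
Qed.

End ComplexIntegral.

Lemma ae_lty d (T : measurableType d) (R : realType) (mu : {measure set T -> \bar R})
    (f : T -> \bar R) : (forall x, 0 <= f x)%E -> measurable_fun setT f ->
  (\int[mu]_x f x < +oo)%E -> {ae mu, forall x, (f x < +oo)%E}.
Proof.
move=> f0 mf fi.
have : mu.-integrable setT f.
  apply/integrableP; split => //.
  by under eq_integral do rewrite gee0_abs//.
move/integrable_ae => /(_ measurableT); apply: filterS => x /= /(_ I) h.
by rewrite -ge0_fin_numE.
Qed.

Lemma integral_eq0_ae d (T : measurableType d) (R : realType) (mu : {measure set T -> \bar R})
    (h : T -> R) : (forall x, 0 <= h x) -> measurable_fun setT h ->
  (\int[mu]_x (h x)%:E = 0)%E <-> {ae mu, forall x, h x = 0}.
Proof.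
move=> h0 mh.
have mE : measurable_fun setT (EFin \o h) by exact/measurable_EFinP.
have [A B] := @ae_eq_integral_abs _ T R mu setT measurableT (EFin \o h) mE.
have e : (\int[mu]_x (h x)%:E = \int[mu]_x `|(EFin \o h) x|)%E.
  by apply: eq_integral => x _ /=; rewrite (ger0_norm (h0 _)).
rewrite e; split.
- by move=> /A; apply: filterS => x /(_ I) [].
- by move=> H; apply: B; apply: filterS H => x /= -> _.
Qed.

Lemma ae_n1_0 d (T : measurableType d) (R : realType) (mu : {measure set T -> \bar R})
    (f : T -> R[i]) : cmeas f -> (\int[mu]_x (n1 (f x))%:E = 0)%E ->
  {ae mu, forall x, f x = 0}.
Proof.
move=> mf /integral_eq0_ae H.
have := H (fun x => n1_ge0 (f x)) (cmeas_n1 mf).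
by apply: filterS => x /n1_eq0.
Qed.

(** * Parameter integrals and Fubini's theorem for complex functions *)

Section ComplexFubini.
Context d1 d2 (T1 : measurableType d1) (T2 : measurableType d2) (R : realType).
Variable m1 : {sigma_finite_measure set T1 -> \bar R}.
Variable m2 : {sigma_finite_measure set T2 -> \bar R}.
Implicit Types F : T1 * T2 -> R[i].

Lemma cmeas_comp d (T : measurableType d) (p : T -> T1) (f : T1 -> R[i]) :
  measurable_fun setT p -> cmeas f -> cmeas (fun x => f (p x)).
Proof.
move=> mp [f1 f2]; split.
- exact: (measurableT_comp f1 mp).
- exact: (measurableT_comp f2 mp).
Qed.

Lemma cmeas_sec1 F x : cmeas F -> cmeas (fun y => F (x, y)).
Proof.
move=> [f1 f2]; split.
- exact: (measurableT_comp f1).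
- exact: (measurableT_comp f2).
Qed.

Lemma cmeas_sec2 F y : cmeas F -> cmeas (fun x => F (x, y)).
Proof.
move=> [f1 f2]; split.
- exact: (measurableT_comp f1).
- exact: (measurableT_comp f2).
Qed.

(** The parameter integral is a total function of [x]. Writing it as a difference of integrals of
    positive and negative parts brings it within reach of Tonelli, including at those [x] whose
    section is not integrable. *)
Lemma measurable_Rintegral_param (f : T1 * T2 -> R) : measurable_fun setT f ->
  measurable_fun setT (fun x => Rintegral m2 setT (fun y => f (x, y))).
Proof.
move=> mf; rewrite /Rintegral.
apply: (measurableT_comp (@fine_measurable R setT measurableT)) => //.
have mE : measurable_fun setT (EFin \o f) by exact/measurable_EFinP.
rewrite (_ : (fun x => _) = (fun x => \int[m2]_y (EFin \o f)^\+%E (x, y)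
    - \int[m2]_y (EFin \o f)^\-%E (x, y))%E); last first.
  apply/funext=> x; rewrite [LHS]integralE.
  by congr (_ - _)%E; apply: eq_integral => y _; rewrite (funeposE, funenegE) (funeposE, funenegE).
apply: emeasurable_funB.
- by apply: (measurable_fun_fubini_tonelli_F (EFin \o f)^\+%E) => //; exact: measurable_funepos.
- by apply: (measurable_fun_fubini_tonelli_F (EFin \o f)^\-%E) => //; exact: measurable_funeneg.
Qed.

Lemma cmeas_param F : cmeas F -> cmeas (fun x => cI m2 (fun y => F (x, y))).
Proof.
move=> [f1 f2]; split.
- exact: (measurable_Rintegral_param f1).
- exact: (measurable_Rintegral_param f2).
Qed.

Variable F : T1 * T2 -> R[i].
Hypothesis mF : cmeas F.
Hypothesis iF : (\int[m1]_x \int[m2]_y (n1 (F (x, y)))%:E < +oo)%E.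

Let iRe : (m1 \x m2)%E.-integrable setT (EFin \o (fun p => complex.Re (F p))).
Proof.
have mE : measurable_fun setT (EFin \o (fun p => complex.Re (F p))).
  by apply/measurable_EFinP; exact: (proj1 mF).
apply/(integrable12ltyP _ _ mE).
apply: le_lt_trans iF; apply: ge0_le_integral => //.
- by move=> x _; apply: integral_ge0.
- apply: (measurable_fun_fubini_tonelli_F (fun p => (`|complex.Re (F p)|)%:E)) => //=.
  by apply/measurable_EFinP; apply: measurableT_comp => //; exact: (proj1 mF).
- apply: (measurable_fun_fubini_tonelli_F (fun p => (n1 (F p))%:E)) => //=.
  + exact: cmeas_n1E.
  + by move=> p; rewrite lee_fin n1_ge0.
- move=> x _; apply: ge0_le_integral => //.
  + by apply/measurable_EFinP; apply: measurableT_comp => //; exact: (proj1 (cmeas_sec1 x mF)).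
  + by apply: cmeas_n1E; exact: cmeas_sec1.
  + by move=> y _; rewrite /= lee_fin ler_Re_n1.
Qed.

Let iIm : (m1 \x m2)%E.-integrable setT (EFin \o (fun p => complex.Im (F p))).
Proof.
have mE : measurable_fun setT (EFin \o (fun p => complex.Im (F p))).
  by apply/measurable_EFinP; exact: (proj2 mF).
apply/(integrable12ltyP _ _ mE).
apply: le_lt_trans iF; apply: ge0_le_integral => //.
- by move=> x _; apply: integral_ge0.
- apply: (measurable_fun_fubini_tonelli_F (fun p => (`|complex.Im (F p)|)%:E)) => //=.
  by apply/measurable_EFinP; apply: measurableT_comp => //; exact: (proj2 mF).
- apply: (measurable_fun_fubini_tonelli_F (fun p => (n1 (F p))%:E)) => //=.
  + exact: cmeas_n1E.
  + by move=> p; rewrite lee_fin n1_ge0.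
- move=> x _; apply: ge0_le_integral => //.
  + by apply/measurable_EFinP; apply: measurableT_comp => //; exact: (proj2 (cmeas_sec1 x mF)).
  + by apply: cmeas_n1E; exact: cmeas_sec1.
  + by move=> y _; rewrite /= lee_fin ler_Im_n1.
Qed.

Lemma ae_cintg_sec1 : {ae m1, forall x, cintg m2 (fun y => F (x, y))}.
Proof.
apply: filterS (ae_lty _ _ iF).
- by move=> x h; split => //; exact: cmeas_sec1.
- by move=> x; apply: integral_ge0 => y _; rewrite lee_fin n1_ge0.
- apply: (measurable_fun_fubini_tonelli_F (fun p => (n1 (F p))%:E)) => //=.
  + exact: cmeas_n1E.
  + by move=> p; rewrite lee_fin n1_ge0.
Qed.

(** The inner [Rintegral] passes through [fine], which is faithful only for almost every value of
    the outer variable; elsewhere the section may fail to be integrable. Hence the two a.e.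
    replacements around the extended-real theorem. *)
Lemma Rfubini (f : T1 * T2 -> R) : (m1 \x m2)%E.-integrable setT (EFin \o f) ->
  Rintegral m1 setT (fun x => Rintegral m2 setT (fun y => f (x, y))) =
  Rintegral m2 setT (fun y => Rintegral m1 setT (fun x => f (x, y))).
Proof.
move=> fi; have fF := Fubini fi.
have A1 := ae_integrable1 fi; have A2 := ae_integrable2 fi.
have mf : measurable_fun setT f by apply/measurable_EFinP; exact: measurable_int fi.
have mE : measurable_fun setT (EFin \o f) by exact/measurable_EFinP.
rewrite /Rintegral; congr fine.
rewrite (@ae_eq_integral _ _ _ m1 setT (fun x => \int[m2]_y (f (x, y))%:E)%E); last 4 first.
- by [].
- by apply/measurable_EFinP; exact: measurable_Rintegral_param.
- exact: measurable_fubini_F fi.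
- by apply: filterS A1 => x h _; rewrite fineK//; exact: integrable_fin_num.
rewrite [LHS]fF; apply/esym.
apply: ae_eq_integral => //.
- apply/measurable_EFinP.
  have := @measurable_fubini_G _ _ _ _ _ _ _ _ fi.
  by move=> /(measurableT_comp (@fine_measurable R setT measurableT)); exact.
- exact: measurable_fubini_G fi.
- by apply: filterS A2 => x h _; rewrite fineK//; exact: integrable_fin_num.
Qed.

Lemma cFubini : cI m1 (fun x => cI m2 (fun y => F (x, y))) =
  cI m2 (fun y => cI m1 (fun x => F (x, y))).
Proof.
apply/complexP; rewrite !(Re_cI, Im_cI).
- exact: (Rfubini iRe).
- exact: (Rfubini iIm).
Qed.

(** By Tonelli the double integral of [h] vanishes in one order, hence in the other. An identity
    known for each xi at a.e. x thus becomes, at a.e. x, an identity for a.e. xi, which is the form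
    needed under an integral in xi. *)
Lemma ae_swap (h : T1 * T2 -> R) : measurable_fun setT h -> (forall p, 0 <= h p) ->
  {ae m2, forall y, {ae m1, forall x, h (x, y) = 0}} ->
  {ae m1, forall x, {ae m2, forall y, h (x, y) = 0}}.
Proof.
move=> mh h0 H.
have mE : measurable_fun setT (EFin \o h) by exact/measurable_EFinP.
have h0E p : (0 <= (EFin \o h) p)%E by rewrite lee_fin.
have e0 : (\int[m1]_x \int[m2]_y (EFin \o h) (x, y) = 0)%E.
  rewrite fubini_tonelli//.
  rewrite (@ae_eq_integral _ _ _ m2 setT (cst 0%E)) ?integral0//.
  - exact: measurable_fun_fubini_tonelli_G.
  - apply: filterS H => y hy _ /=; apply/integral_eq0_ae => //.
    exact: measurableT_comp.
have mF0 : measurable_fun setT (fun x => \int[m2]_y (EFin \o h) (x, y))%E.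
  exact: measurable_fun_fubini_tonelli_F.
have ge0 x : (0 <= \int[m2]_y (EFin \o h) (x, y))%E by exact: integral_ge0.
have [+ _] := @ae_eq_integral_abs _ T1 R m1 setT measurableT _ mF0.
have e1 : (\int[m1]_x `|\int[m2]_y (EFin \o h) (x, y)| = 0)%E.
  by rewrite -[RHS]e0; apply: eq_integral => x _; rewrite gee0_abs.
move=> /(_ e1); apply: filterS => x /= /(_ I) /= h1.
apply/integral_eq0_ae => //; exact: measurableT_comp.
Qed.

End ComplexFubini.

(** * Kernel operators and their resolvents *)

Section AbsoluteSums.
Variable R : realType.
Implicit Types (r : nat -> R) (z : nat -> R[i]).

Definition rsum r : R :=
  fine (\sum_(k <oo) (Num.max (r k) 0)%:E) - fine (\sum_(k <oo) (Num.max (- r k) 0)%:E).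

(* A sum of complex numbers as a total, measurable function of the terms. *)
Definition csum z : R[i] :=
  rsum (fun k => complex.Re (z k)) +i* rsum (fun k => complex.Im (z k)).

Lemma max0_ge0 (x : R) : 0 <= Num.max x 0.
Proof. by rewrite le_max lexx orbT. Qed.

Lemma max0B (x : R) : Num.max x 0 - Num.max (- x) 0 = x.
Proof. by rewrite !maxEle; case: ifPn; case: ifPn; rewrite -?ltNge => *; lra. Qed.

Lemma max0D (x : R) : Num.max x 0 + Num.max (- x) 0 = `|x|.
Proof.
have [h|h] := boolP (0 <= x).
  by rewrite ger0_norm// !maxEle; case: ifPn; case: ifPn; rewrite -?ltNge => *; lra.
by rewrite ltr0_norm ?ltNge// !maxEle; case: ifPn; case: ifPn; move: h; rewrite -?ltNge => *; lra.
Qed.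

(** Positive and negative parts are summed separately, as in [rsum]. Absolute convergence makes both
    sums finite, so that the first [N] terms can be split off inside [fine]. The case [N = 0] bounds
    the sum itself. *)
Lemma rsum_tail r N : (\sum_(k <oo) (`|r k|)%:E < +oo)%E ->
  ((`|rsum r - \sum_(k < N) r k|)%:E <= \sum_(k <oo) (`|r (N + k)%N|)%:E)%E.
Proof.
move=> rfin.
pose p k := (Num.max (r k) 0)%:E; pose q k := (Num.max (- r k) 0)%:E.
have p0 k : (0 <= p k)%E by rewrite lee_fin max0_ge0.
have q0 k : (0 <= q k)%E by rewrite lee_fin max0_ge0.
have tail (f : nat -> \bar R) : (forall k, 0 <= f k)%E ->
    (\sum_(k <oo) f k = \sum_(k < N) f k + \sum_(k <oo) f (N + k)%N)%E.
  move=> f0; rewrite (@nneseries_split _ f 0%N N)//; congr (_ + _)%E.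
    by rewrite add0n big_mkord.
  by rewrite add0n -nneseries_addn//; apply: eq_eseriesr => k _; rewrite addnC.
have le_fin (f : nat -> \bar R) : (forall k, 0 <= f k)%E -> (forall k, f k <= (`|r k|)%:E)%E ->
    (\sum_(k <oo) f k)%E \is a fin_num.
  move=> f0 fr; rewrite ge0_fin_numE ?nneseries_ge0//.
  by apply: le_lt_trans rfin; apply: lee_nneseries => // k _.
have pr k : (p k <= (`|r k|)%:E)%E.
  by rewrite lee_fin -max0D lerDl max0_ge0.
have qr k : (q k <= (`|r k|)%:E)%E.
  by rewrite lee_fin -max0D lerDr max0_ge0.
have pf := le_fin _ p0 pr; have qf := le_fin _ q0 qr.
have sumE (f : nat -> R) : (\sum_(k < N) (f k)%:E)%E = (\sum_(k < N) f k)%:E.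
  by rewrite sumEFin.
have tfin (f : nat -> \bar R) : (forall k, 0 <= f k)%E -> (\sum_(k <oo) f k)%E \is a fin_num ->
    (\sum_(k <oo) f (N + k)%N)%E \is a fin_num.
  move=> f0; rewrite (tail f f0) ge0_fin_numE ?adde_ge0 ?nneseries_ge0 ?sume_ge0//.
  move=> h; rewrite ge0_fin_numE ?nneseries_ge0//; apply: le_lt_trans h.
  by rewrite leeDr// sume_ge0.
have ptf := tfin _ p0 pf; have qtf := tfin _ q0 qf.
have -> : rsum r - \sum_(k < N) r k =
    fine (\sum_(k <oo) p (N + k)%N) - fine (\sum_(k <oo) q (N + k)%N).
  rewrite /rsum -/p -/q (tail p p0) (tail q q0).
  rewrite (sumE (fun k => Num.max (r k) 0)) (sumE (fun k => Num.max (- r k) 0)) !fineD//=.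
  rewrite addrAC opprD addrACA -addrA.
  have <- : \sum_(k < N) Num.max (r k) 0 - \sum_(k < N) Num.max (- r k) 0 = \sum_(k < N) r k.
    by rewrite -sumrB; apply: eq_bigr => k _; rewrite max0B.
  ring.
apply: le_trans (_ : (fine (\sum_(k <oo) p (N + k)%N) + fine (\sum_(k <oo) q (N + k)%N))%:E <= _)%E.
  rewrite lee_fin (le_trans (ler_normB _ _))//.
  by rewrite !ger0_norm ?fine_ge0 ?nneseries_ge0.
rewrite EFinD !fineK// -nneseriesD//; apply: lee_nneseries => [k _ _|k _].
  by rewrite adde_ge0.
by rewrite /p /q -EFinD max0D.
Qed.

Lemma csum_tail z N : (\sum_(k <oo) (n1 (z k))%:E < +oo)%E ->
  ((n1 (csum z - \sum_(k < N) z k))%:E <= \sum_(k <oo) (n1 (z (N + k)%N))%:E)%E.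
Proof.
move=> zfin; rewrite /n1 cReB cImB Re_sum Im_sum EFinD.
have h1 : (\sum_(k <oo) (`|complex.Re (z k)|)%:E < +oo)%E.
  by apply: le_lt_trans zfin; apply: lee_nneseries => // k _; rewrite lee_fin ler_Re_n1.
have h2 : (\sum_(k <oo) (`|complex.Im (z k)|)%:E < +oo)%E.
  by apply: le_lt_trans zfin; apply: lee_nneseries => // k _; rewrite lee_fin ler_Im_n1.
rewrite [leRHS](_ : _ = (\sum_(k <oo) ((`|complex.Re (z (N + k)%N)|)%:E +
  (`|complex.Im (z (N + k)%N)|)%:E))%E); last by apply: eq_eseriesr => k _; rewrite EFinD.
rewrite nneseriesD//; apply: leeD; exact: rsum_tail.
Qed.

End AbsoluteSums.

Lemma cmeas_csum d (T : measurableType d) (R : realType) (F : nat -> T -> R[i]) :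
  (forall k, cmeas (F k)) -> cmeas (fun x => csum (fun k => F k x)).
Proof.
move=> mF.
suff H (h : nat -> T -> R) : (forall k, measurable_fun setT (h k)) ->
    measurable_fun setT (fun x => rsum (fun k => h k x)).
  by split; apply: H => k; [exact: (proj1 (mF k))|exact: (proj2 (mF k))].
move=> mh.
suff S (g : nat -> T -> R) : (forall k, measurable_fun setT (g k)) ->
    measurable_fun setT (fun x => fine (\sum_(k <oo) (Num.max (g k x) 0)%:E)%E).
  by apply: measurable_funB; apply: S => // k; exact: measurableT_comp.
move=> mg; apply: (measurableT_comp (@fine_measurable R setT measurableT)) => //.
apply: ge0_emeasurable_sum => [k x _ _|k _]; first by rewrite lee_fin max0_ge0.
by apply/measurable_EFinP; exact: measurable_maxr.
Qed.

Section KernelOperators.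
Context d (T : measurableType d) (R : realType).
Variable m : {sigma_finite_measure set T -> \bar R}.
Implicit Types (A B : T -> T -> R[i]) (f g : T -> R[i]) (w : T -> R) (C : R).

Definition kmeas A := cmeas (fun p : T * T => A p.1 p.2).

Definition Op A f : T -> R[i] := fun x => cI m (fun t => A x t * f t).

(** Schur's column condition: under it [Op A] has norm at most [C] on L1 weighted by [w]. *)
Definition COL w A C := forall t, (\int[m]_x (w x * n1 (A x t))%:E <= (C * w t)%:E)%E.

Lemma kmeas1 A x : kmeas A -> cmeas (A x).
Proof. exact: cmeas_sec1. Qed.

Lemma kmeas2 A t : kmeas A -> cmeas (A ^~ t).
Proof. exact: (@cmeas_sec2 _ _ _ _ _ (fun p => A p.1 p.2)). Qed.

Lemma cmeas_Op A f : kmeas A -> cmeas f -> cmeas (Op A f).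
Proof.
move=> mA mf; apply: (@cmeas_param _ _ _ _ _ m (fun p => A p.1 p.2 * f p.2)).
by apply: cmeasM => //; apply: cmeas_comp.
Qed.

(** [Op A (B ^~ xi) x] is the kernel of the product of the two operators; its joint measurability
    lets products and iterates of kernels be treated as kernels again. *)
Lemma kmeas_Op A B : kmeas A -> kmeas B -> kmeas (fun x xi => Op A (B ^~ xi) x).
Proof.
move=> mA mB; rewrite /kmeas.
apply: (@cmeas_param _ _ _ _ _ m (fun q : (T * T) * T => A q.1.1 q.2 * B q.2 q.1.2)).
apply: cmeasM.
- apply: (@cmeas_comp _ _ _ _ _ (fun q : (T * T) * T => (q.1.1, q.2)) (fun p => A p.1 p.2)) => //.
  apply: measurable_fun_pair => //; exact: measurableT_comp.
- apply: (@cmeas_comp _ _ _ _ _ (fun q : (T * T) * T => (q.2, q.1.2)) (fun p => B p.1 p.2)) => //.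
  apply: measurable_fun_pair => //; exact: measurableT_comp.
Qed.

Section Bound.
Variables (w : T -> R) (A : T -> T -> R[i]) (C : R) (f : T -> R[i]).
Hypotheses (w0 : forall x, 0 <= w x) (mw : measurable_fun setT w).
Hypotheses (mA : kmeas A) (CA : COL w A C) (C0 : 0 <= C) (mf : cmeas f).

Lemma double_bound :
  (\int[m]_x \int[m]_t (w x * (n1 (A x t) * n1 (f t)))%:E <= C%:E * \int[m]_t (w t * n1 (f t))%:E)%E.
Proof.
have mn : measurable_fun setT (fun p : T * T => w p.1 * (n1 (A p.1 p.2) * n1 (f p.2))).
  apply: measurable_funM; first exact: measurableT_comp.
  apply: measurable_funM; first exact: (cmeas_n1 mA).
  by apply: (measurableT_comp (cmeas_n1 mf)).
have mwA t : measurable_fun setT (fun x => w x * n1 (A x t)).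
  by apply: measurable_funM => //; apply: cmeas_n1; exact: kmeas2.
have ge0 p : (0 <= (w p.1 * (n1 (A p.1 p.2) * n1 (f p.2)))%:E)%E.
  by rewrite lee_fin !mulr_ge0 ?n1_ge0.
rewrite (fubini_tonelli (fun p : T * T => (w p.1 * (n1 (A p.1 p.2) * n1 (f p.2)))%:E))//=; last first.
  exact/measurable_EFinP.
rewrite -ge0_integralZl_EFin//; last 2 first.
- by move=> x _; rewrite lee_fin mulr_ge0 ?n1_ge0.
- by apply/measurable_EFinP; apply: measurable_funM => //; exact: cmeas_n1.
apply: ge0_le_integral => //.
- by move=> x _; apply: integral_ge0 => y _; exact: (ge0 (y, x)).
- apply: (measurable_fun_fubini_tonelli_G (fun p => (w p.1 * (n1 (A p.1 p.2) * n1 (f p.2)))%:E)) => //.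
  exact/measurable_EFinP.
- apply: emeasurable_funM => //; apply/measurable_EFinP.
  by apply: measurable_funM => //; exact: cmeas_n1.
- move=> t _.
  rewrite (_ : (C%:E * _ = (C * w t)%:E * (n1 (f t))%:E)%E); last by rewrite -!EFinM mulrA.
  apply: le_trans (_ : _ <= (\int[m]_x (w x * n1 (A x t))%:E) * (n1 (f t))%:E)%E _; last first.
    by apply: lee_wpmul2r => //; rewrite lee_fin n1_ge0.
  rewrite -ge0_integralZr//.
  + rewrite le_eqVlt; apply/orP; left; apply/eqP; apply: eq_integral => x _.
    by rewrite mulrA EFinM.
  + exact/measurable_EFinP.
  + by move=> x _; rewrite lee_fin mulr_ge0 ?n1_ge0.
  + by rewrite lee_fin n1_ge0.
Qed.

Lemma Op_bound :
  (\int[m]_x (w x * n1 (Op A f x))%:E <= C%:E * \int[m]_t (w t * n1 (f t))%:E)%E.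
Proof.
apply: le_trans double_bound; apply: ge0_le_integral => //.
- by move=> x _; rewrite lee_fin mulr_ge0 ?n1_ge0.
- by apply/measurable_EFinP/measurable_funM => //; apply: cmeas_n1; exact: cmeas_Op.
- apply: (measurable_fun_fubini_tonelli_F (fun p => (w p.1 * (n1 (A p.1 p.2) * n1 (f p.2)))%:E)) => //.
  + apply/measurable_EFinP; apply: measurable_funM; first exact: measurableT_comp.
    apply: measurable_funM; first exact: (cmeas_n1 mA).
    by apply: (measurableT_comp (cmeas_n1 mf)).
  + by move=> p; rewrite lee_fin !mulr_ge0 ?n1_ge0.
- move=> x _.
  have mAf : cmeas (fun t => A x t * f t) by apply: cmeasM => //; exact: kmeas1.
  have := le_n1_cI m mAf; rewrite -/(Op A f x) => h.
  rewrite EFinM; under eq_integral do rewrite EFinM.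
  rewrite ge0_integralZl_EFin//; last 2 first.
  + by move=> t _; rewrite lee_fin mulr_ge0 ?n1_ge0.
  + apply/measurable_EFinP/measurable_funM; last exact: cmeas_n1.
    by apply: cmeas_n1; exact: kmeas1.
  apply: lee_wpmul2l; first by rewrite lee_fin.
  apply: le_trans h _; apply: ge0_le_integral => //.
  + by move=> t _; rewrite lee_fin n1_ge0.
  + exact: cmeas_n1E.
  + apply/measurable_EFinP/measurable_funM; last exact: cmeas_n1.
    by apply: cmeas_n1; exact: kmeas1.
  + by move=> t _; rewrite lee_fin n1M.
Qed.

End Bound.

Definition bnd A C := forall t, (\int[m]_x (n1 (A x t))%:E <= C%:E)%E.

Lemma bnd_COL A C : bnd A C <-> COL (fun=> 1) A C.
Proof.
by split=> h t; have := h t; under eq_integral do rewrite ?mul1r; rewrite ?mulr1;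
 under [X in _ -> (X <= _)%E]eq_integral do rewrite ?mul1r; rewrite ?mulr1.
Qed.

End KernelOperators.

Section Associativity.
Context d (T : measurableType d) (R : realType).
Variable m : {sigma_finite_measure set T -> \bar R}.
Implicit Types (A B : T -> T -> R[i]) (f g : T -> R[i]) (C : R).

Let mul1E (h : T -> R) : (\int[m]_x (1 * h x)%:E = \int[m]_x (h x)%:E)%E.
Proof. by under eq_integral do rewrite mul1r. Qed.

Lemma double_n1 A C f : kmeas A -> bnd m A C -> 0 <= C -> cmeas f ->
  (\int[m]_x \int[m]_t (n1 (A x t) * n1 (f t))%:E <= C%:E * \int[m]_x (n1 (f x))%:E)%E.
Proof.
move=> mA bA C0 mf.
have := @double_bound _ T R m (fun=> 1) A C f (fun=> ler01) (measurable_cst _) mA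
  ((bnd_COL _ _ _).1 bA) C0 mf.
by rewrite mul1E; under [X in (X <= _)%E -> _]eq_integral do rewrite mul1E.
Qed.

Lemma Op_n1 A C f : kmeas A -> bnd m A C -> 0 <= C -> cmeas f ->
  (\int[m]_x (n1 (Op m A f x))%:E <= C%:E * \int[m]_x (n1 (f x))%:E)%E.
Proof.
move=> mA bA C0 mf.
have := @Op_bound _ T R m (fun=> 1) A C f (fun=> ler01) (measurable_cst _) mA
  ((bnd_COL _ _ _).1 bA) C0 mf.
by rewrite !mul1E.
Qed.

Lemma Op_intg A C f : kmeas A -> bnd m A C -> 0 <= C -> cintg m f -> cintg m (Op m A f).
Proof.
move=> mA bA C0 [mf fi]; split; first exact: cmeas_Op.
apply: le_lt_trans (Op_n1 mA bA C0 mf) _.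
by apply: lte_mul_pinfty => //; rewrite lee_fin.
Qed.

Lemma ae_double A C f : kmeas A -> bnd m A C -> 0 <= C -> cintg m f ->
  {ae m, forall x, (\int[m]_t (n1 (A x t) * n1 (f t))%:E < +oo)%E}.
Proof.
move=> mA bA C0 [mf fi].
apply: ae_lty.
- by move=> x; apply: integral_ge0 => t _; rewrite lee_fin mulr_ge0 ?n1_ge0.
- apply: (measurable_fun_fubini_tonelli_F (fun p : T * T => (n1 (A p.1 p.2) * n1 (f p.2))%:E)) => //.
  + apply/measurable_EFinP; apply: measurable_funM; first exact: (cmeas_n1 mA).
    by apply: (measurableT_comp (cmeas_n1 mf)).
  + by move=> p; rewrite lee_fin mulr_ge0 ?n1_ge0.
- apply: le_lt_trans (double_n1 mA bA C0 mf) _.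
  by apply: lte_mul_pinfty => //; rewrite lee_fin.
Qed.

Lemma ae_Op_intg A C f : kmeas A -> bnd m A C -> 0 <= C -> cintg m f ->
  {ae m, forall x, cintg m (fun t => A x t * f t)}.
Proof.
move=> mA bA C0 fi; apply: filterS (ae_double mA bA C0 fi) => x h.
have [mf _] := fi.
apply: cintg_le h.
- by apply: cmeasM => //; exact: kmeas1.
- by move=> t; exact: n1M.
- by apply: measurable_funM; apply: cmeas_n1 => //; exact: kmeas1.
Qed.

Lemma ae_OpD A C f g : kmeas A -> bnd m A C -> 0 <= C -> cintg m f -> cintg m g ->
  {ae m, forall x, Op m A (fun t => f t + g t) x = Op m A f x + Op m A g x}.
Proof.
move=> mA bA C0 fi gi.
apply: filterS2 (ae_Op_intg mA bA C0 fi) (ae_Op_intg mA bA C0 gi) => x hf hg.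
by rewrite /Op -cID//; apply: eq_cI => t; rewrite mulrDr.
Qed.

Lemma ae_OpZ A C z f : kmeas A -> bnd m A C -> 0 <= C -> cintg m f ->
  {ae m, forall x, Op m A (fun t => z * f t) x = z * Op m A f x}.
Proof.
move=> mA bA C0 fi; apply: filterS (ae_Op_intg mA bA C0 fi) => x hf.
by rewrite /Op -cIZl//; apply: eq_cI => t; rewrite mulrCA.
Qed.

Lemma ae_OpN A C f : kmeas A -> bnd m A C -> 0 <= C -> cintg m f ->
  {ae m, forall x, Op m A (fun t => - f t) x = - Op m A f x}.
Proof.
move=> mA bA C0 fi; apply: filterS (ae_Op_intg mA bA C0 fi) => x hf.
by rewrite /Op -cIN//; apply: eq_cI => t; rewrite mulrN.
Qed.

Lemma Op_ae_eq A f g x : kmeas A -> cmeas f -> cmeas g -> {ae m, forall t, f t = g t} ->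
  Op m A f x = Op m A g x.
Proof.
move=> mA mf mg fg; apply: ae_eq_cI.
- by apply: cmeasM => //; exact: kmeas1.
- by apply: cmeasM => //; exact: kmeas1.
- by apply: filterS fg => t ->.
Qed.

Lemma bnd_comp A B CA CB : kmeas A -> kmeas B -> bnd m A CA -> bnd m B CB -> 0 <= CA ->
  bnd m (fun x xi => Op m A (B ^~ xi) x) (CA * CB).
Proof.
move=> mA mB bA bB CA0 xi.
apply: le_trans (Op_n1 mA bA CA0 (kmeas2 xi mB)) _.
by rewrite EFinM; apply: lee_wpmul2l => //; rewrite lee_fin.
Qed.

Lemma ae_OpOp A B CA CB f : kmeas A -> kmeas B -> bnd m A CA -> bnd m B CB ->
  0 <= CA -> 0 <= CB -> cintg m f ->
  {ae m, forall x, Op m A (Op m B f) x = Op m (fun x xi => Op m A (B ^~ xi) x) f x}.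
Proof.
move=> mA mB bA bB CA0 CB0 fi; have [mf _] := fi.
(* Fubini applies where the triple integral of absolute values is finite. *)
pose Bf t := (fine (\int[m]_xi (n1 (B t xi) * n1 (f xi))%:E))%:C : R[i].
have mBf0 : measurable_fun setT (fun t => \int[m]_xi (n1 (B t xi) * n1 (f xi))%:E)%E.
  apply: (measurable_fun_fubini_tonelli_F (fun p : T * T => (n1 (B p.1 p.2) * n1 (f p.2))%:E)) => //.
  + apply/measurable_EFinP; apply: measurable_funM; first exact: (cmeas_n1 mB).
    by apply: (measurableT_comp (cmeas_n1 mf)).
  + by move=> p; rewrite lee_fin mulr_ge0 ?n1_ge0.
have Bge0 t : (0 <= \int[m]_xi (n1 (B t xi) * n1 (f xi))%:E)%E.
  by apply: integral_ge0 => xi _; rewrite lee_fin mulr_ge0 ?n1_ge0.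
have mBf : cmeas Bf.
  by apply: cmeas_real; exact: (measurableT_comp (@fine_measurable R setT measurableT) mBf0).
have n1Bf t : n1 (Bf t) = fine (\int[m]_xi (n1 (B t xi) * n1 (f xi))%:E)%E.
  by rewrite n1_real ger0_norm// fine_ge0.
have aeB := ae_double mB bB CB0 fi.
have iBf : cintg m Bf.
  split => //.
  apply: le_lt_trans (le_lt_trans (double_n1 mB bB CB0 mf) _); last first.
    by apply: lte_mul_pinfty; [rewrite lee_fin| |exact: (proj2 fi)].
  apply: ge0_le_integral => //.
  - by move=> x _; rewrite lee_fin n1_ge0.
  - exact: cmeas_n1E.
  - move=> x _; rewrite n1Bf.
    by case: (\int[m]_xi _)%E (Bge0 x) => //= _; rewrite leey.
apply: filterS2 (ae_double mA bA CA0 iBf) (ae_Op_intg mA bA CA0 iBf) => x hx _.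
pose F (p : T * T) := A x p.1 * (B p.1 p.2 * f p.2).
have mF : cmeas F.
  apply: cmeasM; first by apply: (@cmeas_comp _ _ _ _ _ fst (A x)) => //; exact: kmeas1.
  apply: cmeasM; first exact: mB.
  exact: (@cmeas_comp _ _ _ _ _ snd f).
have iF : (\int[m]_t \int[m]_xi (n1 (F (t, xi)))%:E < +oo)%E.
  apply: le_lt_trans hx; apply: ae_ge0_le_integral => //.
  - by move=> t _; apply: integral_ge0 => xi _; rewrite lee_fin n1_ge0.
  - apply: (measurable_fun_fubini_tonelli_F (fun p => (n1 (F p))%:E)) => //.
    + exact: cmeas_n1E.
    + by move=> p; rewrite lee_fin n1_ge0.
  - by move=> t _; rewrite lee_fin mulr_ge0 ?n1_ge0.
  - apply/measurable_EFinP; apply: measurable_funM; apply: cmeas_n1 => //; exact: kmeas1.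
  - apply: filterS aeB => t ht _; rewrite n1Bf EFinM fineK ?ge0_fin_numE//.
    rewrite -ge0_integralZl_EFin ?n1_ge0//; last 2 first.
    + by move=> xi _; rewrite lee_fin mulr_ge0 ?n1_ge0.
    + apply/measurable_EFinP; apply: measurable_funM; apply: cmeas_n1 => //; exact: kmeas1.
    apply: ge0_le_integral => //.
    + by move=> xi _; rewrite lee_fin n1_ge0.
    + by apply: cmeas_n1E; apply: (cmeas_sec1 t mF).
    + apply: emeasurable_funM => //; apply/measurable_EFinP; apply: measurable_funM;
      apply: cmeas_n1 => //; exact: kmeas1.
    + move=> xi _; rewrite -EFinM lee_fin /F /= (le_trans (n1M _ _))//.
      by rewrite ler_wpM2l ?n1_ge0// n1M.
transitivity (cI m (fun t => cI m (fun xi => F (t, xi)))).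
  apply: ae_eq_cI.
  - by apply: cmeasM; [exact: kmeas1|exact: cmeas_Op].
  - exact: cmeas_param.
  - apply: filterS aeB => t ht; rewrite /F /Op -cIZl//.
    apply: cintg_le ht.
    + by apply: cmeasM => //; exact: kmeas1.
    + by move=> xi; exact: n1M.
    + by apply: measurable_funM; apply: cmeas_n1 => //; exact: kmeas1.
rewrite (cFubini mF iF).
have mF' : cmeas (fun p => F (p.2, p.1)).
  by apply: (@cmeas_comp _ _ _ _ _ (fun p : T * T => (p.2, p.1)) F) => //; exact: measurable_fun_pair.
have iF' : (\int[m]_xi \int[m]_t (n1 (F (t, xi)))%:E < +oo)%E.
  rewrite -(fubini_tonelli (fun p => (n1 (F p))%:E))//; first exact: cmeas_n1E.
  by move=> p; rewrite lee_fin n1_ge0.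
apply: ae_eq_cI.
- exact: (@cmeas_param _ _ _ _ _ m (fun p => F (p.2, p.1))).
- by apply: cmeasM => //; apply: (kmeas1 x (kmeas_Op m mA mB)).
- apply: filterS (ae_cintg_sec1 mF' iF') => xi h /=.
  (* Integrability is known for the product with [f xi] only. Where [f xi] is nonzero, dividing by
     it gives that of [A x t * B t xi]; where it is zero, both sides vanish. *)
  have [f0|f0] := eqVneq (f xi) 0.
    rewrite f0 mulr0 /F /= -[RHS](cI0 m); apply: eq_cI => t.
    by rewrite f0 !mulr0.
  rewrite /F /= /Op -cIZr; last first.
    have := cintgZr (f xi)^-1 h; rewrite /F /=.
    rewrite (_ : (fun _ => _) = (fun t => A x t * B t xi))//.
    by apply/funext => t; rewrite mulrA mulfK.
  by apply: eq_cI => t; rewrite mulrA.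
Qed.

End Associativity.

Lemma nneseries_geometric (R : realType) (c q : R) : 0 <= c -> 0 <= q -> q < 1 ->
  (\sum_(k <oo) (c * q ^+ k)%:E = (c / (1 - q))%:E)%E.
Proof.
move=> c0 q0 q1; apply/cvg_lim => //.
have h : series (geometric c q) @ \oo --> c / (1 - q).
  by apply: cvg_geometric_series; rewrite ger0_norm.
rewrite (_ : (fun n => _) = EFin \o series (geometric c q)).
  by apply: cvg_EFin => //; exact: nearW.
by apply/funext => N /=; rewrite /series /= sumEFin.
Qed.

(** * Neumann series of a kernel that contracts a weighted norm of L1 *)

Section Resolvent.
Context d (T : measurableType d) (R : realType).
Variable m : {sigma_finite_measure set T -> \bar R}.
Variables (K : T -> T -> R[i]) (w : T -> R) (w0 q C : R).
Hypotheses (mK : kmeas K) (mw : measurable_fun setT w).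
Hypotheses (w0_gt0 : 0 < w0) (w_ge : forall x, w0 <= w x) (w_le : forall x, w x <= 1).
Hypotheses (q0 : 0 <= q) (q1 : q < 1) (CK : COL m w K q).
Hypotheses (C0 : 0 <= C) (bK : bnd m K C).
Implicit Types f g : T -> R[i].

Let w_ge0 x : 0 <= w x.
Proof. by rewrite (le_trans (ltW w0_gt0)). Qed.

Definition iterOp k f := iter k (Op m K) f.

(** A pointwise sum rather than a limit chosen in L1: it is defined for every [x], so that joint
    measurability survives when [f] depends on a parameter. *)
Definition neumann f : T -> R[i] := fun x => csum (fun k => (-1) ^+ k * iterOp k f x).

Lemma cmeas_iterOp k f : cmeas f -> cmeas (iterOp k f).
Proof. by move=> mf; elim: k => //= k IH; exact: cmeas_Op. Qed.

Lemma n1_sign k z : n1 ((-1) ^+ k * z : R[i]) = n1 z.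
Proof. by rewrite -signr_odd; case: (odd k); rewrite ?expr1 ?expr0 ?mulN1r ?mul1r ?n1N. Qed.

Let cmeas_term k f : cmeas f -> cmeas (fun x => (-1) ^+ k * iterOp k f x).
Proof. by move=> mf; apply: cmeasM; [exact: cmeas_cst|exact: cmeas_iterOp]. Qed.

Lemma cmeas_neumann f : cmeas f -> cmeas (neumann f).
Proof. by move=> mf; apply: cmeas_csum => k; exact: cmeas_term. Qed.

Lemma kmeas_iterOp k A : kmeas A -> kmeas (fun x xi => iterOp k (A ^~ xi) x).
Proof.
by move=> mA; elim: k => //= k IH; apply: (@kmeas_Op _ T R m K (fun x xi => iterOp k (A ^~ xi) x)).
Qed.

Lemma kmeas_neumann A : kmeas A -> kmeas (fun x xi => neumann (A ^~ xi) x).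
Proof.
move=> mA; apply: (@cmeas_csum _ _ _ (fun k (p : T * T) => (-1) ^+ k * iterOp k (A ^~ p.2) p.1)) => k.
by apply: cmeasM; [exact: cmeas_cst|exact: kmeas_iterOp].
Qed.

(** Since [w0 <= w <= 1], this norm is equivalent to that of L1. Contraction is measured in it, and
    the results are stated in L1 at the cost of a factor 1 / [w0]. *)
Let wn f : \bar R := (\int[m]_x (w x * n1 (f x))%:E)%E.

Let wn_ge0 f : (0 <= wn f)%E.
Proof. by apply: integral_ge0 => x _; rewrite lee_fin mulr_ge0 ?n1_ge0. Qed.

Let mwn f : cmeas f -> measurable_fun setT (fun x => (w x * n1 (f x))%:E).
Proof. by move=> mf; apply/measurable_EFinP/measurable_funM => //; exact: cmeas_n1. Qed.

Let wn_le f : cmeas f -> (wn f <= \int[m]_x (n1 (f x))%:E)%E.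
Proof.
move=> mf; apply: ge0_le_integral => //.
- by move=> x _; rewrite lee_fin mulr_ge0 ?n1_ge0.
- exact: mwn.
- exact: cmeas_n1E.
- by move=> x _; rewrite lee_fin ler_piMl ?n1_ge0.
Qed.

Let le_wn f : cmeas f -> (\int[m]_x (n1 (f x))%:E <= w0^-1%:E * wn f)%E.
Proof.
move=> mf; rewrite /wn -ge0_integralZl_EFin//; last 3 first.
- by move=> x _; rewrite lee_fin mulr_ge0 ?n1_ge0.
- exact: mwn.
- by rewrite invr_ge0 ltW.
apply: ge0_le_integral => //.
- by move=> x _; rewrite lee_fin n1_ge0.
- exact: cmeas_n1E.
- by apply: emeasurable_funM => //; exact: mwn.
- move=> x _; rewrite -EFinM lee_fin mulrA ler_peMl ?n1_ge0//.
  by rewrite mulrC ler_pdivlMr// mul1r.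
Qed.

Lemma iterOp_n1 k f : cmeas f ->
  (\int[m]_x (n1 (iterOp k f x))%:E <= (w0^-1 * q ^+ k)%:E * \int[m]_x (n1 (f x))%:E)%E.
Proof.
move=> mf; apply: le_trans (le_wn (cmeas_iterOp k mf)) _.
rewrite EFinM -muleA; apply: lee_wpmul2l; first by rewrite lee_fin invr_ge0 ltW.
apply: le_trans (_ : _ <= (q ^+ k)%:E * wn f)%E _; last first.
  by apply: lee_wpmul2l; [rewrite lee_fin exprn_ge0|exact: wn_le].
elim: k => [|k IH]; first by rewrite expr0 mul1e.
apply: le_trans (Op_bound w_ge0 mw mK CK q0 (cmeas_iterOp k mf)) _.
rewrite exprS EFinM -muleA; apply: lee_wpmul2l => //; by rewrite lee_fin.
Qed.

Section Fixed.
Variable f : T -> R[i].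
Hypothesis fi : cintg m f.

Let I1 := fine (\int[m]_x (n1 (f x))%:E)%E.

Let I1E : (\int[m]_x (n1 (f x))%:E = I1%:E)%E.
Proof.
rewrite /I1 fineK// ge0_fin_numE; first exact: (proj2 fi).
by apply: integral_ge0 => x _; rewrite lee_fin n1_ge0.
Qed.

Let I1_ge0 : 0 <= I1.
Proof. by rewrite fine_ge0//; apply: integral_ge0 => x _; rewrite lee_fin n1_ge0. Qed.

Let D := w0^-1 / (1 - q) * I1.

Lemma iterOp_intg k : cintg m (iterOp k f).
Proof.
have [mf _] := fi; split; first exact: cmeas_iterOp.
by apply: le_lt_trans (iterOp_n1 k mf) _; rewrite I1E -EFinM ltry.
Qed.

Lemma tail_bound N : (\int[m]_x (\sum_(k <oo) (n1 (iterOp (N + k) f x))%:E) <= (D * q ^+ N)%:E)%E.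
Proof.
have [mf _] := fi.
rewrite integral_nneseries//; last 2 first.
- by move=> k; apply: cmeas_n1E; exact: cmeas_iterOp.
- by move=> k x _; rewrite lee_fin n1_ge0.
apply: le_trans (_ : _ <= \sum_(k <oo) ((w0^-1 * I1 * q ^+ N) * q ^+ k)%:E)%E _.
  apply: lee_nneseries => k _; first by move=> _; apply: integral_ge0 => x _; rewrite lee_fin n1_ge0.
  by apply: le_trans (iterOp_n1 _ mf) _; rewrite I1E -EFinM lee_fin exprD; lra.
rewrite nneseries_geometric// ?lee_fin /D; last first.
  by apply: mulr_ge0; [apply: mulr_ge0; rewrite // invr_ge0 ltW|rewrite exprn_ge0].
by rewrite le_eqVlt; apply/orP; left; apply/eqP; ring.
Qed.

Lemma ae_abs_sum : {ae m, forall x, (\sum_(k <oo) (n1 ((-1) ^+ k * iterOp k f x))%:E < +oo)%E}.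
Proof.
have [mf _] := fi.
have H : {ae m, forall x, (\sum_(k <oo) (n1 (iterOp (0 + k) f x))%:E < +oo)%E}.
  apply: ae_lty.
  - by move=> x; apply: nneseries_ge0 => k _ _; rewrite lee_fin n1_ge0.
  - apply: ge0_emeasurable_sum => [k x _ _|k _]; first by rewrite lee_fin n1_ge0.
    by apply: cmeas_n1E; exact: cmeas_iterOp.
  - by apply: le_lt_trans (tail_bound 0) _; rewrite ltry.
by apply: filterS H => x; under [X in _ -> (X < _)%E]eq_eseriesr do rewrite n1_sign.
Qed.

Lemma neumann_partial N :
  (\int[m]_x (n1 (neumann f x - \sum_(k < N) (-1) ^+ k * iterOp k f x))%:E <= (D * q ^+ N)%:E)%E.
Proof.
have [mf _] := fi.
apply: le_trans (tail_bound N); apply: ae_ge0_le_integral => //.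
- by move=> x _; rewrite lee_fin n1_ge0.
- apply: cmeas_n1E; apply: cmeasB; first exact: cmeas_neumann.
  by apply: (@cmeas_sum _ _ _ _ (index_enum 'I_N)
    (fun k x => (-1) ^+ (k : nat) * iterOp k f x)) => k; exact: cmeas_term.
- by move=> x _; apply: nneseries_ge0 => k _ _; rewrite lee_fin n1_ge0.
- apply: ge0_emeasurable_sum => [k x _ _|k _]; first by rewrite lee_fin n1_ge0.
  by apply: cmeas_n1E; exact: cmeas_iterOp.
- apply: filterS ae_abs_sum => x h _; apply: le_trans (csum_tail N h) _.
  by under eq_eseriesr do rewrite n1_sign.
Qed.

Lemma neumann_n1 : (\int[m]_x (n1 (neumann f x))%:E <= D%:E)%E.
Proof.
have := neumann_partial 0; rewrite expr0 mulr1.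
by under eq_integral do rewrite big_ord0 subr0.
Qed.

Lemma neumann_intg : cintg m (neumann f).
Proof.
have [mf _] := fi; split; first exact: cmeas_neumann.
by apply: le_lt_trans neumann_n1 _; rewrite ltry.
Qed.

(** A partial sum of the series solves the equation up to one iterate of the operator. The defect of
    the full sum therefore has an L1 norm below a constant times q^N for every N, hence is zero. *)
Lemma neumann_eq : {ae m, forall x, neumann f x + Op m K (neumann f) x = f x}.
Proof.
have [mf _] := fi.
pose S N x := \sum_(k < N) (-1) ^+ k * iterOp k f x.
have iS N : cintg m (S N).
  apply: (@cintg_sum _ _ _ m _ (index_enum 'I_N) (fun k x => (-1) ^+ (k : nat) * iterOp k f x)) => k.
  by apply: cintgZl; exact: iterOp_intg.
(* Telescoping: the defect of the N-th partial sum is, up to sign, the first omitted term. *)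
have KS N : {ae m, forall x, S N x + Op m K (S N) x - f x = - ((-1) ^+ N * iterOp N f x)}.
  elim: N => [|N IH].
    apply: nearW => x; rewrite expr0 mul1r /=.
    rewrite (_ : Op m K (S 0%N) x = 0) ?addr0 /S ?big_ord0 ?sub0r//.
    by rewrite /Op -[RHS](cI0 m); apply: eq_cI => t; rewrite /S big_ord0 mulr0.
  have iN : cintg m (fun t => (-1) ^+ N * iterOp N f t) by apply: cintgZl; exact: iterOp_intg.
  apply: filterS3 IH (ae_OpD mK bK C0 (iS N) iN) (ae_OpZ ((-1) ^+ N) mK bK C0 (iterOp_intg N)) => x h1 h2 h3.
  have e : S N.+1 = (fun t => S N t + (-1) ^+ N * iterOp N f t).
    by apply/funext => t; rewrite /S big_ord_recr.
  rewrite e h2 h3 /= exprS.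
  rewrite [LHS](_ : _ = (S N x + Op m K (S N) x - f x) + (-1) ^+ N * iterOp N f x + (-1) ^+ N * Op m K (iterOp N f) x); last by ring.
  by rewrite h1 addNr add0r mulN1r mulNr opprK.
have iE : cintg m (fun x => neumann f x + Op m K (neumann f) x - f x).
  apply: cintgB => //; apply: cintgD; first exact: neumann_intg.
  by apply: Op_intg bK C0 neumann_intg.
(* The three constants bound the tail of the series, its image under the operator of L1 norm at most
   [C], and the N-th iterate. *)
have key N : (\int[m]_x (n1 (neumann f x + Op m K (neumann f) x - f x))%:E <=
    ((D + C * D + w0^-1 * I1) * q ^+ N)%:E)%E.
  have iD : cintg m (fun x => neumann f x - S N x) by apply: cintgB => //; exact: neumann_intg.
  have iKD := Op_intg mK bK C0 iD.
  have iN : cintg m (iterOp N f) by exact: iterOp_intg.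
  apply: le_trans (_ : _ <= \int[m]_x ((n1 (neumann f x - S N x))%:E +
     ((n1 (Op m K (fun x => neumann f x - S N x) x))%:E + (n1 (iterOp N f x))%:E)))%E _.
    apply: ae_ge0_le_integral => //.
    - by move=> x _; rewrite lee_fin n1_ge0.
    - exact: cmeas_n1E (proj1 iE).
    - by move=> x _; rewrite !adde_ge0// lee_fin n1_ge0.
    - apply: emeasurable_funD; first exact: cmeas_n1E (proj1 iD).
      by apply: emeasurable_funD; [exact: cmeas_n1E (proj1 iKD)|exact: cmeas_n1E (proj1 iN)].
    - apply: filterS3 (KS N) (ae_OpD mK bK C0 neumann_intg (cintgN (iS N))) (ae_OpN mK bK C0 (iS N)) => x h1 h2 h3 _.
      rewrite -!EFinD lee_fin h2 h3 -(n1_sign N (iterOp N f x)) -[X in _ + (_ + X)]n1N -h1.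
      rewrite (le_trans _ (lerD (lexx _) (n1D _ _)))// (le_trans _ (n1D _ _))//.
      by rewrite le_eqVlt; apply/orP; left; apply/eqP; congr n1; ring.
  have nn (g : T -> R[i]) x : (0 <= (n1 (g x))%:E)%E by rewrite lee_fin n1_ge0.
  have mn g : cintg m g -> measurable_fun setT (fun x => (n1 (g x))%:E).
    by move=> [mg _]; exact: cmeas_n1E.
  rewrite ge0_integralD//; last 4 first.
  - by move=> x _; exact: (nn (fun x => neumann f x - S N x)).
  - exact: (mn _ iD).
  - by move=> x _; apply: adde_ge0; [exact: (nn (Op m K (fun x => neumann f x - S N x)))|exact: nn].
  - by apply: emeasurable_funD; [exact: (mn _ iKD)|exact: (mn _ iN)].
  rewrite (ge0_integralD _ measurableT (fun x _ => nn _ x) (mn _ iKD) (fun x _ => nn _ x) (mn _ iN)).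
  rewrite !mulrDl !EFinD -addeA; apply: leeD; first exact: neumann_partial.
  apply: leeD.
    apply: le_trans (Op_n1 mK bK C0 (proj1 iD)) _.
    by rewrite -mulrA EFinM; apply: lee_wpmul2l; [rewrite lee_fin|exact: neumann_partial].
  by apply: le_trans (iterOp_n1 N mf) _; rewrite I1E -EFinM lee_fin; lra.
have z0 : (\int[m]_x (n1 (neumann f x + Op m K (neumann f) x - f x))%:E = 0)%E.
  apply/eqP; rewrite eq_le; apply/andP; split; last first.
    by apply: integral_ge0 => x _; rewrite lee_fin n1_ge0.
  apply/lee_addgt0Pr => e e0; rewrite add0e.
  have : geometric (D + C * D + w0^-1 * I1) q n @[n --> \oo] --> 0.
    by apply: cvg_geometric; rewrite ger0_norm.
  move=> /cvgr0Pnorm_le /(_ _ e0) [N _ /(_ N (leqnn N))] /= h.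
  apply: le_trans (key N) _; rewrite lee_fin (le_trans _ h)//.
  by rewrite ler_norm.
apply: filterS (ae_n1_0 (proj1 iE) z0) => x /eqP.
by rewrite subr_eq0 => /eqP.
Qed.

End Fixed.

(** From f = - K f the weighted norm of f is at most [q] times itself; it is finite and [q < 1], so
    it vanishes. *)
Lemma volterra_unique f : cintg m f -> {ae m, forall x, f x + Op m K f x = 0} ->
  {ae m, forall x, f x = 0}.
Proof.
move=> fi h; have [mf fI] := fi.
have wfin : wn f \is a fin_num.
  by rewrite ge0_fin_numE//; apply: le_lt_trans (wn_le mf) _.
have le1 : (wn f <= q%:E * wn f)%E.
  apply: le_trans (Op_bound w_ge0 mw mK CK q0 mf).
  apply: ae_ge0_le_integral => //.
  - by move=> x _; rewrite lee_fin mulr_ge0 ?n1_ge0.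
  - exact: mwn.
  - by move=> x _; rewrite lee_fin mulr_ge0 ?n1_ge0.
  - by apply: mwn; exact: cmeas_Op.
  - apply: filterS h => x hx _; rewrite lee_fin.
    have -> : f x = - Op m K f x by apply/eqP; rewrite -addr_eq0 hx.
    by rewrite n1N.
have z0 : (\int[m]_x (n1 (f x))%:E = 0)%E.
  apply/eqP; rewrite eq_le; apply/andP; split; last first.
    by apply: integral_ge0 => x _; rewrite lee_fin n1_ge0.
  apply: le_trans (le_wn mf) _.
  have -> : wn f = 0%E; last by rewrite mule0.
  move: le1 (wn_ge0 f); rewrite -(fineK wfin) -EFinM !lee_fin => a b; congr EFin.
  apply/eqP; rewrite eq_le b andbT -(@pmulr_rle0 _ (1 - q)) ?subr_gt0//.
  by rewrite mulrBl mul1r subr_le0.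
exact: ae_n1_0 z0.
Qed.

End Resolvent.

(** * The Gamma function and the power kernels *)

Section ChangeOfVariables.
Variable R : realType.
Local Notation mu := (@lebesgue_measure R).

Lemma measurable_sub_l (x : R) : measurable_fun setT (fun t : measurableTypeR R => (x - t : measurableTypeR R)).
Proof. by apply: measurable_funB. Qed.

(** Lebesgue measure is determined by its values on the intervals ]u, v], and the reflection pulls
    these back to intervals [x - v, x - u[ of the same length. *)
Lemma lebesgue_measure_refl (x : R) (A : set R) : measurable A ->
  pushforward mu (fun t : measurableTypeR R => (x - t : measurableTypeR R)) A = mu A.
Proof.
move=> mA; apply/esym.
pose phi : measurableTypeR R -> measurableTypeR R := fun t => x - t.
have mphi : measurable_fun setT phi by exact: measurable_sub_l.
pose mixin := isMeasurableFun.Build _ _ _ _ _ mphi.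
pose phi' : {mfun _ >-> _} := HB.pack phi mixin.
apply: (@lebesgue_measure_unique R (pushforward mu phi')) => //= _ [[u v]] _ <- /=.
rewrite /pushforward.
have -> : phi @^-1` [set` `]u, v]] = [set` `[x - v, x - u[].
  by apply/seteqP; split => t; rewrite /phi /= !in_itv/= => /andP[h1 h2]; apply/andP; split; lra.
rewrite !lebesgue_measure_itv/= !lte_fin.
case: ifPn => h1; case: ifPn => h2 //.
- by rewrite -!EFinD; congr EFin; ring.
- by exfalso; move: h1 h2; rewrite -leNgt; lra.
- by exfalso; move: h1 h2; rewrite -leNgt; lra.
Qed.

Lemma ge0_integral_refl (x : R) (f : R -> \bar R) : measurable_fun setT f ->
  (forall r, 0 <= f r)%E -> (\int[mu]_t f (x - t)%R = \int[mu]_t f t)%E.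
Proof.
move=> mf f0.
pose phi : measurableTypeR R -> measurableTypeR R := fun t => x - t.
have mphi : measurable_fun setT phi by exact: measurable_sub_l.
pose mixin := isMeasurableFun.Build _ _ _ _ _ mphi.
pose phi' : {mfun _ >-> _} := HB.pack phi mixin.
transitivity (\int[pushforward mu phi']_t f t)%E.
  by rewrite (ge0_integral_pushforward mphi).
by apply: eq_measure_integral => A mA _; exact: lebesgue_measure_refl.
Qed.

Lemma measurable_mul_l (r : R) : measurable_fun setT (fun t : measurableTypeR R => (r * t : measurableTypeR R)).
Proof. by apply: measurable_funM. Qed.

Lemma lebesgue_measure_scale (r : R) (r0 : 0 < r) (A : set R) : measurable A ->
  (r%:E * pushforward mu (fun t : measurableTypeR R => (r * t)%R : measurableTypeR R) A = mu A)%E.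
Proof.
move=> mA; apply/esym.
pose phi : measurableTypeR R -> measurableTypeR R := fun t => r * t.
have mphi : measurable_fun setT phi by exact: measurable_mul_l.
pose mixin := isMeasurableFun.Build _ _ _ _ _ mphi.
pose phi' : {mfun _ >-> _} := HB.pack phi mixin.
pose rn : {nonneg R} := NngNum (ltW r0).
apply: (@lebesgue_measure_unique R (mscale rn (pushforward mu phi'))) => //= _ [[u v]] _ <- /=.
rewrite /mscale /= /pushforward.
have -> : phi @^-1` [set` `]u, v]] = [set` `]u / r, v / r]].
  by apply/seteqP; split => t; rewrite /phi /= !in_itv/= ltr_pdivrMr// ler_pdivlMr// mulrC.
rewrite !lebesgue_measure_itv/= !lte_fin ltr_pM2r ?invr_gt0//.
case: ifPn => h1; last by rewrite mule0.
by rewrite -!EFinD -EFinM; congr EFin; rewrite mulrBr !(mulrC r) !divfK ?gt_eqF.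
Qed.

Lemma ge0_integral_scale (r : R) (f : R -> \bar R) : 0 < r -> measurable_fun setT f ->
  (forall r, 0 <= f r)%E -> (r%:E * \int[mu]_t f (r * t)%R = \int[mu]_t f t)%E.
Proof.
move=> r0 mf f0.
pose phi : measurableTypeR R -> measurableTypeR R := fun t => r * t.
have mphi : measurable_fun setT phi by exact: measurable_mul_l.
pose mixin := isMeasurableFun.Build _ _ _ _ _ mphi.
pose phi' : {mfun _ >-> _} := HB.pack phi mixin.
pose rn : {nonneg R} := NngNum (ltW r0).
pose nu : {measure set (measurableTypeR R) -> \bar R} := pushforward mu phi'.
transitivity (\int[mscale rn (nu mphi)]_t f t)%E.
  rewrite ge0_integral_mscale//.
  by rewrite (ge0_integral_pushforward mphi).
by apply: eq_measure_integral => A mA _; exact: lebesgue_measure_scale.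
Qed.

Lemma Rintegral_refl (x : R) (f : R -> R) : measurable_fun setT f ->
  Rintegral mu setT (fun t => f (x - t)) = Rintegral mu setT f.
Proof.
move=> mf; rewrite /Rintegral; congr fine.
have mE : measurable_fun setT (EFin \o f) by exact/measurable_EFinP.
rewrite [LHS]integralE [RHS]integralE; congr (_ - _)%E.
- rewrite -(@ge0_integral_refl x (EFin \o f)^\+%E) //; last exact: measurable_funepos.
  by apply: eq_integral => t _; rewrite !funeposE.
- rewrite -(@ge0_integral_refl x (EFin \o f)^\-%E) //; last exact: measurable_funeneg.
  by apply: eq_integral => t _; rewrite !funenegE.
Qed.

Lemma cI_refl (x : R) (f : R -> R[i]) : cmeas f -> cI mu (fun t => f (x - t)) = cI mu f.
Proof.
by move=> [f1 f2]; apply/complexP; rewrite !(Re_cI, Im_cI); [exact: (Rintegral_refl x f1)|exact: (Rintegral_refl x f2)].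
Qed.

Lemma Rintegral_scale (r : R) (f : R -> R) : 0 < r -> mu.-integrable setT (EFin \o f) ->
  r * Rintegral mu setT (fun t => f (r * t)) = Rintegral mu setT f.
Proof.
move=> r0 fi; have mE := measurable_int mu fi.
rewrite /Rintegral [in RHS]integralE [in LHS]integralE.
have fp := @ge0_integral_scale r (EFin \o f)^\+%E r0 (measurable_funepos mE) (fun=> funepos_ge0 _ _).
have fn := @ge0_integral_scale r (EFin \o f)^\-%E r0 (measurable_funeneg mE) (fun=> funeneg_ge0 _ _).
have Pf := integrable_pos_fin_num measurableT fi; have Nf := integrable_neg_fin_num measurableT fi.
have ep : (\int[mu]_t ((fun t => (f (r * t))%:E)^\+ t) = \int[mu]_t (EFin \o f)^\+ (r * t)%R)%E.
  by apply: eq_integral => t _; rewrite !funeposE.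
have en : (\int[mu]_t ((fun t => (f (r * t))%:E)^\- t) = \int[mu]_t (EFin \o f)^\- (r * t)%R)%E.
  by apply: eq_integral => t _; rewrite !funenegE.
rewrite ep en -fp -fn in Pf Nf *.
have fin (e : \bar R) : (0 <= e)%E -> (r%:E * e)%E \is a fin_num -> e \is a fin_num.
  by case: e => //= _; rewrite gt0_muley ?lte_fin.
have Pf' := fin _ _ Pf; have Nf' := fin _ _ Nf.
have {}Pf' := Pf' (integral_ge0 _ (fun t _ => funepos_ge0 _ _)).
have {}Nf' := Nf' (integral_ge0 _ (fun t _ => funeneg_ge0 _ _)).
by rewrite (fineB Pf Nf) (fineB Pf' Nf') !fineM// mulrBr.
Qed.

Lemma cI_scale (r : R) (f : R -> R[i]) : 0 < r -> cintg mu f ->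
  r%:C * cI mu (fun t => f (r * t)) = cI mu f.
Proof.
move=> r0 fi; apply/complexP; rewrite ?cReM ?cImM ReR ImR !(Re_cI, Im_cI) !mul0r ?subr0 ?addr0.
- exact: (Rintegral_scale r0 (cintg_Re fi)).
- exact: (Rintegral_scale r0 (cintg_Im fi)).
Qed.

End ChangeOfVariables.

Section ComplexPower.
Variable R : realType.
Local Notation mu := (@lebesgue_measure R).
Implicit Types (x y u r : R) (z w : R[i]).

Definition cis x : R[i] := cos x +i* sin x.

Lemma Re_cis x : complex.Re (cis x) = cos x. Proof. by []. Qed.
Lemma Im_cis x : complex.Im (cis x) = sin x. Proof. by []. Qed.

Lemma cis0 : cis 0 = 1.
Proof. by rewrite /cis cos0 sin0. Qed.

Lemma cisD x y : cis (x + y) = cis x * cis y.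
Proof.
apply/complexP; rewrite ?cReM ?cImM !(Re_cis, Im_cis).
- exact: cosD.
- by rewrite sinD addrC.
Qed.

Lemma cpowE x z : cpow x z = (x `^ complex.Re z)%:C * cis (complex.Im z * ln x).
Proof. by []. Qed.

Lemma cpow0 x : cpow x 0 = 1 :> R[i].
Proof. by rewrite cpowE powRr0 mul0r cis0 mul1r. Qed.

Lemma cpow1l z : cpow 1 z = 1.
Proof. by rewrite cpowE powR1 ln1 mulr0 cis0 mulr1. Qed.

Lemma cpowD x z w : 0 < x -> cpow x (z + w) = cpow x z * cpow x w.
Proof.
move=> x0; rewrite !cpowE cReD cImD powRD; last by rewrite (gt_eqF x0) implybT.
by rewrite mulrDl cisD rmorphM mulrACA.
Qed.

Lemma cpow1 x : 0 < x -> cpow x 1 = x%:C :> R[i].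
Proof. by move=> x0; rewrite cpowE powRr1 ?ltW// mul0r cis0 mulr1. Qed.

Lemma cpowS x z : 0 < x -> cpow x z = x%:C * cpow x (z - 1).
Proof. move=> x0; have e : z = 1 + (z - 1) by rewrite addrC subrK.
by rewrite {1}e (cpowD 1 (z - 1) x0) (cpow1 x0). Qed.

Lemma cpowM x y z : 0 < x -> 0 < y -> cpow (x * y) z = cpow x z * cpow y z.
Proof.
move=> x0 y0; rewrite !cpowE powRM ?ltW// lnM ?posrE// mulrDr cisD.
by rewrite rmorphM mulrACA.
Qed.

Lemma n1_cpow x z : 0 < x -> n1 (cpow x z) <= 2 * x `^ (complex.Re z).
Proof.
move=> x0; rewrite /cpow (le_trans (n1M _ _))// n1_real ger0_norm ?powR_ge0//.
rewrite mulrC ler_wpM2r ?powR_ge0// /n1 /=.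
by rewrite (_ : 2 = 1 + 1)// lerD// ?cos_max ?sin_max.
Qed.

Lemma cpow_neq0 x z : 0 < x -> cpow x z != 0.
Proof.
move=> x0; apply/eqP => e.
have : cpow x z * cpow x (- z) = 1 by rewrite -cpowD// subrr cpow0.
by rewrite e mul0r => /eqP; rewrite eq_sym oner_eq0.
Qed.

Lemma cmeas_cpow z : cmeas (fun u : measurableTypeR R => cpow u z).
Proof.
apply: cmeasM.
  by apply: cmeas_real; exact: measurable_powR.
have ml : measurable_fun setT (fun u : measurableTypeR R => complex.Im z * ln u).
  by apply: measurable_funM => //; exact: measurable_ln.
split => /=.
- apply: (measurableT_comp _ ml) => //; apply: continuous_measurable_fun; exact: continuous_cos.
- apply: (measurableT_comp _ ml) => //; apply: continuous_measurable_fun; exact: continuous_sin.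
Qed.

(** The power u^(z-1) cut off at 0. With this cut-off the convolution over the whole line of two
    such powers at x is an integral over (0,x), with no endpoints to carry through Fubini and
    changes of variables. *)
Definition pw z u : R[i] := if 0 < u then cpow u (z - 1) else 0.

Lemma measurable_pos : measurable_fun setT (fun u : measurableTypeR R => (0 < (u : R))%R).
Proof. by apply: measurable_fun_ltr. Qed.

Lemma cmeas_pw z : cmeas (pw z : measurableTypeR R -> _).
Proof.
apply: cmeas_if; [exact: measurable_pos|exact: cmeas_cpow|exact: cmeas_cst].
Qed.

Lemma int_powR_0 (s d : R) : 0 < s -> 0 < d ->
  (\int[mu]_(u in `]0%R, d]) (u `^ (s - 1))%:E <= (d `^ s / s)%:E)%E.
Proof.
move=> s0 d0.
(* Exhaustion of ]0, d] by compact intervals away from the singularity, on which the fundamental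
   theorem of calculus applies. The denominator n + 2 keeps the first one nondegenerate. *)
pose F n : set (measurableTypeR R) := `[d / n.+2%:R, d]%classic.
have e n : (0 : R) < d / n.+2%:R by rewrite divr_gt0.
have ed n : d / n.+2%:R < d by rewrite ltr_pdivrMr// ltr_pMr// (ltr_nat R 1).
have UF : \bigcup_n F n = `]0, d]%classic.
  apply/seteqP; split => [u [n _]|u].
    by rewrite /F /= !in_itv/= => /andP[h1 h2]; rewrite h2 andbT (lt_le_trans (e n)).
  rewrite /= in_itv/= => /andP[u0 ud].
  exists (Num.truncn (d / u)) => //; rewrite /F /= in_itv/= ud andbT.
  rewrite ler_pdivrMr// mulrC -ler_pdivrMr//.
  by rewrite (le_trans (ltW (truncnS_gt _)))// ler_nat.
have mF n : measurable (F n : set (measurableTypeR R)) by exact: measurable_itv.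
have ndF : nondecreasing_seq F.
  apply/nondecreasing_seqP => n; apply/subsetPset => u; rewrite /F /= !in_itv/= => /andP[h1 ->].
  by rewrite andbT (le_trans _ h1)// ler_pM2l// lef_pV2 ?posrE// ler_nat.
have mf n : measurable_fun (F n : set (measurableTypeR R)) (fun u => (u `^ (s - 1))%:E).
  apply/measurable_EFinP; apply: measurable_funTS; exact: measurable_powR.
have f0 n (u : R) : F n u -> (0 <= (u `^ (s - 1))%:E)%E by rewrite lee_fin powR_ge0.
have := @ge0_nondecreasing_set_cvg_integral _ _ R F (fun u => (u `^ (s - 1))%:E) mu ndF mF mf f0.
rewrite UF => /cvg_lim <-//.
apply: lime_le; first by apply: ereal_nondecreasing_is_cvgn; exact: ge0_nondecreasing_set_nondecreasing_integral.
apply: nearW => n.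
have D u : 0 < u -> is_derive u 1 (fun v => s^-1 * v `^ s) (u `^ (s - 1)).
  move=> u0; have := is_derive1_powR s u0 => h.
  by apply: is_derive_eq; rewrite -[LHS]/(s^-1 * (s * u `^ (s - 1))) mulKf ?gt_eqF.
have C u : 0 < u -> {for u, continuous (fun v => s^-1 * v `^ s)}.
  by move=> u0; apply: differentiable_continuous; apply/derivable1_diffP; have [] := D _ u0.
have C1 u : 0 < u -> {for u, continuous (fun v => v `^ (s - 1))}.
  move=> u0; apply: differentiable_continuous; apply/derivable1_diffP.
  by have [] := is_derive1_powR (s - 1) u0.
rewrite /F (@continuous_FTC2 _ _ (fun v => s^-1 * v `^ s)); last 4 first.
- exact: ed.
- apply: continuous_in_subspaceT => u; rewrite inE /= in_itv/= => /andP[h _].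
  exact: C1 (lt_le_trans (e n) h).
- split.
  + by move=> u; rewrite in_itv/= => /andP[h _]; have [] := D _ (lt_trans (e n) h).
  + by apply: cvg_at_right_filter; exact: C (e n).
  + by apply: cvg_at_left_filter; exact: C d0.
- move=> u; rewrite in_itv/= => /andP[h _].
  by rewrite derive1E; have [_ ->] := D _ (lt_trans (e n) h).
rewrite -EFinB lee_fin mulrC lerBlDr lerDl mulr_ge0 ?powR_ge0 ?invr_ge0//.
exact: ltW.
Qed.

Lemma int_pw_fin z (d : R) : 0 < complex.Re z -> 0 < d ->
  (\int[mu]_u (if (u <= d) then n1 (pw z u) else 0)%:E <= (2 * (d `^ (complex.Re z) / complex.Re z))%:E)%E.
Proof.
move=> s0 d0; rewrite EFinM.
apply: le_trans (_ : _ <= 2%:E * \int[mu]_(u in `]0%R, d]) (u `^ (complex.Re z - 1))%:E)%E _; last first.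
  by apply: lee_wpmul2l => //; exact: int_powR_0.
rewrite [in leRHS]integral_mkcond -ge0_integralZl_EFin//; last 2 first.
- by move=> u _; apply: erestrict_ge0 => t _; rewrite lee_fin powR_ge0.
- apply/(measurable_restrictT _ _).1 => //; apply/measurable_EFinP; apply: measurable_funTS.
  exact: measurable_powR.
apply: ge0_le_integral => //.
- by move=> u _; rewrite lee_fin; case: ifP => // _; exact: n1_ge0.
- apply/measurable_EFinP; apply: measurable_fun_ifT => //; first exact: measurable_fun_ler.
  by apply: cmeas_n1; exact: cmeas_pw.
- apply: emeasurable_funM => //.
  apply/(measurable_restrictT _ _).1 => //; apply/measurable_EFinP; apply: measurable_funTS.
  exact: measurable_powR.
- move=> u _; rewrite patchE /pw; case: ifPn => [ud|ud].
    case: ifPn => [u0|u0].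
      rewrite mem_set; last by rewrite /= in_itv/= u0.
      by rewrite -EFinM lee_fin (le_trans (n1_cpow _ u0))// cReB.
    by rewrite n1_0 memNset ?mule0//= in_itv/= (negbTE u0).
  by case: ifPn => _; rewrite ?mule0// -EFinM lee_fin mulr_ge0// powR_ge0.
Qed.

End ComplexPower.

Section Gamma.
Variable R : realType.
Local Notation mu := (@lebesgue_measure R).
Implicit Types (x y u r : R) (z w : R[i]).

(** The term of degree n > |s| in the exponential series of v / 2 dominates v^s up to the factor 2^n
    n!. *)
Lemma powR_le_exp (s : R) :
  exists2 C : R, 0 <= C & forall v, 1 <= v -> v `^ s <= C * expR (v / 2).
Proof.
pose n := (Num.truncn `|s|).+1.
exists (2 ^+ n * n`!%:R) => [|v v1]; first by rewrite mulr_ge0// exprn_ge0.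
have v0 : 0 <= v by rewrite (le_trans _ v1).
apply: le_trans (_ : v ^+ n <= _).
  rewrite -powR_mulrn//; apply: ler_powR => //.
  by rewrite (le_trans (ler_norm s))// ltW// truncnS_gt.
have v20 : 0 <= v / 2 by rewrite divr_ge0.
have := @expR_ge1Dxn R (v / 2) (Num.truncn `|s|) v20; rewrite -/n => h.
have h2 : (v / 2) ^+ n / n`!%:R <= expR (v / 2) by rewrite (le_trans _ h)// lerDr.
rewrite -mulrA [_ * expR _]mulrC.
have -> : v ^+ n = 2 ^+ n * (v / 2) ^+ n by rewrite -exprMn mulrCA divff ?mulr1.
rewrite ler_wpM2l ?exprn_ge0// -ler_pdivrMr// ltr0n fact_gt0//.
Qed.

Definition gint z u : R[i] := (expR (- u))%:C * pw z u.

Lemma cmeas_gint z : cmeas (gint z : measurableTypeR R -> _).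
Proof.
apply: cmeasM; last exact: cmeas_pw.
apply: cmeas_real; apply: measurableT_comp => //.
Qed.

Lemma gint_intg z : 0 < complex.Re z -> cintg mu (gint z).
Proof.
move=> z0.
have [C C0 hC] := powR_le_exp (complex.Re z - 1).
have half0 : (0 : R) < 2^-1 by rewrite invr_gt0.
(* Up to 1 the power itself is integrable. Beyond 1 the integrand is at most 2 C e^(-u/2), the 2
   coming from [n1_cpow]; this is [4 * C] times the exponential density of rate 1/2, whose integral
   is 1. *)
pose h (u : measurableTypeR R) : R := (if (u <= 1)%R then n1 (pw z u) else 0) +
  4 * C * exponential_pdf 2^-1 u.
apply: (@cintg_le _ _ _ _ _ h).
- exact: cmeas_gint.
- move=> u; rewrite /gint (le_trans (n1M _ _))// n1_real ger0_norm ?expR_ge0//.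
  have p0 : 0 <= exponential_pdf 2^-1 u :> R by apply: exponential_pdf_ge0; exact: ltW.
  have q0 : 0 <= 4 * C * exponential_pdf 2^-1 u by rewrite !mulr_ge0.
  rewrite /h; case: ifPn => u1.
    have [u0|u0] := boolP (0 < u); last first.
      by rewrite /pw (negbTE u0) n1_0 mulr0 add0r.
    rewrite -[leLHS]addr0 lerD// ler_piMl ?n1_ge0// -expR0 ler_expR.
    by rewrite oppr_le0 ltW.
  rewrite -ltNge in u1; rewrite add0r.
  have u0 : 0 < u by rewrite (lt_trans _ u1).
  rewrite (exponential_pdfE _ (ltW u0)) /pw u0.
  have := n1_cpow (z - 1) u0; rewrite cReB => h1.
  have := hC _ (ltW u1) => h2.
  rewrite (le_trans (ler_wpM2l (expR_ge0 _) (le_trans h1 (ler_wpM2l _ h2))))//.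
  rewrite -subr_ge0 [leRHS](_ : _ = 2 * C * (expR (- 2^-1 * u) - expR (- u) * expR (u / 2))); last by field.
  rewrite -expRD (_ : - u + u / 2 = - 2^-1 * u); last by field.
  by rewrite subrr mulr0.
- apply: measurable_funD.
    apply: measurable_fun_ifT => //; first exact: measurable_fun_ler.
    by apply: cmeas_n1; exact: cmeas_pw.
  by apply: measurable_funM => //; exact: measurable_exponential_pdf.
- rewrite /h; under eq_integral do rewrite EFinD.
  have p0 u : 0 <= exponential_pdf 2^-1 u :> R by apply: exponential_pdf_ge0; exact: ltW.
  rewrite ge0_integralD//; last 4 first.
  + by move=> u _; rewrite lee_fin; case: ifP => // _; exact: n1_ge0.
  + apply/measurable_EFinP; apply: measurable_fun_ifT => //; first exact: measurable_fun_ler.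
    by apply: cmeas_n1; exact: cmeas_pw.
  + by move=> u _; rewrite lee_fin !mulr_ge0.
  + by apply/measurable_EFinP; apply: measurable_funM => //; exact: measurable_exponential_pdf.
  apply: lte_add_pinfty.
    by apply: le_lt_trans (int_pw_fin z0 ltr01) _; rewrite ltry.
  under eq_integral do rewrite EFinM.
  rewrite ge0_integralZl_EFin//; last 3 first.
  + by move=> u _; rewrite lee_fin.
  + by apply/measurable_EFinP; exact: measurable_exponential_pdf.
  + by rewrite mulr_ge0.
  by rewrite integral_exponential_pdf// mule1 ltry.
Qed.

Lemma cint_cI (D : set R) (f : R -> R[i]) :
  cint D f = cI mu (fun u => if u \in D then f u else 0).
Proof.
apply/complexP; rewrite ?Re_cI ?Im_cI /= Rintegral_mkcond; congr (Rintegral _ _ _);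
 by apply/funext => u; rewrite patchE /reals /imags; case: ifP.
Qed.

Lemma cGammaE z : cGamma z = cI mu (gint z).
Proof.
rewrite /cGamma cint_cI; apply: eq_cI => u; rewrite /gint /pw.
have -> : (u \in `]0, +oo[%classic) = (0 < u) by apply/idP/idP; rewrite inE/= in_itv/= andbT.
by case: ifP => //; rewrite mulr0.
Qed.

End Gamma.

Section Beta.
Variable R : realType.
Local Notation mu := (@lebesgue_measure R).
Implicit Types (x y u r : R) (z w : R[i]).

Lemma ae_exists (P : R -> Prop) (c d : R) : c < d -> {ae mu, forall x, P x} ->
  exists2 x, c < x < d & P x.
Proof.
move=> cd aeP; apply: contrapT => H.
have [A [mA A0 hA]] := aeP.
have sub : `]c, d[%classic `<=` A.
  move=> x; rewrite /= in_itv/= => xcd; apply: hA => /= Px; apply: H; by exists x.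
have : (mu `]c, d[ <= mu A)%E by apply: le_measure; rewrite ?inE//; exact: measurable_itv.
by rewrite A0 lebesgue_measure_itv/= lte_fin cd -EFinB lee_fin subr_le0 leNgt cd.
Qed.

Lemma ge0_integral_shift (t : R) (h : R -> \bar R) : measurable_fun setT h ->
  (forall u, 0 <= h u)%E -> (\int[mu]_x h (x - t)%R = \int[mu]_x h x)%E.
Proof.
move=> mh h0.
have mh' : measurable_fun setT (fun u : measurableTypeR R => h (0 - u)%R).
  by apply: (measurableT_comp mh); exact: measurable_sub_l.
transitivity (\int[mu]_x h (0 - (t - x))%R)%E.
  by apply: eq_integral => x _; rewrite sub0r opprB.
by rewrite (ge0_integral_refl t mh') // (ge0_integral_refl 0 mh).
Qed.

Lemma cI_shift (t : R) (h : R -> R[i]) : cmeas (h : measurableTypeR R -> _) ->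
  cI mu (fun x => h (x - t)) = cI mu h.
Proof.
move=> mh.
have mh' : cmeas (fun u : measurableTypeR R => h (0 - u)).
  by apply: (@cmeas_comp _ _ R _ _ (fun u : measurableTypeR R => (0 - u) : measurableTypeR R) h) => //; exact: measurable_sub_l.
transitivity (cI mu (fun x => h (0 - (t - x)))).
  by apply: eq_cI => x; rewrite sub0r opprB.
by rewrite (cI_refl t mh') (cI_refl 0 mh).
Qed.

Definition convk (phi : R -> R[i]) : measurableTypeR R -> measurableTypeR R -> R[i] :=
  fun x t => phi ((x : R) - (t : R)).

Lemma measurable_sub2 : measurable_fun setT
  (fun p : measurableTypeR R * measurableTypeR R => ((p.1 : R) - (p.2 : R)) : measurableTypeR R).
Proof. by apply: measurable_funB. Qed.

Lemma kmeas_convk phi : cmeas (phi : measurableTypeR R -> _) -> kmeas (convk phi).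
Proof.
move=> mphi; apply: (@cmeas_comp _ _ R _ _
 (fun p : measurableTypeR R * measurableTypeR R => ((p.1 : R) - (p.2 : R)) : measurableTypeR R) phi) => //.
exact: measurable_sub2.
Qed.

Lemma bnd_convk phi C : cmeas (phi : measurableTypeR R -> _) ->
  (\int[mu]_u (n1 (phi u))%:E <= C%:E)%E -> bnd mu (convk phi) C.
Proof.
move=> mphi h t; rewrite /convk (ge0_integral_shift t (cmeas_n1E mphi))//.
by move=> u; rewrite lee_fin n1_ge0.
Qed.

Lemma cintg_scale (r : R) (f : R -> R[i]) : 0 < r -> cintg mu f -> cintg mu (fun t => f (r * t)).
Proof.
move=> r0 [mf fi]; split.
  apply: (@cmeas_comp _ _ R _ _ (fun t : measurableTypeR R => (r * t) : measurableTypeR R) f) => //.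
  exact: measurable_mul_l.
have := ge0_integral_scale r0 (cmeas_n1E mf) (fun u => _).
move=> /(_ (fun u => eq_ind_r is_true (n1_ge0 (f u)) (lee_fin _ _))) e.
move: fi; rewrite -e.
have h0 : (0 <= \int[mu]_t (n1 (f (r * t)))%:E)%E.
  by apply: integral_ge0 => t _; rewrite lee_fin n1_ge0.
move: h0; case: (\int[mu]_t (n1 (f (r * t)))%:E)%E => //=.
- by move=> *; rewrite ltry.
- by move=> _; rewrite gt0_muley ?lte_fin.
Qed.

(** At [x = 1] this is Euler's Beta function B(z,w); for other x > 0 it is a convolution of powers,
    reduced to B(z,w) by scaling. *)
Definition beta_int z w x := cI mu (fun t => pw z (x - t) * pw w t).

Lemma pw_scale z r u : 0 < r -> pw z (r * u) = cpow r (z - 1) * pw z u.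
Proof.
move=> r0; rewrite /pw pmulr_rgt0//; case: ifP => u0; last by rewrite mulr0.
by rewrite cpowM.
Qed.

Lemma gint_conv z w x t : gint z (x - t) * gint w t = (expR (- x))%:C * (pw z (x - t) * pw w t).
Proof.
rewrite /gint mulrACA -rmorphM -expRD; congr ((expR _)%:C * _); ring.
Qed.

Section Fixed.
Variables z w : R[i].
Hypotheses (z0 : 0 < complex.Re z) (w0 : 0 < complex.Re w).

Let mG z' : cmeas (gint z' : measurableTypeR R -> _). Proof. exact: cmeas_gint. Qed.

Let F (p : measurableTypeR R * measurableTypeR R) := convk (gint z) p.1 p.2 * gint w p.2.

Let mF : cmeas F.
Proof.
apply: cmeasM; first exact: (kmeas_convk (mG z)).
by apply: (@cmeas_comp _ _ R _ _ (fun p : measurableTypeR R * measurableTypeR R => p.2) (gint w)); [exact: measurable_snd|exact: mG].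
Qed.

Let Cz := fine (\int[mu]_u (n1 (gint z u))%:E)%E.

Let CzE : (\int[mu]_u (n1 (gint z u))%:E = Cz%:E)%E.
Proof.
rewrite fineK// ge0_fin_numE; first exact: (proj2 (gint_intg z0)).
by apply: integral_ge0 => u _; rewrite lee_fin n1_ge0.
Qed.

Let Cz0 : 0 <= Cz.
Proof. by rewrite fine_ge0//; apply: integral_ge0 => u _; rewrite lee_fin n1_ge0. Qed.

Let iF : (\int[mu]_x \int[mu]_t (n1 (F (x, t)))%:E < +oo)%E.
Proof.
have bz : bnd mu (convk (gint z)) Cz by apply: bnd_convk => //; rewrite CzE.
apply: le_lt_trans (le_lt_trans (double_n1 (kmeas_convk (mG z)) bz Cz0 (mG w)) _); last first.
  by apply: lte_mul_pinfty; [rewrite lee_fin| |exact: (proj2 (gint_intg w0))].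
apply: ge0_le_integral => //.
- by move=> x _; apply: integral_ge0 => t _; rewrite lee_fin n1_ge0.
- apply: (measurable_fun_fubini_tonelli_F (fun p => (n1 (F p))%:E)) => //.
  + exact: (cmeas_n1E mF).
  + by move=> p; rewrite lee_fin n1_ge0.
- apply: (measurable_fun_fubini_tonelli_F (fun p : measurableTypeR R * measurableTypeR R =>
     (n1 (convk (gint z) p.1 p.2) * n1 (gint w p.2))%:E)) => //.
  + apply/measurable_EFinP; apply: measurable_funM; first exact: (cmeas_n1 (kmeas_convk (mG z))).
    by apply: (measurableT_comp (cmeas_n1 (mG w))).
  + by move=> p; rewrite lee_fin mulr_ge0 ?n1_ge0.
- move=> x _; apply: ge0_le_integral => //.
  + by move=> t _; rewrite lee_fin n1_ge0.
  + by apply: cmeas_n1E; apply: (cmeas_sec1 x mF).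
  + apply/measurable_EFinP; apply: measurable_funM; apply: cmeas_n1 => //.
    exact: (kmeas1 x (kmeas_convk (mG z))).
  + by move=> t _; rewrite lee_fin n1M.
Qed.

Lemma Gamma_mul_int : cGamma z * cGamma w =
  cI mu (fun x => cI mu (fun t => gint z (x - t) * gint w t)).
Proof.
rewrite (cFubini mF iF) !cGammaE -cIZl; last exact: gint_intg.
apply: eq_cI => t; rewrite -(cI_shift t (mG z)) -cIZr//.
split; first exact: (kmeas2 t (kmeas_convk (mG z))).
rewrite (ge0_integral_shift t (cmeas_n1E (mG z))).
  exact: (proj2 (gint_intg z0)).
by move=> u; rewrite lee_fin n1_ge0.
Qed.

(** Fubini yields integrability at almost every x. A single point is enough, because scaling
    transports it to every other x > 0. *)
Let conv_intg0 : exists2 x, 0 < x & cintg mu (fun t => pw z (x - t) * pw w t).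
Proof.
have [x /andP[x0 _] hx] := ae_exists ltr01 (ae_cintg_sec1 mF iF).
exists x => //; have := cintgZl (expR x)%:C hx.
congr cintg; apply/funext => t; rewrite /F /= /convk gint_conv mulrA -rmorphM -expRD subrr expR0.
by rewrite mul1r.
Qed.

Lemma conv_scale (r x t : R) : 0 < r ->
  pw z (r * x - r * t) * pw w (r * t) = cpow r (z + w - 1 - 1) * (pw z (x - t) * pw w t).
Proof.
move=> r0; rewrite -mulrBr !pw_scale// mulrACA -cpowD//; congr (cpow _ _ * _); ring.
Qed.

Lemma conv_intg x : 0 < x -> cintg mu (fun t => pw z (x - t) * pw w t).
Proof.
move=> x0; have [y y0 hy] := conv_intg0.
have r0 : 0 < y / x by rewrite divr_gt0.
have := cintgZl (cpow (y / x) (z + w - 1 - 1))^-1 (cintg_scale r0 hy).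
congr cintg; apply/funext => t.
have -> : y - y / x * t = y / x * x - y / x * t by rewrite divfK ?gt_eqF.
by rewrite conv_scale// mulKf// cpow_neq0.
Qed.

Lemma beta_intE x : 0 < x -> beta_int z w x = cpow x (z + w - 1) * beta_int z w 1.
Proof.
move=> x0; rewrite /beta_int -(cI_scale x0 (conv_intg x0)).
rewrite (cpowS (z + w - 1) x0) -mulrA; congr (_ * _).
rewrite -cIZl; last exact: (conv_intg ltr01).
apply: eq_cI => t.
have -> : x - x * t = x * 1 - x * t by rewrite mulr1.
by rewrite conv_scale.
Qed.

(** The product of the two Gamma integrands at x - t and t is e^(-x) times the convolution of the
    powers. By homogeneity the inner integral is e^(-x) x^(z+w-1) B(z,w), and the outer one is then
    Gamma(z+w) B(z,w). *)
Lemma Gamma_beta : cGamma z * cGamma w = cGamma (z + w) * beta_int z w 1.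
Proof.
rewrite Gamma_mul_int cGammaE -cIZr; last by apply: gint_intg; rewrite cReD addr_gt0.
apply: eq_cI => x; rewrite [gint (z + w) x]/gint [pw (z + w) x]/pw; case: ifP => x0; last first.
  rewrite mulr0 mul0r -[RHS](cI0 mu); apply: eq_cI => t; rewrite gint_conv /pw.
  case: ifP => h1; case: ifP => h2; rewrite ?(mulr0, mul0r)//.
  by exfalso; move: x0 => /negbT; rewrite -leNgt; lra.
rewrite -mulrA -beta_intE// /beta_int -cIZl; last exact: conv_intg.
by apply: eq_cI => t; rewrite gint_conv.
Qed.

End Fixed.

Lemma Gamma1 : cGamma (1 : R[i]) = 1.
Proof.
rewrite cGammaE.
have e : gint 1 = fun u => (if 0 < u then expR (- u) else 0)%:C :> R[i].
  apply/funext => u; rewrite /gint /pw subrr; case: ifP => _; last by rewrite mulr0.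
  by rewrite cpow0 mulr1.
apply/complexP; rewrite e ?Re_cI ?Im_cI /=; last first.
  by rewrite /Rintegral integral0.
have := @integral_exponential_pdf R 1 ltr01.
move=> /(congr1 fine) /= <-; rewrite /Rintegral; congr fine; apply: ae_eq_integral => //.
- apply/measurable_EFinP; apply: measurable_fun_ifT => //; first exact: measurable_pos.
  by apply: measurableT_comp => //.
- by apply/measurable_EFinP; exact: measurable_exponential_pdf.
(* The integrand and the exponential density differ at most at 0. *)
- have : mu.-negligible ([set 0] : set R) by apply/negligibleP => //; exact: lebesgue_measure_set1.
  apply: negligibleS => u /= /not_implyP[_ h]; apply: contrapT => u0; apply: h.
  congr EFin; case: (ltrgtP 0 u) => // h; last by case: u0.
    by rewrite exponential_pdfE ?(ltW h)// mul1r mulN1r.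
  by rewrite lt0_exponential_pdf.
Qed.

End Beta.

Section GammaFunctional.
Variable R : realType.
Local Notation mu := (@lebesgue_measure R).
Implicit Types (x y u r : R) (z w : R[i]).

Lemma Re_cpow x z : complex.Re (cpow x z) = x `^ complex.Re z * cos (complex.Im z * ln x).
Proof. by rewrite cpowE cReM ReR ImR mul0r subr0. Qed.

Lemma Im_cpow x z : complex.Im (cpow x z) = x `^ complex.Re z * sin (complex.Im z * ln x).
Proof. by rewrite cpowE cImM ReR ImR mul0r addr0. Qed.

Lemma is_derive_Re_cpow x z : 0 < x ->
  is_derive x 1 (fun v => complex.Re (cpow v z)) (complex.Re (z * cpow x (z - 1))).
Proof.
move=> x0.
have h1 := is_derive1_powR (complex.Re z) x0.
have h2 := is_derive1_ln x0.
have h3 : is_derive x 1 (fun v => complex.Im z * ln v) (complex.Im z *: x^-1) by exact: is_deriveZ.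
have h4 := @is_derive1_comp R (@cos R) (fun v => complex.Im z * ln v) x _ _ (is_derive_cos _) h3.
have h5 := is_deriveM h1 h4.
rewrite (_ : (fun v => complex.Re (cpow v z)) =
    (fun v => v `^ complex.Re z) * (@cos R \o (fun v => complex.Im z * ln v))); last first.
  by apply/funext => v; rewrite Re_cpow.
apply: (is_derive_eq h5).
rewrite cReM Re_cpow Im_cpow cReB cImB Re1 Im1 subr0 /= /GRing.scale /=.
have -> : x `^ complex.Re z = x `^ (complex.Re z - 1) * x.
  by rewrite -[X in _ = _ * X](powRr1 (ltW x0)) -powRD ?subrK// (gt_eqF x0) implybT.
by field; rewrite gt_eqF.
Qed.

Lemma is_derive_Im_cpow x z : 0 < x ->
  is_derive x 1 (fun v => complex.Im (cpow v z)) (complex.Im (z * cpow x (z - 1))).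
Proof.
move=> x0.
have h1 := is_derive1_powR (complex.Re z) x0.
have h2 := is_derive1_ln x0.
have h3 : is_derive x 1 (fun v => complex.Im z * ln v) (complex.Im z *: x^-1) by exact: is_deriveZ.
have h4 := @is_derive1_comp R (@sin R) (fun v => complex.Im z * ln v) x _ _ (is_derive_sin _) h3.
have h5 := is_deriveM h1 h4.
rewrite (_ : (fun v => complex.Im (cpow v z)) =
    (fun v => v `^ complex.Re z) * (@sin R \o (fun v => complex.Im z * ln v))); last first.
  by apply/funext => v; rewrite Im_cpow.
apply: (is_derive_eq h5).
rewrite cImM Re_cpow Im_cpow cReB cImB Re1 Im1 subr0 /= /GRing.scale /=.
have -> : x `^ complex.Re z = x `^ (complex.Re z - 1) * x.
  by rewrite -[X in _ = _ * X](powRr1 (ltW x0)) -powRD ?subrK// (gt_eqF x0) implybT.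
by field; rewrite gt_eqF.
Qed.

Lemma cont_Re_cpow x z : 0 < x -> {for x, continuous (fun v => complex.Re (cpow v z))}.
Proof.
move=> x0; apply: differentiable_continuous; apply/derivable1_diffP.
by have [] := is_derive_Re_cpow z x0.
Qed.

Lemma cont_Im_cpow x z : 0 < x -> {for x, continuous (fun v => complex.Im (cpow v z))}.
Proof.
move=> x0; apply: differentiable_continuous; apply/derivable1_diffP.
by have [] := is_derive_Im_cpow z x0.
Qed.

Lemma pw_integrable z (d : R) : 0 < complex.Re z -> 0 < d ->
  mu.-integrable `]0, d] (EFin \o (fun u => complex.Re (cpow u (z - 1)))) /\
  mu.-integrable `]0, d] (EFin \o (fun u => complex.Im (cpow u (z - 1)))).
Proof.
move=> z0 d0.
have [m1 m2] := cmeas_cpow (z - 1).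
have H (f : R -> R) : measurable_fun setT (f : measurableTypeR R -> R) ->
    (forall u, 0 < u -> `|f u| <= n1 (cpow u (z - 1))) -> mu.-integrable `]0, d] (EFin \o f).
  move=> mf fle; apply/integrableP; split.
    by apply/measurable_EFinP; exact: measurable_funTS.
  apply: le_lt_trans (le_lt_trans (int_pw_fin z0 d0) _); last by rewrite ltry.
  rewrite integral_mkcond; apply: ge0_le_integral => //.
  - by move=> u _; apply: erestrict_ge0.
  - apply/(measurable_restrictT _ _).1 => //; apply: measurable_funTS.
    by apply/measurable_EFinP; apply: measurableT_comp.
  - apply/measurable_EFinP; apply: measurable_fun_ifT => //; first exact: measurable_fun_ler.
    by apply: cmeas_n1; exact: cmeas_pw.
  - move=> u _; rewrite patchE; case: ifPn; last first.
      by move=> _; rewrite lee_fin; case: ifP => // _; exact: n1_ge0.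
    by rewrite inE /= in_itv/= => /andP[u0 ud]; rewrite ud /pw u0 lee_fin fle.
by split; apply: H => // u _; [exact: ler_Re_n1|exact: ler_Im_n1].
Qed.

Lemma beta_int_1E z x : 0 < complex.Re z -> 0 < x ->
  beta_int 1 z x = Rintegral mu `]0, x] (fun u => complex.Re (cpow u (z - 1))) +i*
    Rintegral mu `]0, x] (fun u => complex.Im (cpow u (z - 1))).
Proof.
move=> z0 x0; have [i1 i2] := pw_integrable z0 x0.
have sub : `]0, x[%classic `<=` `]0, x]%classic by apply: subset_itvl; rewrite bnd_simp.
have e u : pw 1 (x - u) * pw z u = if u \in `]0, x[%classic then cpow u (z - 1) else 0.
  rewrite /pw subr_gt0 subrr cpow0.
  have -> : (u \in `]0, x[%classic) = (0 < u) && (u < x) by apply/idP/idP; rewrite inE/= in_itv.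
  by case: (0 < u) => /=; case: (u < x); rewrite ?(mul0r, mulr0, mul1r).
rewrite /beta_int (eq_cI mu e) -cint_cI.
have m1 : measurable (`]0, x[%classic : set (measurableTypeR R)) by exact: measurable_itv.
have m2 : measurable (`]0, x]%classic : set (measurableTypeR R)) by exact: measurable_itv.
rewrite -!Rintegral_itv_bndo_bndc//.
- exact: integrableS i2.
- exact: integrableS i1.
Qed.

(** This is the integral of u^(z-1) over (0,1). It is found without a limit at 0: near x = 1 the
    integral over (0,x) equals x^z B(1,z), and its derivative at 1 is 1 by the fundamental theorem
    and z B(1,z) by the power rule. *)
Lemma beta_int_1 z : 0 < complex.Re z -> z * beta_int 1 z 1 = 1.
Proof.
move=> z0; set B := beta_int 1 z 1.
have [i1 i2] := pw_integrable z0 (ltr0n R 2).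
have lt12 : (1 : R) < 2 by rewrite (ltr_nat R 1 2).
have E x : 0 < x -> beta_int 1 z x = cpow x z * B.
  by move=> x0; rewrite (@beta_intE R 1 z ltr01 z0 x x0) addrAC subrr add0r.
clearbody B.
have nearpos : \forall x \near (1 : R), 0 < x by exact: lt_nbhsr.
apply/complexP.
- have [_ h] := continuous_FTC1 lt12 i1 (ltr01 : BRight (0 : R) < BRight 1)%O (@cont_Re_cpow 1 (z - 1) ltr01).
  rewrite derive1E in h.
  have e1 : complex.Re (cpow (1 : R) (z - 1)) = 1 by rewrite Re_cpow powR1 ln1 mulr0 cos0 mulr1.
  rewrite e1 in h; rewrite Re1 -h.
  have -> : 'D_1 (fun y => Rintegral mu `]0, y] (fun u => complex.Re (cpow u (z - 1)))) 1 =
    'D_1 (fun y => complex.Re (cpow y z) * complex.Re B - complex.Im (cpow y z) * complex.Im B) (1 : R).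
    apply: near_eq_derive.
    near=> y; have y0 : 0 < y by near: y.
    by rewrite -cReM -E// beta_int_1E.
  have d1 := is_derive_Re_cpow z (ltr01 : 0 < 1 :> R).
  have d2 := is_derive_Im_cpow z (ltr01 : 0 < 1 :> R).
  have [_ h3] := is_deriveB (is_deriveZ (complex.Re B) d1) (is_deriveZ (complex.Im B) d2).
  transitivity (complex.Re B *: complex.Re (z * cpow 1 (z - 1)) - complex.Im B *: complex.Im (z * cpow 1 (z - 1))).
    rewrite cpow1l mulr1 /GRing.scale /= ?cReM ?cImM; ring.
  rewrite -h3; apply: (congr1 (fun F : R -> R => derive F (1 : R) (1 : R))); apply/funext => v.
  by rewrite !(mulrC (complex.Re (cpow _ _))) !(mulrC (complex.Im (cpow _ _))).
- have [_ h] := continuous_FTC1 lt12 i2 (ltr01 : BRight (0 : R) < BRight 1)%O (@cont_Im_cpow 1 (z - 1) ltr01).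
  rewrite derive1E in h.
  have e1 : complex.Im (cpow (1 : R) (z - 1)) = 0 by rewrite Im_cpow powR1 ln1 mulr0 sin0 mulr0.
  rewrite e1 in h; rewrite Im1 -h.
  have -> : 'D_1 (fun y => Rintegral mu `]0, y] (fun u => complex.Im (cpow u (z - 1)))) 1 =
    'D_1 (fun y => complex.Re (cpow y z) * complex.Im B + complex.Im (cpow y z) * complex.Re B) (1 : R).
    apply: near_eq_derive.
    near=> y; have y0 : 0 < y by near: y.
    by rewrite -cImM -E// beta_int_1E.
  have d1 := is_derive_Re_cpow z (ltr01 : 0 < 1 :> R).
  have d2 := is_derive_Im_cpow z (ltr01 : 0 < 1 :> R).
  have [_ h3] := is_deriveD (is_deriveZ (complex.Im B) d1) (is_deriveZ (complex.Re B) d2).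
  transitivity (complex.Im B *: complex.Re (z * cpow 1 (z - 1)) + complex.Re B *: complex.Im (z * cpow 1 (z - 1))).
    rewrite cpow1l mulr1 /GRing.scale /= ?cReM ?cImM; ring.
  rewrite -h3; apply: (congr1 (fun F : R -> R => derive F (1 : R) (1 : R))); apply/funext => v.
  by rewrite !(mulrC (complex.Re (cpow _ _))) !(mulrC (complex.Im (cpow _ _))).
Unshelve. all: by end_near. Qed.

(** Instead of an integration by parts: Gamma(1) Gamma(z) = Gamma(1+z) B(1,z), with Gamma(1) = 1 and
    z B(1,z) = 1. *)
Lemma GammaS z : 0 < complex.Re z -> cGamma (z + 1) = z * cGamma z.
Proof.
move=> z0; have := Gamma_beta (ltr01 : 0 < complex.Re (1 : R[i])) z0.
rewrite Gamma1 mul1r addrC => ->.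
by rewrite mulrCA beta_int_1// mulr1.
Qed.

End GammaFunctional.

(** * Gamma has no zero in the right half-plane *)

Section GammaNonzero.
Variable R : realType.
Local Notation mu := (@lebesgue_measure R).
Implicit Types (x y u r s : R) (z w : R[i]).

Lemma powRS t s : 0 < t -> t `^ (s + 1) = t `^ s * t.
Proof. by move=> t0; rewrite powRD ?(gt_eqF t0) ?implybT// powRr1// ltW. Qed.

Lemma sin_sqr_le x : sin x ^+ 2 <= x ^+ 2.
Proof.
wlog x0 : x / 0 <= x.
  move=> H; have [/H//|x0] := leP 0 x.
  by have := H (- x); rewrite sinN !sqrrN; apply; rewrite oppr_ge0 ltW.
have [] := @MVT_segment R (@sin R) (@cos R) 0 x x0 (fun _ _ => is_derive_sin _).
  by apply: continuous_subspaceT => u; exact: continuous_sin.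
move=> c _; rewrite sin0 !subr0 => ->; rewrite exprMn ler_piMl ?sqr_ge0//.
Qed.

Lemma cos_ge x : 1 - x ^+ 2 / 2 <= cos x.
Proof.
have -> : cos x = 1 - 2 * sin (x / 2) ^+ 2.
  have e : (x / 2) *+ 2 = x by rewrite -mulr_natr divfK.
  rewrite -{1}e cos_mulr2n.
  by rewrite cos2sin2; ring.
have := sin_sqr_le (x / 2); lra.
Qed.

(** With E = u^(1/2) the right-hand side is 4 (E - 1/E)^2, and |ln u| / 2 is at most |E - 1/E| by
    e^v >= 1 + v. Being linear in u and 1/u, the bound integrates against e^(-t) t^(s-1) to values
    of Gamma at s + 1, s and s - 1. *)
Lemma ln_sqr_le u : 0 < u -> ln u ^+ 2 <= 4 * (u - 2 + u^-1).
Proof.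
move=> u0; set x := ln u; have uE : u = expR x by rewrite lnK.
pose E := expR (x / 2); have E0 : 0 < E by exact: expR_gt0.
have EE : u = E * E by rewrite uE -expRD -splitr.
have EV : E^-1 = expR (- (x / 2)) by rewrite expRN.
have h1 : x / 2 <= E - 1 by have := expR_ge1Dx (x / 2); rewrite -/E; lra.
have h2 : - (x / 2) <= E^-1 - 1 by rewrite EV; have := expR_ge1Dx (- (x / 2)); lra.
have V0 : 0 < E^-1 by rewrite invr_gt0.
have EEV : E * E^-1 = 1 by rewrite divff// gt_eqF.
rewrite EE invfM; set V := E^-1 in h2 V0 EEV *.
have -> : 4 * (E * E - 2 + V * V) = 4 * (E - V) ^+ 2 by rewrite -EEV; ring.
have [x0|x0] := leP 0 x.
- have V1 : V <= 1 by rewrite /V EV -[leRHS]expR0 ler_expR oppr_le0 divr_ge0.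
  have : (x / 2) ^+ 2 <= (E - V) ^+ 2 by rewrite lerXn2r ?nnegrE ?divr_ge0//; lra.
  lra.
- have E1 : E <= 1 by rewrite /E -[leRHS]expR0 ler_expR; lra.
  have : (- (x / 2)) ^+ 2 <= (V - E) ^+ 2 by rewrite lerXn2r ?nnegrE//; lra.
  rewrite sqrrN; lra.
Qed.

Definition gr s u : R := if 0 < u then expR (- u) * u `^ (s - 1) else 0.

Lemma gintR s u : gint s%:C u = (gr s u)%:C.
Proof.
rewrite /gint /pw /gr; case: ifP => u0; last by rewrite mulr0.
rewrite cpowE cReB ReR Re1 cImB ImR Im1 subrr mul0r cis0 mulr1.
by apply/complexP; rewrite ?cReM ?cImM !(ReR, ImR); ring.
Qed.

Lemma gr_intg s : 0 < s -> mu.-integrable setT (EFin \o gr s).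
Proof.
move=> s0; have := cintg_Re (@gint_intg R s%:C s0).
by apply: eq_integrable => // u _ /=; rewrite gintR.
Qed.

Definition Gr s : R := Rintegral mu setT (gr s).

Lemma cGammaR s : cGamma s%:C = (Gr s)%:C.
Proof.
rewrite cGammaE; apply/complexP; rewrite ?Re_cI ?Im_cI.
- by apply: eq_Rintegral => u _; rewrite gintR.
- rewrite ImR -[RHS](@Rintegral_set0 _ _ R mu (fun=> 0)) /Rintegral integral_set0 integral0_eq// => u _.
  by rewrite gintR.
Qed.

Lemma GrS s : 0 < s -> Gr (s + 1) = s * Gr s.
Proof.
move=> s0; have := @GammaS R s%:C s0.
have -> : s%:C + 1 = (s + 1)%:C :> R[i] by apply/complexP; rewrite ?cReD ?cImD//= addr0.
by rewrite !cGammaR -rmorphM => /complexI.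
Qed.

Lemma gr_ge0 s u : 0 <= gr s u.
Proof. by rewrite /gr; case: ifP => // _; rewrite mulr_ge0 ?expR_ge0 ?powR_ge0. Qed.

Lemma Gr_gt0 s : 0 < s -> 0 < Gr s.
Proof.
move=> s0; rewrite lt_neqAle; apply/andP; split; last by apply: Rintegral_ge0 => u _; exact: gr_ge0.
apply/eqP => e.
have mg : measurable_fun setT (gr s : measurableTypeR R -> R).
  by apply/measurable_EFinP; exact: measurable_int (gr_intg s0).
have : (\int[mu]_u (gr s u)%:E = 0)%E.
  have := integrable_fin_num measurableT (gr_intg s0) => h.
  by rewrite -(fineK h) -[fine _]/(Gr s) -e.
have [H _] := integral_eq0_ae mu (fun u => gr_ge0 s u) mg.
move=> /H /(ae_exists ltr01) [u /andP[u0 _]].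
rewrite /gr u0 => /eqP; rewrite mulf_eq0 expR_eq0 /= => /eqP h.
by have := powR_gt0 (s - 1) u0; rewrite h ltxx.
Qed.

(* A zero of Gamma at z propagates to z + n.  But with s = Re z + n, y = Im z,
   s^(-iy) Gamma(z + n) has real part at least
   int e^(-t) t^(s-1) (1 - y^2 ln^2 (t/s) / 2) dt, and ln^2 u <= 4 (u - 2 + 1/u)
   bounds this below by Gamma(s - 1) (s - 1 - 2 y^2). *)
Lemma Gamma_neq0 z : 0 < complex.Re z -> cGamma z != 0.
Proof.
move=> z0; apply/eqP => Gz.
have Gzn n : cGamma (z + n%:R) = 0.
  elim: n => [|n IH]; first by rewrite addr0.
  rewrite -natr1 addrA GammaS ?IH ?mulr0// cReD Re_nat ltr_wpDr//.
pose y := complex.Im z.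
(* [m] exceeds 2 y^2, and [n] is one more, so that s - 1 = Re z + m exceeds 2 y^2: the lower bound
   Gamma(s - 1) (s - 1 - 2 y^2) is then positive. *)
pose m := (Num.truncn (2 * y ^+ 2)).+1.
pose n := m.+1.
pose s := complex.Re z + n%:R.
have ny : 2 * y ^+ 2 < m%:R by rewrite /m truncnS_gt.
have s1 : 2 * y ^+ 2 < s - 1.
  rewrite /s /n -natr1; move: ny z0; set mm := m%:R; lra.
have sgt1 : 0 < s - 1 by apply: le_lt_trans s1; rewrite mulr_ge0 ?sqr_ge0.
have s0 : 0 < s by lra.
have zs : complex.Re (z + n%:R) = s by rewrite cReD Re_nat.
have ys : complex.Im (z + n%:R) = y by rewrite cImD Im_nat addr0.
have zn0 : 0 < complex.Re (z + n%:R) by rewrite zs.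
have gi := @gint_intg R _ zn0.
have h0 : Rintegral mu setT (fun t => complex.Re (cis (- (y * ln s)) * gint (z + n%:R) t)) = 0.
  by rewrite -Re_cI cIZl// -cGammaE Gzn mulr0.
have ge t : gr s t - 2 * y ^+ 2 * (s^-1 * gr (s + 1) t - 2 * gr s t + s * gr (s - 1) t) <=
    complex.Re (cis (- (y * ln s)) * gint (z + n%:R) t).
  rewrite /gint /pw /gr; case: ifP => t0; last by rewrite !mulr0 Re0; lra.
  have -> : cis (- (y * ln s)) * ((expR (- t))%:C * cpow t (z + n%:R - 1)) =
      (expR (- t) * t `^ (s - 1))%:C * cis (y * ln (t / s)).
    rewrite cpowE cReB cImB Re1 Im1 subr0 zs ys ln_div ?posrE//.
    by rewrite mulrBr cisD rmorphM; ring.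
  rewrite cReM ReR ImR mul0r subr0 Re_cis; set w := expR (- t) * t `^ (s - 1).
  have w0 : 0 <= w by rewrite mulr_ge0 ?expR_ge0 ?powR_ge0.
  have e1 : expR (- t) * t `^ (s + 1 - 1) = w * t.
    by rewrite /w -mulrA -powRS//; congr (_ * _ `^ _); ring.
  have e2 : expR (- t) * t `^ (s - 1 - 1) = w / t.
    by rewrite /w -[in RHS](subrK 1 (s - 1)) powRS// mulrA mulfK// gt_eqF.
  rewrite e1 e2.
  have -> : w - 2 * y ^+ 2 * (s^-1 * (w * t) - 2 * w + s * (w / t)) =
    w * (1 - y ^+ 2 * (4 * (t / s - 2 + (t / s)^-1)) / 2).
    by field; rewrite !gt_eqF.
  rewrite ler_wpM2l//; apply: le_trans (cos_ge _); rewrite exprMn.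
  have := ln_sqr_le (divr_gt0 t0 s0) => h.
  by rewrite lerB// ler_pM2r ?invr_gt0// ler_wpM2l// sqr_ge0.
have i1 := gr_intg s0.
have i2 := @gr_intg (s + 1) (addr_gt0 s0 ltr01).
have i3 := gr_intg sgt1.
have iZ c (f : R -> R) : mu.-integrable setT (EFin \o f) -> mu.-integrable setT (EFin \o (fun t => c * f t)).
  by move=> fi; exact: (@integrableZl _ _ R mu setT measurableT c (EFin \o f)).
have iD (f h : R -> R) : mu.-integrable setT (EFin \o f) -> mu.-integrable setT (EFin \o h) ->
    mu.-integrable setT (EFin \o (fun t => f t + h t)).
  by move=> fi hi; exact: (@integrableD _ _ R mu setT measurableT (EFin \o f) (EFin \o h)).
have iB (f h : R -> R) : mu.-integrable setT (EFin \o f) -> mu.-integrable setT (EFin \o h) ->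
    mu.-integrable setT (EFin \o (fun t => f t - h t)).
  by move=> fi hi; exact: (@integrableB _ _ R mu setT measurableT (EFin \o f) (EFin \o h)).
have iY := iB _ _ (iZ s^-1 _ i2) (iZ 2 _ i1).
have iX := iD _ _ iY (iZ s _ i3).
have iL := iB _ _ i1 (iZ (2 * y ^+ 2) _ iX).
have := le_Rintegral measurableT iL (cintg_Re (cintgZl (cis (- (y * ln s))) gi)) (fun t _ => ge t).
rewrite h0 RintegralB//; last exact: (iZ (2 * y ^+ 2) _ iX).
rewrite (RintegralZl _ measurableT iX) (RintegralD measurableT iY (iZ s _ i3)).
rewrite (RintegralB measurableT (iZ s^-1 _ i2) (iZ 2 _ i1)).
rewrite !RintegralZl// -!/(Gr _) GrS// leNgt => /negP; apply.
have es : Gr s = (s - 1) * Gr (s - 1) by rewrite -(GrS sgt1) subrK.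
rewrite es.
have G0 := Gr_gt0 sgt1.
have -> : (s - 1) * Gr (s - 1) - 2 * y ^+ 2 * (s^-1 * (s * ((s - 1) * Gr (s - 1))) -
   2 * ((s - 1) * Gr (s - 1)) + s * Gr (s - 1)) = Gr (s - 1) * (s - 1 - 2 * y ^+ 2).
  by field; rewrite gt_eqF.
by rewrite mulr_gt0// subr_gt0.
Qed.

End GammaNonzero.

Section ReciprocalGamma.
Variable R : realType.
Local Notation mu := (@lebesgue_measure R).
Implicit Types (x y u r s : R) (z w : R[i]).

Lemma rGammaE z : 0 < complex.Re z -> rGamma z = (cGamma z)^-1.
Proof. by move=> z0; rewrite /rGamma z0. Qed.

Lemma rGamma_neq0 z : 0 < complex.Re z -> rGamma z != 0.
Proof. by move=> z0; rewrite rGammaE// invr_eq0 Gamma_neq0. Qed.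

Lemma rGamma1 : rGamma (1 : R[i]) = 1.
Proof. by rewrite rGammaE ?ltr01// Gamma1 invr1. Qed.

Lemma complex_neq0 z : 0 < complex.Re z -> z != 0.
Proof. by move=> z0; apply/eqP => e; rewrite e ltxx in z0. Qed.

(** Valid on the whole plane, poles of Gamma included, where both sides vanish. The cases follow the
    definition of [rGamma]: for -1 < Re z <= 0 its product is the single factor z, and further left
    both sides use the same shifted value of Gamma. *)
Lemma rGammaS z : rGamma z = z * rGamma (z + 1).
Proof.
have R1 : complex.Re (z + 1) = complex.Re z + 1 by rewrite cReD.
have [z0|z0] := boolP (0 < complex.Re z).
  rewrite !rGammaE ?R1 ?addr_gt0// GammaS// invfM mulrA divff ?mul1r//.
  exact: complex_neq0.
rewrite /rGamma (negbTE z0); rewrite -leNgt in z0.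
have [z1|z1] := boolP (0 < complex.Re (z + 1)).
  have -> : Num.truncn (- complex.Re z) = 0%N.
    by apply: truncn_def; move: z1; rewrite R1 => ?; apply/andP; split; lra.
  by rewrite big_ord1 addr0.
rewrite -leNgt R1 in z1.
have tr : Num.truncn (- complex.Re z) = (Num.truncn (- complex.Re (z + 1))).+1.
  apply: truncn_def; rewrite R1.
  have h : 0 <= - (complex.Re z + 1) by lra.
  have /andP[h1 h2] := truncn_itv h.
  by rewrite -!natr1 in h2 *; apply/andP; split; lra.
rewrite tr; set m := (Num.truncn _).+1.
rewrite big_ord_recl addr0 -mulrA; congr (_ * (_ / cGamma _)).
- by apply: eq_bigr => k _; rewrite /bump /= -natr1 [_ + 1]addrC addrA.
- by rewrite -natr1 [_ + 1]addrC addrA.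
Qed.

(* kf z (x - t) is the kernel of I^z; as 1 / Gamma is entire, kf (z - 1) is the
   derivative of kf z on u > 0 for every z. *)
Definition kf z u : R[i] := rGamma z * pw z u.

Lemma cmeas_kf z : cmeas (kf z : measurableTypeR R -> _).
Proof. by apply: cmeasM; [exact: cmeas_cst|exact: cmeas_pw]. Qed.

Lemma kf_pos z u : 0 < u -> kf z u = rGamma z * cpow u (z - 1).
Proof. by rewrite /kf /pw => ->. Qed.

Lemma kf_le0 z u : u <= 0 -> kf z u = 0.
Proof. by move=> u0; rewrite /kf /pw ltNge u0 mulr0. Qed.

Lemma kf1 u : 0 < u -> kf 1 u = 1.
Proof. by move=> u0; rewrite kf_pos// rGamma1 subrr cpow0 mulr1. Qed.

(** The semigroup law at the level of kernels: the Beta identity divided by Gamma(z), Gamma(w) and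
    Gamma(z+w), which are nonzero by [Gamma_neq0]. *)
Lemma kf_conv z w x : 0 < complex.Re z -> 0 < complex.Re w ->
  cI mu (fun t => kf z (x - t) * kf w t) = kf (z + w) x.
Proof.
move=> z0 w0; have [x0|x0] := leP x 0.
  rewrite kf_le0// -[RHS](cI0 mu); apply: eq_cI => t.
  have [t0|t0] := leP t 0; first by rewrite [kf w t]kf_le0// mulr0.
  by rewrite kf_le0 ?mul0r//; lra.
have zw0 : 0 < complex.Re (z + w) by rewrite cReD addr_gt0.
transitivity (rGamma z * rGamma w * beta_int z w x).
  rewrite /beta_int -cIZl; last exact: conv_intg.
  by apply: eq_cI => t; rewrite /kf mulrACA.
rewrite beta_intE// kf_pos// !rGammaE// mulrCA mulrC; congr (_ * _).
apply: (mulfI (Gamma_neq0 zw0)); rewrite divff ?Gamma_neq0//.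
transitivity ((cGamma z)^-1 / cGamma w * (cGamma (z + w) * beta_int z w 1)); first by ring.
rewrite -Gamma_beta//.
by field; rewrite !Gamma_neq0.
Qed.

Lemma int_kf_fin z (d : R) : 0 < complex.Re z -> 0 < d ->
  (\int[mu]_u (if (u <= d) then n1 (kf z u) else 0)%:E < +oo)%E.
Proof.
move=> z0 d0.
apply: (@le_lt_trans _ _ ((n1 (rGamma z))%:E * \int[mu]_u (if (u <= d) then n1 (pw z u) else 0)%:E)%E).
  have mif (y : R[i]) : measurable_fun setT (fun u : measurableTypeR R => if ((u : R) <= d)%R then n1 (pw z u) else 0).
    apply: measurable_fun_ifT => //; first exact: measurable_fun_ler.
    by apply: cmeas_n1; exact: cmeas_pw.
  rewrite -ge0_integralZl_EFin ?n1_ge0//; last 2 first.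
  - by move=> u _; rewrite lee_fin; case: ifP => // _; exact: n1_ge0.
  - by apply/measurable_EFinP; exact: mif.
  apply: ge0_le_integral => //.
  - by move=> u _; rewrite lee_fin; case: ifP => // _; exact: n1_ge0.
  - apply/measurable_EFinP; apply: measurable_fun_ifT => //; first exact: measurable_fun_ler.
    by apply: cmeas_n1; exact: cmeas_kf.
  - by apply: emeasurable_funM => //; apply/measurable_EFinP; exact: mif.
  - move=> u _; rewrite -EFinM lee_fin; case: ifP => _; last by rewrite mulr0.
    exact: n1M.
apply: lte_mul_pinfty => //; first by rewrite lee_fin n1_ge0.
by apply: le_lt_trans (int_pw_fin z0 d0) _; rewrite ltry.
Qed.

Lemma kf_dE z u : 0 < u -> kf (z - 1) u = rGamma z * ((z - 1) * cpow u (z - 1 - 1)).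
Proof. by move=> u0; rewrite kf_pos// (rGammaS (z - 1)) subrK mulrA [_ * rGamma z]mulrC mulrA. Qed.

Lemma is_derive_kf z u : 0 < u ->
  is_derive u 1 (fun v => complex.Re (rGamma z * cpow v (z - 1))) (complex.Re (kf (z - 1) u)) /\
  is_derive u 1 (fun v => complex.Im (rGamma z * cpow v (z - 1))) (complex.Im (kf (z - 1) u)).
Proof.
move=> u0; rewrite kf_dE//.
have d1 := is_derive_Re_cpow (z - 1) u0.
have d2 := is_derive_Im_cpow (z - 1) u0.
set c := rGamma z; split.
- rewrite (_ : (fun v => _) = (complex.Re c *: (fun v => complex.Re (cpow v (z - 1)))) -
     (complex.Im c *: (fun v => complex.Im (cpow v (z - 1))))); last first.
    by apply/funext => v; rewrite cReM.
  by apply: (is_derive_eq (is_deriveB (is_deriveZ _ d1) (is_deriveZ _ d2))); rewrite [in RHS]cReM.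
- rewrite (_ : (fun v => _) = (complex.Re c *: (fun v => complex.Im (cpow v (z - 1)))) +
     (complex.Im c *: (fun v => complex.Re (cpow v (z - 1))))); last first.
    by apply/funext => v; rewrite cImM.
  by apply: (is_derive_eq (is_deriveD (is_deriveZ _ d2) (is_deriveZ _ d1))); rewrite [in RHS]cImM.
Qed.

End ReciprocalGamma.

(** * Absolute continuity and a.e. derivatives *)

Section LebesgueAe.
Variable R : realType.
Local Notation mu := (@lebesgue_measure R).

#[global] Instance ae_lebesgue_filter : Filter (nbhs (almost_everywhere mu)).
Proof. exact: (@ae_filter_ringOfSetsType _ (measurableTypeR R) R mu). Qed.

Lemma ae_neq (x0 : R) : {ae mu, forall x, x != x0}.
Proof.
exists [set x0]; split; [exact: measurable_set1|exact: lebesgue_measure_set1|].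
by move=> x /= /negP; rewrite negbK => /eqP.
Qed.

End LebesgueAe.

(** * Step functions on uniform subdivisions of an interval *)

Section StepFunctions.
Variable R : realType.
Local Notation mu := (@lebesgue_measure R).
Variables (c b : R).
Hypothesis cb : c < b.
Implicit Types (a : nat -> R) (N k : nat) (x : R).

Definition mesh N : R := (b - c) / N.+1%:R.
Definition node N k : R := c + mesh N * k%:R.
Definition cell N k x : bool := (node N k <= x) && (x < node N k.+1).
Definition step N a x : R := \sum_(k < N.+1) (if cell N k x then a k else 0).

Lemma mesh_gt0 N : 0 < mesh N.
Proof. by rewrite divr_gt0 ?subr_gt0. Qed.

Lemma nodeS N k : node N k.+1 = node N k + mesh N.
Proof. by rewrite /node -natr1 mulrDr mulr1 addrA. Qed.

Lemma node_le N k k' : (k <= k')%N -> node N k <= node N k'.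
Proof. by move=> kk; rewrite lerD2l ler_pM2l ?mesh_gt0// ler_nat. Qed.

Lemma node0 N : node N 0 = c.
Proof. by rewrite /node mulr0 addr0. Qed.

Lemma node_last N : node N N.+1 = b.
Proof. by rewrite /node /mesh divfK// subrKC. Qed.

Lemma cell_uniq N k k' x : cell N k x -> cell N k' x -> k = k'.
Proof.
move=> /andP[h1 h2] /andP[h3 h4].
case: (ltngtP k k') => // kk.
- by have := node_le N kk; rewrite leNgt (le_lt_trans h3 h2).
- by have := node_le N kk; rewrite leNgt (le_lt_trans h1 h4).
Qed.

Lemma step_cell N a k x : (k < N.+1)%N -> cell N k x -> step N a x = a k.
Proof.
move=> kN kx; rewrite /step (bigD1 (Ordinal kN))//= kx big1 ?addr0// => i ik.
case: ifP => // ix; case/eqP: ik; apply: val_inj => /=; exact: cell_uniq ix kx.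
Qed.

Lemma step_cases N x : (forall a, step N a x = 0) \/
  (exists2 k, (k < N.+1)%N & forall a, step N a x = a k).
Proof.
have [[k kx]|no] := pselect (exists k : 'I_N.+1, cell N k x).
  by right; exists k => // a; apply: step_cell.
left => a; rewrite /step big1// => k _; case: ifP => // kx; case: no; by exists k.
Qed.

Lemma cell_ex N x : c < x < b -> exists2 k, (k < N.+1)%N & cell N k x.
Proof.
move=> /andP[cx xb]; set r := (x - c) / mesh N.
have r0 : 0 <= r by rewrite divr_ge0 ?ltW ?mesh_gt0// subr_gt0.
have /andP[h1 h2] := truncn_itv r0.
have rN : r < N.+1%:R.
  rewrite ltr_pdivrMr ?mesh_gt0// mulrC /mesh divfK//; lra.
exists (Num.truncn r); first by rewrite -(ltr_nat R) (le_lt_trans h1 rN).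
apply/andP; split; rewrite /node.
- by move: h1; rewrite ler_pdivlMr ?mesh_gt0// mulrC => h1; lra.
- by move: h2; rewrite ltr_pdivrMr ?mesh_gt0// mulrC => h2; lra.
Qed.

Lemma cellE N k a x : (if cell N k x then a k else 0) = a k * \1_(`[node N k, node N k.+1[%classic) x.
Proof.
rewrite indicE /cell.
have -> : (x \in `[node N k, node N k.+1[%classic) = (node N k <= x) && (x < node N k.+1).
  by apply/idP/idP; rewrite inE/= in_itv.
by case: ifP => _; rewrite ?mulr1 ?mulr0.
Qed.

Lemma cell_integrable N k a : mu.-integrable setT (EFin \o (fun x => if cell N k x then a k else 0)).
Proof.
have -> : (EFin \o (fun x => if cell N k x then a k else 0)) =
    (fun x => (a k)%:E * (\1_(`[node N k, node N k.+1[%classic) x)%:E)%E.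
  by apply/funext => x /=; rewrite cellE EFinM.
by apply: integrableZl => //; exact: integrable_indic_itv.
Qed.

Lemma cell_int N k a : Rintegral mu setT (fun x => if cell N k x then a k else 0) = a k * mesh N.
Proof.
under eq_Rintegral do rewrite cellE.
rewrite RintegralZl//; last exact: integrable_indic_itv.
have h := mesh_gt0 N.
have -> : Rintegral mu setT (\1_(`[node N k, node N k.+1[%classic)) = mesh N => //.
rewrite /Rintegral integral_indic// setIT.
suff e : mu `[node N k, node N k.+1[%classic = (mesh N)%:E by exact: (congr1 fine e).
by rewrite lebesgue_measure_itv/= lte_fin nodeS ltrDl h/= -EFinB addrAC subrr add0r.
Qed.

Lemma step_integrable N a : mu.-integrable setT (EFin \o step N a).
Proof.
have -> : EFin \o step N a = (fun x => \sum_(k < N.+1) (EFin \o (fun x => if cell N k x then a k else 0)%R) x)%E.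
  by apply/funext => x /=; rewrite sumEFin.
by apply: integrable_sum => // k _; exact: cell_integrable.
Qed.

Lemma step_int N a : Rintegral mu setT (step N a) = \sum_(k < N.+1) a k * mesh N.
Proof.
rewrite /Rintegral.
have -> : (\int[mu]_x (step N a x)%:E =
    \int[mu]_x \sum_(k < N.+1) (EFin \o (fun x => if cell N k x then a k else 0)%R) x)%E.
  by apply: eq_integral => x _ /=; rewrite sumEFin.
rewrite integral_sum//; last by move=> k; exact: cell_integrable.
rewrite [X in fine X](_ : _ = (\sum_(k < N.+1) (a k * mesh N)%:E)%E).
  by rewrite sumEFin.
apply: eq_bigr => k _; rewrite -(cell_int N k a) /Rintegral fineK//.
by apply: integrable_fin_num => //; exact: cell_integrable.
Qed.

Lemma measurable_step N a : measurable_fun setT (step N a : measurableTypeR R -> R).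
Proof. by apply/measurable_EFinP; exact: measurable_int (step_integrable N a). Qed.

End StepFunctions.

Section AbsoluteContinuity.
Variable R : realType.
Local Notation mu := (@lebesgue_measure R).

Definition racf (c b : R) (f : R -> R) : Prop :=
  forall e : R, 0 < e -> exists2 d : R, 0 < d &
    forall (N : nat) (u v : 'I_N -> R),
      (forall i, c <= u i /\ u i < v i /\ v i <= b) ->
      (forall i j, i != j -> v i <= u j \/ v j <= u i) ->
      \sum_i (v i - u i) < d ->
      \sum_i `|f (v i) - f (u i)| < e.

Definition clamp (M x : R) : R := Num.max (- M) (Num.min x M).

Lemma clamp_norm (M x : R) : 0 <= M -> `|clamp M x| <= M.
Proof.
move=> M0; rewrite /clamp ler_norml le_max lexx/= ge_max ge_min lexx orbT andbT; lra.
Qed.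

Lemma clamp_id (M x : R) : `|x| <= M -> clamp M x = x.
Proof.
rewrite ler_norml => /andP[h1 h2]; rewrite /clamp.
by rewrite !maxEle !minEle h2 h1.
Qed.

Lemma clampE (M x : R) : 0 <= M ->
  clamp M x = if x <= M then (if - M <= x then x else - M) else M.
Proof.
move=> M0; rewrite /clamp maxEle minEle; case: (boolP (x <= M)) => h1.
  case: (boolP (- M <= x)) => h2 //.
by rewrite (_ : - M <= M)//; lra.
Qed.

Lemma clamp_diff (M x : R) : 0 <= M -> `|x - clamp M x| <= (if M < `|x| then `|x| else 0).
Proof.
move=> M0; case: ifPn => [h|]; last first.
  by rewrite -leNgt => h; rewrite clamp_id// subrr normr0.
rewrite clampE//; case: (boolP (x <= M)) => h1; first case: (boolP (- M <= x)) => h2.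
- by rewrite subrr normr0.
- rewrite -ltNge in h2; rewrite [`|x|]ltr0_norm; last lra.
  rewrite ltr0_norm; lra.
- rewrite -ltNge in h1; rewrite [`|x|]gtr0_norm; last lra.
  rewrite gtr0_norm; lra.
Qed.

Lemma clamp_le (M x : R) : 0 <= M -> `|clamp M x| <= `|x|.
Proof.
move=> M0; rewrite clampE//; case: (boolP (x <= M)) => h1; first case: (boolP (- M <= x)) => h2 //.
- rewrite -ltNge in h2; rewrite [`|x|]ltr0_norm; last lra.
  by rewrite normrN ger0_norm//; lra.
- by rewrite -ltNge in h1; rewrite !ger0_norm//; lra.
Qed.

Lemma clamp_cont (M : R) : continuous (clamp M).
Proof.
have h : continuous (fun x : R => Num.min x M).
  by apply: min_fun_continuous => x; [exact: cvg_id|exact: cvg_cst].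
have k : continuous (fun _ : R => - M) by move=> x; exact: cvg_cst.
exact: max_fun_continuous k h.
Qed.

(** Differentiability written without a quotient, so that [t = x] causes no exception. *)
Definition rder (f : R -> R) x d : Prop := forall e : R, 0 < e -> exists2 r : R, 0 < r &
  forall t, `|t - x| < r -> `|f t - f x - d * (t - x)| <= e * `|t - x|.

Section Main.
Variables (c b : R) (f : R -> R).
Hypotheses (cb : c < b) (acf : racf c b f).

Let dl N k := f (node c b N k.+1) - f (node c b N k).

Lemma ac_cells (e d : R) N (A : {set 'I_N.+1}) :
  (forall (N : nat) (u v : 'I_N -> R),
      (forall i, c <= u i /\ u i < v i /\ v i <= b) ->
      (forall i j, i != j -> v i <= u j \/ v j <= u i) ->
      \sum_i (v i - u i) < d ->
      \sum_i `|f (v i) - f (u i)| < e) ->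
  #|A|%:R * mesh c b N < d -> \sum_(k in A) `|dl N k| < e.
Proof.
move=> H Ad.
pose u (i : 'I_#|A|) := node c b N (enum_val i).
pose v (i : 'I_#|A|) := node c b N (enum_val i).+1.
have -> : \sum_(k in A) `|dl N k| = \sum_i `|f (v i) - f (u i)|.
  by rewrite (big_enum_val (fun k : 'I_N.+1 => `|dl N k|)).
apply: H.
- move=> i; split; first by rewrite -[leLHS](node0 c b N); exact: (node_le cb).
  split; first by rewrite /v /u nodeS ltrDl mesh_gt0.
  by rewrite -[leRHS](node_last c b N); apply: (node_le cb).
- move=> i j ij; have {ij} : (enum_val i : nat) != enum_val j.
    by apply: contra_neq ij => /val_inj /enum_val_inj.
  by rewrite neq_ltn => /orP[h|h]; [left|right]; exact: (node_le cb).
- rewrite (eq_bigr (fun=> mesh c b N)); last by move=> i _; rewrite /v /u nodeS addrAC subrr add0r.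
  by rewrite sumr_const card_ord -mulr_natl.
Qed.

(* Uniform integrability of the difference quotients dl N k / mesh N. *)
Lemma ac_unif_int (e : R) : 0 < e -> exists2 M0 : R, 0 <= M0 & exists N0, forall N M, (N0 <= N)%N -> M0 <= M ->
  \sum_(k < N.+1) (if M * mesh c b N < `|dl N k| then `|dl N k| else 0) < e.
Proof.
move=> e0; have [d d0 H] := acf e0.
(* Cells of total length at least d/2 on which the increments exceed [M] times the mesh contribute
   at least M d/2 >= e to the sum. The bound on [N] makes the mesh smaller than d/2, so that such a
   total length can be kept below [d]. *)
exists (2 * e / d); first by rewrite divr_ge0 ?mulr_ge0 ?ltW.
exists (Num.truncn (2 * (b - c) / d)).+1 => N M NN MM.
have h0 := mesh_gt0 cb N.
have hd : mesh c b N < d / 2.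
  rewrite /mesh ltr_pdivrMr//.
  have : 2 * (b - c) / d < N.+1%:R.
    apply: lt_le_trans (truncnS_gt _) _; rewrite ler_nat; exact: leqW.
  by rewrite ltr_pdivrMr//; lra.
pose A : {set 'I_N.+1} := finset (fun k : 'I_N.+1 => M * mesh c b N < `|dl N k|).
rewrite -big_mkcond/= (eq_bigl (fun k => k \in A)); last by move=> k; rewrite finset.inE.
apply: (ac_cells H); rewrite ltNge; apply/negP => Ad.
(* A part of A of total length in [d/2, d[ would contradict absolute continuity. *)
pose m := (Num.truncn (d / 2 / mesh c b N)).+1.
have q0 : 0 <= d / 2 / mesh c b N by apply: divr_ge0 (ltW h0); apply: divr_ge0 (ltW d0) _.
have /andP[q1 q2] := truncn_itv q0.
have md : m%:R * mesh c b N < d.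
  rewrite /m -natr1 mulrDl mul1r.
  have : (Num.truncn (d / 2 / mesh c b N))%:R * mesh c b N <= d / 2 by rewrite -ler_pdivlMr.
  lra.
have md2 : d / 2 < m%:R * mesh c b N by rewrite -ltr_pdivrMr.
have mA : (m <= #|A|)%N.
  by rewrite -(ler_nat R) -(ler_pM2r h0) (le_trans (ltW md)).
pose B : {set 'I_N.+1} := finset (fun k => k \in take m (enum A)).
have cB : #|B| = m.
  rewrite cardsE; have /card_uniqP -> : uniq (take m (enum A)) by rewrite take_uniq// enum_uniq.
  by rewrite size_take -cardE; case: ltngtP mA => // ->.
have sBA k : k \in B -> k \in A by rewrite finset.inE => /mem_take; rewrite mem_enum.
have Bd : #|B|%:R * mesh c b N < d by rewrite cB.
have := ac_cells H Bd; rewrite ltNge => /negP; apply.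
apply: le_trans (_ : \sum_(k in B) M * mesh c b N <= _); last first.
  by apply: ler_sum => k /sBA; rewrite inE => /ltW.
rewrite sumr_const cB -mulr_natl mulrCA.
have M0 : 0 <= M by apply: le_trans MM; rewrite divr_ge0 ?mulr_ge0 ?ltW.
apply: le_trans (_ : 2 * e / d * (d / 2) <= _); first by rewrite le_eqVlt; apply/orP; left; apply/eqP; field; rewrite gt_eqF.
by apply: ler_pM => //; rewrite ?divr_ge0 ?mulr_ge0 ?ltW.
Qed.

Let dq N k := dl N k / mesh c b N.

(** Straddling: the endpoints of the cell containing [x] lie on its two sides, so the errors of the
    linear approximation at both endpoints add up to at most [e] times the length of the cell. *)
Lemma step_cvg x d : c < x < b -> rder f x d ->
  step c b N (dq N) x @[N --> \oo] --> d.
Proof.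
move=> cxb fd; apply/cvgrPdist_le => e e0.
have [r r0 hr] := fd _ e0.
exists (Num.truncn ((b - c) / r)).+1 => // N /= NN.
have h0 := mesh_gt0 cb N.
have hr' : mesh c b N < r.
  rewrite /mesh ltr_pdivrMr//.
  have : (b - c) / r < N.+1%:R.
    apply: lt_le_trans (truncnS_gt _) _; rewrite ler_nat; exact: leqW.
  by rewrite ltr_pdivrMr// mulrC.
have [k kN kx] := cell_ex cb N cxb.
rewrite (step_cell cb _ kN kx) /dq /dl.
move: kx => /andP[]; rewrite nodeS; set u := node c b N k; set h := mesh c b N in h0 hr' *.
move=> ux xu.
have h1 := hr u; have h2 := hr (u + h).
rewrite [`|u - x|]ler0_norm in h1; last lra.
rewrite [`|u + h - x|]gtr0_norm in h2; last lra.
have {}h1 := h1 ltac:(lra); have {}h2 := h2 ltac:(lra).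
have -> : d - (f (u + h) - f u) / h = (d * h - (f (u + h) - f u)) / h.
  by field; rewrite gt_eqF.
rewrite normrM normfV (gtr0_norm h0) ler_pdivrMr//.
move: h1 h2; rewrite !ler_norml => /andP[h1 h2] /andP[h3 h4]; apply/andP; split; nra.
Qed.

Lemma step_out N a x : ~~ (c <= x < b) -> step c b N a x = 0.
Proof.
move=> xn; rewrite /step big1// => k _; case: ifPn => // /andP[h1 h2].
case/negP: xn; rewrite (le_trans _ h1)/=; last by rewrite -[leLHS](node0 c b N); exact: (node_le cb).
by apply: lt_le_trans h2 _; rewrite -[leRHS](node_last c b N); apply: (node_le cb).
Qed.

Lemma step_comp N a (F : R -> R) x : F 0 = 0 -> step c b N (F \o a) x = F (step c b N a x).
Proof.
by move=> F0; case: (step_cases cb N x) => [h|[k _ h]]; rewrite !h.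
Qed.

Lemma telescope_dl N : \sum_(k < N.+1) dq N k * mesh c b N = f b - f c.
Proof.
rewrite (eq_bigr (fun k : 'I_N.+1 => f (node c b N k.+1) - f (node c b N k))); last first.
  by move=> k _; rewrite /dq divfK ?gt_eqF ?mesh_gt0.
rewrite -(big_mkord xpredT (fun k => f (node c b N k.+1) - f (node c b N k))).
by rewrite telescope_sumr// node0 node_last.
Qed.

(** At a fixed level [M] the truncated difference quotients are bounded and converge a.e. to the
    truncated derivative, so dominated convergence applies. Without truncation their integral is f b
    - f c; what truncation removes is at most [e], uniformly in [N], by [ac_unif_int]. *)
Lemma ac_clamp (W : R -> R) (e : R) :
  measurable_fun setT (W : measurableTypeR R -> R) ->
  (forall x, ~~ (c < x < b) -> W x = 0) ->
  {ae mu, forall x, c < x < b -> rder f x (W x)} -> 0 < e ->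
  exists2 M0 : R, 0 <= M0 & forall M, M0 <= M -> `|f b - f c - Rintegral mu setT (clamp M \o W)| <= e.
Proof.
move=> mW W0 Wd e0; have [M0 M00 [N0 H]] := ac_unif_int e0.
exists M0 => // M MM; have Mge0 := le_trans M00 MM.
have c0 : clamp M 0 = 0 by rewrite clamp_id// normr0.
pose S N := step c b N (dq N).
have mS N : measurable_fun setT (S N : measurableTypeR R -> R) by exact: measurable_step.
have mc : measurable_fun setT (clamp M) by apply: continuous_measurable_fun; exact: clamp_cont.
have cv : {ae mu, forall x, S N x @[N --> \oo] --> W x}.
  apply: filterS2 Wd (ae_neq c) => x hx xc.
  have [cxb|ncxb] := boolP (c < x < b); first by apply: step_cvg => //; exact: hx.
  rewrite W0//; apply: cvg_near_cst; apply: nearW => N; rewrite /S step_out//.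
  by apply: contra ncxb; rewrite le_eqVlt eq_sym (negbTE xc).
have iD : mu.-integrable setT (EFin \o (fun x => M * \1_(`[c, b]%classic) x)).
  have -> : (EFin \o (fun x => M * \1_(`[c, b]%classic) x)) =
    (fun x => M%:E * (\1_(`[c, b]%classic) x)%:E)%E by apply/funext => x /=; rewrite EFinM.
  by apply: integrableZl => //; exact: integrable_indic_itv.
have cA : {ae mu, forall x, setT x -> (EFin \o (clamp M \o S N)) x @[N --> \oo] --> (EFin \o (clamp M \o W)) x}.
  apply: filterS cv => x hx _ /=; apply/fine_cvgP; split; first exact: nearW.
  change (clamp M (S N x) @[N --> \oo] --> clamp M (W x)).
  by apply: continuous_cvg => //; exact: clamp_cont.
have dA : {ae mu, forall x, forall N, setT x ->
    (`|(EFin \o (clamp M \o S N)) x| <= (EFin \o (fun x => M * \1_(`[c, b]%classic) x)%R) x)%E}.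
  apply: filterS (ae_neq c) => x _ N _ /=.
  rewrite lee_fin indicE; have [h|h] := boolP (x \in `[c, b]%classic).
    by rewrite mulr1 clamp_norm.
  rewrite mulr0 /S step_out ?c0 ?normr0//.
  by apply: contra h => /andP[h1 h2]; rewrite inE/= in_itv/= h1 ltW.
have [iW _ DC] := @dominated_convergence _ (measurableTypeR R) R mu setT measurableT
  (fun N => EFin \o (clamp M \o S N)) (EFin \o (clamp M \o W)) _
  (fun N => iffRL (measurable_EFinP _ _) (measurableT_comp mc (mS N)))
  (iffRL (measurable_EFinP _ _) (measurableT_comp mc mW)) cA iD dA.
have iS N : Rintegral mu setT (clamp M \o S N) = \sum_(k < N.+1) clamp M (dq N k) * mesh c b N.
  rewrite -(step_int cb N (clamp M \o dq N)); apply: eq_Rintegral => x _.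
  exact: (esym (step_comp N (dq N) x c0)).
have {}DC : Rintegral mu setT (clamp M \o S N) @[N --> \oo] --> Rintegral mu setT (clamp M \o W).
  by apply: fine_cvg; rewrite fineK//; exact: (integrable_fin_num measurableT iW).
have cvd : `|f b - f c - Rintegral mu setT (clamp M \o S N)| @[N --> \oo] -->
    `|f b - f c - Rintegral mu setT (clamp M \o W)|.
  by apply: cvg_norm; apply: cvgB => //; exact: cvg_cst.
rewrite -(cvg_lim _ cvd)//; apply: limr_le; first by apply/cvg_ex; eexists; exact: cvd.
exists N0 => // N /= NN; rewrite iS -(telescope_dl N) -sumrB.
apply: le_trans (ler_norm_sum _ _ _) _; apply: le_trans (ltW (H N M NN MM)).
have h0 := mesh_gt0 cb N.
apply: ler_sum => k _; rewrite -mulrBl normrM (gtr0_norm h0).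
apply: le_trans (ler_wpM2r (ltW h0) (clamp_diff _ Mge0)) _.
have e1 : `|dq N k| * mesh c b N = `|dl N k|.
  by rewrite -{1}(gtr0_norm h0) -normrM /dq divfK ?gt_eqF.
have -> : (M < `|dq N k|) = (M * mesh c b N < `|dl N k|) by rewrite -e1 ltr_pM2r.
by case: ifP => _; rewrite ?mul0r// e1.
Qed.

(** The truncation level tends to infinity in [ac_clamp], under the domination by |W|. *)
Lemma ac_eq_int (W : R -> R) :
  mu.-integrable setT (EFin \o W) -> (forall x, ~~ (c < x < b) -> W x = 0) ->
  {ae mu, forall x, c < x < b -> rder f x (W x)} -> f b - f c = Rintegral mu setT W.
Proof.
move=> iW W0 Wd.
have mW : measurable_fun setT (W : measurableTypeR R -> R).
  by apply/measurable_EFinP; exact: measurable_int iW.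
have mc (M : R) : measurable_fun setT (clamp M) by apply: continuous_measurable_fun; exact: clamp_cont.
have cA : {ae mu, forall x, setT x -> (EFin \o (clamp N%:R \o W)) x @[N --> \oo] --> (EFin \o W) x}.
  apply: filterS (ae_neq c) => x _ _ /=; apply: cvg_near_cst.
  exists (Num.truncn `|W x|).+1 => // N /= NN; rewrite clamp_id//.
  by apply: le_trans (ltW (truncnS_gt _)) _; rewrite ler_nat.
have dA : {ae mu, forall x, forall N, setT x ->
    (`|(EFin \o (clamp N%:R \o W)) x| <= (abse \o (EFin \o W)) x)%E}.
  by apply: filterS (ae_neq c) => x _ N _ /=; rewrite lee_fin clamp_le.
have [_ _ DC] := @dominated_convergence _ (measurableTypeR R) R mu setT measurableT
  (fun N => EFin \o (clamp N%:R \o W)) (EFin \o W) _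
  (fun N => iffRL (measurable_EFinP _ _) (measurableT_comp (mc _) mW))
  (measurable_int _ iW) cA (integrable_abse iW) dA.
have {}DC : Rintegral mu setT (clamp N%:R \o W) @[N --> \oo] --> Rintegral mu setT W.
  by apply: fine_cvg; rewrite fineK//; exact: (integrable_fin_num measurableT iW).
apply/eqP; rewrite -subr_eq0 -normr_le0; apply/ler_addgt0Pr => e e0; rewrite add0r.
have cvd : `|f b - f c - Rintegral mu setT (clamp N%:R \o W)| @[N --> \oo] -->
    `|f b - f c - Rintegral mu setT W|.
  by apply: cvg_norm; apply: cvgB => //; exact: cvg_cst.
have [M0 M00 H] := ac_clamp mW W0 Wd e0.
rewrite -(cvg_lim _ cvd)//; apply: limr_le; first by apply/cvg_ex; eexists; exact: cvd.
exists (Num.truncn M0).+1 => // N /= NN; apply: H.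
by apply: le_trans (ltW (truncnS_gt _)) _; rewrite ler_nat.
Qed.

(** [w] comes without measurability. The upper limit of the step functions of difference quotients
    is a measurable version of it, and Fatou's lemma with a uniform L1 bound on the quotients gives
    integrability. *)
Lemma ac_deriv_intg (w : R -> R) :
  {ae mu, forall x, c < x < b -> rder f x (w x)} ->
  exists W : R -> R, [/\ mu.-integrable setT (EFin \o W),
    forall x, ~~ (c < x < b) -> W x = 0 &
    {ae mu, forall x, c < x < b -> W x = w x}].
Proof.
move=> wd; pose S N := step c b N (dq N).
have mS N : measurable_fun setT (S N : measurableTypeR R -> R) by exact: measurable_step.
pose W0 x := fine (limn_esup (fun N => (S N x)%:E)).
have mW0 : measurable_fun setT (W0 : measurableTypeR R -> R).
  apply: measurableT_comp => //; apply: (@measurable_fun_limn_esup _ (measurableTypeR R) R setT (fun N => EFin \o S N)).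
  by move=> N; apply/measurable_EFinP.
pose W x := W0 x * \1_(`]c, b[%classic) x.
have Wout x : ~~ (c < x < b) -> W x = 0.
  by move=> h; rewrite /W indicE memNset ?mulr0//= in_itv/=; apply/negP.
have Win x : c < x < b -> W x = W0 x.
  by move=> h; rewrite /W indicE mem_set ?mulr1//= in_itv.
have mW : measurable_fun setT (W : measurableTypeR R -> R).
  by apply: measurable_funM => //; apply: measurable_indic.
have Sw x : c < x < b -> rder f x (w x) -> (S N x)%:E @[N --> \oo] --> (w x)%:E.
  move=> cxb hx; apply/fine_cvgP; split; first exact: nearW.
  exact: step_cvg.
have W0w : {ae mu, forall x, c < x < b -> W x = w x}.
  apply: filterS wd => x hx cxb; rewrite Win// /W0.
  by rewrite (cvg_limn_einf_sup (Sw x cxb (hx cxb))).2.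
exists W; split => //.
have [M0 M00 [N0 H]] := ac_unif_int (ltr01 : 0 < 1 :> R).
(* An increment is either at most [M0] times the mesh, which sums to M0 (b - c), or belongs to the
   large ones, whose sum is below 1. *)
pose C := M0 * (b - c) + 1.
have bS N : (N0 <= N)%N -> (\int[mu]_x `|(S N x)%:E| <= C%:E)%E.
  move=> NN; have h0 := mesh_gt0 cb N.
  have -> : (\int[mu]_x `|(S N x)%:E| = \int[mu]_x (step c b N (fun k => `|dq N k|)%R x)%:E)%E.
    apply: eq_integral => x _ /=; congr EFin.
    by rewrite -(step_comp _ (dq N) (F := fun z => `|z|)) ?normr0.
  have iS := step_integrable c b N (fun k => `|dq N k|).
  rewrite -(fineK (integrable_fin_num measurableT iS)) lee_fin [leLHS](step_int cb).
  apply: le_trans (_ : \sum_(k < N.+1) (M0 * mesh c b N +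
      (if M0 * mesh c b N < `|dl N k| then `|dl N k| else 0)) <= _).
    apply: ler_sum => k _.
    have -> : `|dq N k| * mesh c b N = `|dl N k|.
      by rewrite -{1}(gtr0_norm h0) -normrM /dq divfK ?gt_eqF.
    case: ifPn; first by rewrite lerDr mulr_ge0// ltW.
    by rewrite -leNgt addr0.
  rewrite big_split/= sumr_const card_ord /C lerD//; last exact: ltW (H N M0 NN (lexx _)).
  by rewrite -mulrnAr ler_wpM2l// /mesh -mulr_natr divfK.
apply/integrableP; split; first by apply/measurable_EFinP.
apply: (@le_lt_trans _ _ C%:E); last exact: ltry.
have mA N : measurable_fun setT (fun x : measurableTypeR R => `|(S N x)%:E|%E).
  by apply: measurableT_comp => //; apply/measurable_EFinP.
(* Fatou's lemma is applied to the sequence shifted by [N0], since the bound [bS] holds from [N0]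
   on. *)
apply: (@le_trans _ _ (\int[mu]_x limn_einf (fun N => `|(S (N + N0)%N x)%:E|))%E).
  apply: ae_ge0_le_integral => //.
  - by apply: measurableT_comp => //; apply/measurable_EFinP.
  - move=> x _; rewrite limn_einf_lim; apply: lime_ge; first exact: is_cvg_einfs.
    by apply: nearW => N; apply: le_ereal_inf_tmp => _ [k _ <-].
  - have -> : (fun x : measurableTypeR R => limn_einf (fun N => `|(S (N + N0)%N x)%:E|%E)) =
        (fun x => - limn_esup (fun N => - `|(S (N + N0)%N x)%:E|))%E.
      by apply/funext => x; rewrite -limn_einfN; congr limn_einf; apply/funext => N; exact: esym (oppeK _).
    apply: measurableT_comp => //.
    apply: (@measurable_fun_limn_esup _ (measurableTypeR R) R setT (fun N x => - `|(S (N + N0)%N x)%:E|)%E) => N.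
    by apply: measurableT_comp => //; exact: mA.
  - apply: filterS wd => x hx _.
    have [cxb|ncxb] := boolP (c < x < b); last first.
      rewrite /= Wout// normr0 limn_einf_lim; apply: lime_ge; first exact: is_cvg_einfs.
      by apply: nearW => N; apply: le_ereal_inf_tmp => _ [k _ <-]; rewrite lee_fin normr_ge0.
    have /cvg_abse h := Sw x cxb (hx cxb).
    have {}h : `|(S (N + N0)%N x)%:E|%E @[N --> \oo] --> `|(w x)%:E|%E by rewrite (cvg_shiftn N0 (fun N => `|(S N x)%:E|%E)).
    rewrite (cvg_limn_einf_sup h).1/= Win// /W0.
    by rewrite (cvg_limn_einf_sup (Sw x cxb (hx cxb))).2.
apply: le_trans (fatou _ _ _ _) _ => //.
rewrite limn_einf_lim; apply: lime_le; first exact: is_cvg_einfs.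
apply: nearW => N; apply: le_trans (bS (N + N0)%N (leq_addl _ _)).
apply: ereal_inf_lbound; exists N => //=.
Qed.

End Main.

Lemma Rintegral_cst0 : Rintegral mu setT (fun=> 0 : R) = 0.
Proof. by rewrite /Rintegral integral0. Qed.

(** A single density serves every x: the integral formula is applied on [c,x] to its restriction to
    t < x, which has the same a.e. derivative property there. *)
Lemma ac_int (c b : R) (f w : R -> R) : c < b -> racf c b f ->
  {ae mu, forall x, c < x < b -> rder f x (w x)} ->
  exists W : R -> R, [/\ mu.-integrable setT (EFin \o W),
    forall x, ~~ (c < x < b) -> W x = 0,
    {ae mu, forall x, c < x < b -> W x = w x} &
    forall x, c <= x <= b -> f x - f c = Rintegral mu setT (fun t => if t < x then W t else 0)].
Proof.
move=> cb acf wd; have [W [iW W0 Ww]] := ac_deriv_intg cb acf wd.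
exists W; split => // x /andP[]; rewrite le_eqVlt => /orP[/eqP <- _|cx xb].
  rewrite subrr -[LHS]Rintegral_cst0; apply: eq_Rintegral => t _; case: ifPn => // tc.
  by rewrite W0// negb_and -leNgt (ltW tc).
apply: (@ac_eq_int c x f) => //.
- move=> e e0; have [d d0 H] := acf e e0; exists d => // N u v h1 h2 h3; apply: H => // i.
  by have [? [? ?]] := h1 i; split=> //; split => //; apply: le_trans xb.
- apply: (@le_integrable _ (measurableTypeR R) R mu setT measurableT _ (EFin \o W)) => //.
    apply/measurable_EFinP; apply: measurable_fun_ifT => //.
      exact: measurable_fun_ltr.
    by apply/measurable_EFinP; exact: measurable_int iW.
  by move=> t _ /=; case: ifP => // _; rewrite normr0 lee_fin.
- by move=> t tn; case: ifPn => // tx; apply: W0; apply: contra tn => /andP[-> _]/=; rewrite tx.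
- apply: filterS2 wd Ww => t h1 h2 /andP[ct tx]; rewrite tx.
  have ctb : c < t < b by rewrite ct (lt_le_trans tx xb).
  by rewrite h2//; exact: h1.
Qed.

End AbsoluteContinuity.

(** * Derivatives *)

Section ElementaryCalculus.
Variable R : realType.
Local Notation mu := (@lebesgue_measure R).
Implicit Types (A B : set R) (f g : R -> R[i]) (x c b : R) (d z : R[i]).

Definition ccont A f x : Prop := forall e : R, 0 < e -> exists2 r : R, 0 < r &
  forall t, A t -> `|t - x| < r -> n1 (f t - f x) <= e.

(** Equivalent to [cderiv] but free of division: the case [t = x] is trivial, and sums, restrictions
    and passages to nearby points become estimates on [n1]. *)
Definition cder A f x d : Prop := forall e : R, 0 < e -> exists2 r : R, 0 < r &
  forall t, A t -> `|t - x| < r -> n1 (f t - f x - d * (t - x)%:C) <= e * `|t - x|.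

Definition climr c f z : Prop := forall e : R, 0 < e -> exists2 r : R, 0 < r &
  forall t, c < t -> t < c + r -> n1 (f t - z) <= e.

Lemma n1_Mr z (r : R) : n1 (z * r%:C) = n1 z * `|r|.
Proof. by rewrite /n1 !ReImE/= !mulr0 subr0 add0r !normrM mulrDl. Qed.

Lemma near_dnbhsP A x (P : R -> Prop) : (\forall t \near within A x^', P t) <->
  exists2 r : R, 0 < r & forall t, A t -> t != x -> `|t - x| < r -> P t.
Proof.
rewrite near_withinE /dnbhs near_withinE; split.
  move=> /nbhs_normP[r r0 h]; exists r => // t At tx tr; apply: h => //=.
  by rewrite distrC.
move=> [r r0 h]; apply/nbhs_normP; exists r => // t /= tr tx At; apply: h => //.
by rewrite distrC.
Qed.

Lemma near_wnbhsP A x (P : R -> Prop) : (\forall t \near within A (nbhs x), P t) <->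
  exists2 r : R, 0 < r & forall t, A t -> `|t - x| < r -> P t.
Proof.
rewrite near_withinE; split.
  move=> /nbhs_normP[r r0 h]; exists r => // t At tr; apply: h => //=.
  by rewrite distrC.
move=> [r r0 h]; apply/nbhs_normP; exists r => // t /= tr At; apply: h => //.
by rewrite distrC.
Qed.

Lemma near_rightP c (P : R -> Prop) : (\forall t \near c^'+, P t) <->
  exists2 r : R, 0 < r & forall t, c < t -> t < c + r -> P t.
Proof.
rewrite near_withinE; split.
  move=> /nbhs_normP[r r0 h]; exists r => // t ct tr; apply: h => //=.
  rewrite distrC gtr0_norm; lra.
move=> [r r0 h]; apply/nbhs_normP; exists r => // t /= tr ct; apply: h => //.
move: tr; rewrite distrC gtr0_norm; lra.
Qed.

Lemma ccvgP (F : set_system R) {FF : Filter F} f z :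
  ccvg F f z <-> forall e : R, 0 < e -> \forall t \near F, n1 (f t - z) <= e.
Proof.
split.
- move=> [/cvgrPdist_le h1 /cvgrPdist_le h2] e e0.
  have e2 : 0 < e / 2 by rewrite divr_gt0.
  apply: filterS2 (h1 _ e2) (h2 _ e2) => t; rewrite ![`|_ - reals _ _|]distrC ![`|_ - imags _ _|]distrC => k1 k2.
  by rewrite /n1 cReB cImB (splitr e) lerD.
- move=> h; split; apply/cvgrPdist_le => e e0; apply: filterS (h e e0) => t; rewrite distrC.
  + by apply: le_trans; rewrite /reals -cReB ler_Re_n1.
  + by apply: le_trans; rewrite /imags -cImB ler_Im_n1.
Qed.

Lemma cderivP A f x d : cderiv A f x d <-> cder A f x d.
Proof.
rewrite /cderiv ccvgP; split=> h e e0.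
- have /near_dnbhsP[r r0 hr] := h e e0; exists r => // t At tr.
  have [->|tx] := eqVneq t x; first by rewrite !subrr normr0 mulr0 mulr0 subrr n1_0.
  have t0 : (t - x)%:C != 0.
    by apply: contra tx => /eqP/(congr1 (@complex.Re R))/= /eqP; rewrite subr_eq0.
  have -> : f t - f x - d * (t - x)%:C = ((f t - f x) / (t - x)%:C - d) * (t - x)%:C.
    by rewrite mulrBl divfK.
  by rewrite n1_Mr ler_wpM2r// hr.
- have [r r0 hr] := h e e0; apply/near_dnbhsP; exists r => // t At tx tr.
  have t0 : (t - x)%:C != 0.
    by apply: contra tx => /eqP/(congr1 (@complex.Re R))/= /eqP; rewrite subr_eq0.
  have n0 : 0 < `|t - x| by rewrite normr_gt0 subr_eq0.
  have := hr t At tr.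
  have -> : f t - f x - d * (t - x)%:C = ((f t - f x) / (t - x)%:C - d) * (t - x)%:C.
    by rewrite mulrBl divfK.
  by rewrite n1_Mr ler_pM2r.
Qed.

Lemma ccontP A f : ccontinuous A f <-> forall x, A x -> ccont A f x.
Proof.
rewrite /ccontinuous; split.
- move=> [/subspace_continuousP h1 /subspace_continuousP h2] x Ax e e0.
  have /ccvgP h : ccvg (within A (nbhs x)) f (f x) by split; [exact: h1|exact: h2].
  exact/near_wnbhsP/h.
- move=> h.
  have k x : A x -> ccvg (within A (nbhs x)) f (f x).
    by move=> Ax; apply/ccvgP => e e0; apply/near_wnbhsP; exact: h.
  by split; apply/subspace_continuousP => x /k[].
Qed.

Lemma ccvg_rightP c f z : ccvg c^'+ f z <-> climr c f z.
Proof.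
rewrite ccvgP; split=> h e e0; first by apply/near_rightP; exact: h.
by apply/near_rightP; exact: h.
Qed.

Lemma cder_sub A B f x d : B `<=` A -> cder A f x d -> cder B f x d.
Proof. by move=> BA h e e0; have [r r0 hr] := h e e0; exists r => // t /BA; exact: hr. Qed.

Lemma ccont_sub A B f x : B `<=` A -> ccont A f x -> ccont B f x.
Proof. by move=> BA h e e0; have [r r0 hr] := h e e0; exists r => // t /BA; exact: hr. Qed.

Lemma cder_ccont A f x d : cder A f x d -> ccont A f x.
Proof.
move=> h e e0; have [r r0 hr] := h 1 ltr01.
have k0 : 0 < 1 + n1 d by rewrite ltr_wpDr ?n1_ge0.
exists (Num.min r (e / (1 + n1 d))); first by rewrite lt_min r0 divr_gt0.
move=> t At; rewrite lt_min => /andP[t1 t2].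
have -> : f t - f x = (f t - f x - d * (t - x)%:C) + d * (t - x)%:C by rewrite subrK.
apply: le_trans (n1D _ _) _; rewrite n1_Mr.
apply: le_trans (lerD (hr t At t1) (lexx _)) _; rewrite -mulrDl mulrC.
by rewrite -ler_pdivlMr// ltW.
Qed.

Lemma ccontD A f g x : ccont A f x -> ccont A g x -> ccont A (fun t => f t + g t) x.
Proof.
move=> hf hg e e0; have e2 : 0 < e / 2 by rewrite divr_gt0.
have [r r0 hr] := hf _ e2; have [s s0 hs] := hg _ e2.
exists (Num.min r s); first by rewrite lt_min r0.
move=> t At; rewrite lt_min => /andP[t1 t2]; rewrite opprD addrACA (splitr e).
exact: le_trans (n1D _ _) (lerD (hr t At t1) (hs t At t2)).
Qed.

Lemma ccont_cst A z x : ccont A (fun=> z) x.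
Proof. by move=> e e0; exists 1 => // t _ _; rewrite subrr n1_0 ltW. Qed.

Lemma cderD A f g x d d' : cder A f x d -> cder A g x d' -> cder A (fun t => f t + g t) x (d + d').
Proof.
move=> hf hg e e0; have e2 : 0 < e / 2 by rewrite divr_gt0.
have [r r0 hr] := hf _ e2; have [s s0 hs] := hg _ e2.
exists (Num.min r s); first by rewrite lt_min r0.
move=> t At; rewrite lt_min => /andP[t1 t2]; rewrite [in leRHS](splitr e) [in leRHS]mulrDl.
apply: le_trans (lerD (hr t At t1) (hs t At t2)); apply: le_trans (n1D _ _).
by rewrite le_eqVlt; apply/orP; left; apply/eqP; congr n1; ring.
Qed.

Lemma cder_cst A z x : cder A (fun=> z) x 0.
Proof.
by move=> e e0; exists 1 => // t _ _; rewrite subrr mul0r subrr n1_0 mulr_ge0// ltW.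
Qed.

Lemma cderZ A f x d z : cder A f x d -> cder A (fun t => z * f t) x (z * d).
Proof.
move=> hf e e0; have k0 : 0 < 1 + n1 z by rewrite ltr_wpDr ?n1_ge0.
have [r r0 hr] := hf (e / (1 + n1 z)) (divr_gt0 e0 k0); exists r => // t At tr.
rewrite -mulrA -!mulrBr (le_trans (n1M _ _))//.
apply: le_trans (ler_wpM2l (n1_ge0 z) (hr t At tr)) _.
rewrite mulrA ler_wpM2r// mulrA ler_pdivrMr// mulrC ler_wpM2l ?(ltW e0)//; lra.
Qed.

Lemma cder_sum A (I : Type) (s : seq I) (P : pred I) (F : I -> R -> R[i]) (d : I -> R[i]) x :
  (forall i, P i -> cder A (F i) x (d i)) ->
  cder A (fun t => \sum_(i <- s | P i) F i t) x (\sum_(i <- s | P i) d i).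
Proof.
move=> h; elim: s => [|i s IH].
  rewrite big_nil; have -> : (fun t => \sum_(i <- [::] | P i) F i t) = fun=> 0.
    by apply/funext => t; rewrite big_nil.
  exact: cder_cst.
have -> : (fun t => \sum_(i <- i :: s | P i) F i t) =
    (fun t => (if P i then F i t else 0) + \sum_(i <- s | P i) F i t).
  by apply/funext => t; rewrite big_cons; case: ifP; rewrite ?add0r.
rewrite big_cons; case: ifPn => Pi; first by apply: cderD => //; exact: h.
rewrite -[d in cder _ _ _ d]add0r; apply: cderD => //; exact: cder_cst.
Qed.

Lemma cder_ext A f g x d : A x -> (forall t, A t -> f t = g t) -> cder A f x d -> cder A g x d.
Proof.
move=> Ax fg h e e0; have [r r0 hr] := h e e0; exists r => // t At tr.
by rewrite -!fg//; exact: hr.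
Qed.

Section Interval.
Variables (c b : R).
Hypothesis cb : c < b.
Local Notation I := (`]c, b[%classic : set R).

Lemma in_oo x : I x <-> c < x < b. Proof. by rewrite /= in_itv. Qed.

(** Functions equal a.e. agree at points arbitrarily close to any given one. All transfers of
    values, limits and derivatives between representatives below go through such points. *)
Lemma ae_near f g x (r : R) : aeeq c b f g -> c < x < b -> 0 < r ->
  exists t, [/\ c < t < b, x < t, t - x < r & f t = g t].
Proof.
move=> fg /andP[cx xb] r0.
have h : x < Num.min b (x + r) by rewrite lt_min xb ltrDl.
have [t] := ae_exists h fg; rewrite lt_min => /andP[xt /andP[tb tr]] ft.
exists t; split=> //.
- by rewrite (lt_trans cx xt).
- by rewrite ltrBlDl.
- by apply: ft; rewrite in_itv/= (lt_trans cx xt).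
Qed.

Lemma ccont_ae_eq f g x : aeeq c b f g -> c < x < b -> ccont I f x -> ccont I g x -> f x = g x.
Proof.
move=> fg xI hf hg; apply/eqP; rewrite -subr_eq0; apply/eqP/n1_eq0/le_anti.
rewrite n1_ge0 andbT; apply/ler_addgt0Pr => e e0; rewrite add0r.
have e2 : 0 < e / 2 by rewrite divr_gt0.
have [r r0 hr] := hf _ e2; have [s s0 hs] := hg _ e2.
have rs : 0 < Num.min r s by rewrite lt_min r0.
have [t [tI xt]] := ae_near fg xI rs; rewrite lt_min => /andP[t1 t2] ft.
have tx : `|t - x| = t - x by rewrite gtr0_norm// subr_gt0.
have -> : f x - g x = - (f t - f x) + (g t - g x) by rewrite ft; ring.
rewrite (le_trans (n1D _ _))// n1N (splitr e) lerD//.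
- by apply: hr; [exact/in_oo|rewrite tx].
- by apply: hs; [exact/in_oo|rewrite tx].
Qed.

Lemma cder_ae_uniq f g x d d' : aeeq c b f g -> c < x < b -> f x = g x ->
  cder I f x d -> cder I g x d' -> d = d'.
Proof.
move=> fg xI fgx hf hg; apply/eqP; rewrite -subr_eq0; apply/eqP/n1_eq0/le_anti.
rewrite n1_ge0 andbT; apply/ler_addgt0Pr => e e0; rewrite add0r.
have e2 : 0 < e / 2 by rewrite divr_gt0.
have [r r0 hr] := hf _ e2; have [s s0 hs] := hg _ e2.
have rs : 0 < Num.min r s by rewrite lt_min r0.
have [t [tI xt]] := ae_near fg xI rs; rewrite lt_min => /andP[t1 t2] ft.
have t0 : 0 < t - x by rewrite subr_gt0.
have tx : `|t - x| = t - x by rewrite gtr0_norm.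
have := hr t (iffRL (in_oo t) tI); have := hs t (iffRL (in_oo t) tI).
rewrite tx => /(_ t2) k2 /(_ t1) k1.
rewrite -(ler_pM2r t0) -{1}tx -n1_Mr.
have -> : (d - d') * (t - x)%:C = - (f t - f x - d * (t - x)%:C) + (g t - g x - d' * (t - x)%:C).
  by rewrite ft fgx; ring.
by rewrite (le_trans (n1D _ _))// n1N (splitr e) mulrDl lerD.
Qed.

(* f need not be differentiable where it differs from g; continuity of f recovers
   its increments from those of g. *)
Lemma cder_transfer f g x d : aeeq c b f g -> (forall t, I t -> ccont I f t) ->
  c < x < b -> f x = g x -> cder I g x d -> cder I f x d.
Proof.
move=> fg cf xI fgx hg e e0.
have [r r0 hr] := hg _ e0; exists r => // t tI tr.
apply/ler_addgt0Pr => k k0.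
have D0 : 0 < 1 + n1 d + e by rewrite -addrA ltr_wpDr// addr_ge0 ?n1_ge0// ltW.
have k2 : 0 < k / 2 by rewrite divr_gt0.
have [s s0 hs] := cf t tI _ k2.
have m0 : 0 < Num.min s (Num.min (r - `|t - x|) (k / 2 / (1 + n1 d + e))).
  by rewrite !lt_min s0 subr_gt0 tr divr_gt0.
have [u [uI tu]] := ae_near fg (iffLR (in_oo t) tI) m0.
rewrite !lt_min => /and3P[u1 u2 u3] fu.
have ut : `|u - t| = u - t by rewrite gtr0_norm// subr_gt0.
have ux : `|u - x| <= (u - t) + `|t - x|.
  by rewrite -ut -[u - x](_ : (u - t) + (t - x) = _) ?ler_normD//; ring.
have := hr u (iffRL (in_oo u) uI); have -> : `|u - x| < r by lra.
move=> /(_ isT) h1.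
have h2 := hs u (iffRL (in_oo u) uI); rewrite ut in h2; have {}h2 := h2 u1.
have -> : f t - f x - d * (t - x)%:C =
    - (f u - f t) + (g u - g x - d * (u - x)%:C) + d * (u - t)%:C.
  by rewrite fu fgx !rmorphB/=; ring.
apply: le_trans (n1D _ _) _; apply: le_trans (lerD (n1D _ _) (lexx _)) _.
rewrite n1N n1_Mr ut.
have : e * `|u - x| <= e * (u - t) + e * `|t - x| by rewrite -mulrDr ler_pM2l.
have : (u - t) * (1 + n1 d + e) < k / 2 by rewrite -ltr_pdivlMr.
have : 0 < u - t by rewrite subr_gt0.
nra.
Qed.

Lemma climr_ae_uniq f g z z' : aeeq c b f g -> climr c f z -> climr c g z' -> z = z'.
Proof.
move=> fg hf hg; apply/eqP; rewrite -subr_eq0; apply/eqP/n1_eq0/le_anti.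
rewrite n1_ge0 andbT; apply/ler_addgt0Pr => e e0; rewrite add0r.
have e2 : 0 < e / 2 by rewrite divr_gt0.
have [r r0 hr] := hf _ e2; have [s s0 hs] := hg _ e2.
have h : c < Num.min b (Num.min (c + r) (c + s)) by rewrite !lt_min cb !ltrDl r0.
have [t] := ae_exists h fg; rewrite !lt_min => /andP[ct /and3P[tb tr ts]] ft.
have {}ft : f t = g t by apply: ft; rewrite in_itv/= ct.
have -> : z - z' = - (f t - z) + (g t - z') by rewrite ft; ring.
by rewrite (le_trans (n1D _ _))// n1N (splitr e) lerD// ?hr ?hs.
Qed.

Lemma aeeq_trans f g h : aeeq c b f g -> aeeq c b g h -> aeeq c b f h.
Proof. by move=> fg gh; apply: filterS2 fg gh => x h1 h2 xI; rewrite h1// h2. Qed.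

Lemma aeeq_sym f g : aeeq c b f g -> aeeq c b g f.
Proof. by move=> fg; apply: filterS fg => x h1 xI; rewrite h1. Qed.

Lemma aeeq_all f g : (forall x, c < x < b -> f x = g x) -> aeeq c b f g.
Proof. by move=> fg; apply: filterS (ae_neq 0) => x _; rewrite in_itv/=; exact: fg. Qed.

(** Differentiability gives continuity, and continuous functions equal a.e. are equal everywhere;
    then their derivatives coincide too. Induction carries this up to order [m], starting from a
    mere a.e. equality. *)
Lemma chain_uniq m (F G : nat -> R -> R[i]) :
  (forall i, (i < m)%N -> forall x, I x -> cder I (F i) x (F i.+1 x)) ->
  (forall i, (i < m)%N -> forall x, I x -> cder I (G i) x (G i.+1 x)) ->
  aeeq c b (F 0%N) (G 0%N) -> forall i, (i <= m)%N -> aeeq c b (F i) (G i).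
Proof.
move=> hF hG FG0; elim => // i IH im.
have {}IH := IH (ltnW im).
have e x : c < x < b -> F i x = G i x.
  move=> xI; apply: (ccont_ae_eq IH) => //; apply: cder_ccont.
  - exact: (hF i im x (iffRL (in_oo x) xI)).
  - exact: (hG i im x (iffRL (in_oo x) xI)).
apply: aeeq_all => x xI; apply: (cder_ae_uniq IH xI (e x xI)).
- exact: (hF i im x (iffRL (in_oo x) xI)).
- exact: (hG i im x (iffRL (in_oo x) xI)).
Qed.

Lemma nth_derivE m u w : nth_deriv c b m u w <-> exists F : nat -> R -> R[i],
  [/\ aeeq c b (F 0%N) u, aeeq c b (F m) w,
      forall i, (i < m.-1)%N -> forall x, I x -> cder I (F i) x (F i.+1 x) &
      (0 < m)%N -> {ae mu, forall x, c < x < b -> cder I (F m.-1) x (F m x)}].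
Proof.
split=> -[F [h1 h2 h3 h4]]; exists F; split => //.
- move=> i im x xI; apply/cderivP; apply: h3; last exact: xI.
  by move: im; rewrite -ltnS; case: (m).
- case: m h2 h3 h4 => // m h2 h3 h4 _; apply: filterS (h4 m erefl) => x h xI.
  by apply/cderivP; apply: h; rewrite in_itv.
- move=> i im x xI; apply/cderivP; apply: h3; last exact: xI.
  by move: im; rewrite -ltnS; case: (m).
- by move=> i im; case: m im h2 h3 h4 => // m [->] _ _ /(_ isT) h; apply: filterS h => x h xI;
  apply/cderivP; apply: h; rewrite in_itv in xI.
Qed.

Lemma nth_deriv_uniq m u w w' : nth_deriv c b m u w -> nth_deriv c b m u w' -> aeeq c b w w'.
Proof.
move=> /nth_derivE[F [h1 h2 h3 h4]] /nth_derivE[G [k1 k2 k3 k4]].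
have FG0 : aeeq c b (F 0%N) (G 0%N) by exact: aeeq_trans h1 (aeeq_sym k1).
have FG := chain_uniq h3 k3 FG0.
apply: aeeq_trans (aeeq_sym h2) _; apply: aeeq_trans _ (k2).
case: m {h2 k2} h3 h4 k3 k4 FG => [|m] h3 h4 k3 k4 FG; first exact: FG.
move: h4 k4 FG => /(_ isT) h4 /(_ isT) k4 /(_ m (leqnn _)) FG.
apply: filterS3 h4 k4 (FG) => x h4 k4 FGx xI.
have xI' : c < x < b by move: xI; rewrite in_itv.
by apply: (cder_ae_uniq FG xI'); [exact: FGx|exact: h4|exact: k4].
Qed.

(** Links two chains for one class: [F], given with a continuous top member as in AC^n, and the
    hidden chain behind [nth_deriv], whose top member has derivative [w] a.e. The first then has the
    same a.e. derivative. *)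
Lemma nth_deriv_trans m u w (F : nat -> R -> R[i]) : (0 < m)%N -> nth_deriv c b m u w ->
  aeeq c b (F 0%N) u ->
  (forall i, (i < m.-1)%N -> forall x, I x -> cder I (F i) x (F i.+1 x)) ->
  (forall x, I x -> ccont I (F m.-1) x) ->
  {ae mu, forall x, c < x < b -> cder I (F m.-1) x (w x)}.
Proof.
move=> m0 /nth_derivE[G [h1 h2 h3 /(_ m0) h4]] F0 hF Fc.
have FG := chain_uniq hF h3 (aeeq_trans F0 (aeeq_sym h1)) (leqnn _).
apply: filterS3 h2 h4 (FG) => x h2 h4 FGx xI.
have xI' : x \in `]c, b[ by rewrite in_itv.
by rewrite -h2//; apply: (cder_transfer FG Fc xI (FGx xI')); exact: h4.
Qed.

End Interval.
End ElementaryCalculus.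

(** * Primitives *)

Section Primitives.
Variable R : realType.
Local Notation mu := (@lebesgue_measure R).
Local Notation X := (measurableTypeR R).
Implicit Types (f g phi : R -> R[i]) (x y c b : R) (d z : R[i]).

Definition res c b f : R -> R[i] := fun x => if (c < x) && (x < b) then f x else 0.

(** The lower limit is minus infinity; for [phi] vanishing on the left of c this is the primitive
    that vanishes at c. *)
Definition prim phi : R -> R[i] := fun x => cI mu (fun t => if t < x then phi t else 0).

Lemma L1P c b f : L1 c b f <-> cintg mu (res c b f).
Proof.
rewrite cintgP /L1; have e (p : R[i] -> R) (g : R -> R) : p 0 = 0 -> (forall x, g x = p (f x)) ->
    (EFin \o g) \_ (`]c, b[%classic) = EFin \o (fun x => p (res c b f x)).
  move=> p0 gp; apply/funext => x; rewrite /patch /res /= mem_setE in_itv/=.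
  by case: ifP => _ /=; rewrite ?p0 ?gp.
have eR := e (@complex.Re R) (reals f) erefl (fun=> erefl).
have eI := e (@complex.Im R) (imags f) erefl (fun=> erefl).
have mI : measurable (`]c, b[%classic : set X) by exact: measurable_itv.
have kR := integrable_mkcond (mu := mu) (EFin \o reals f) mI.
have kI := integrable_mkcond (mu := mu) (EFin \o imags f) mI.
by rewrite eR in kR; rewrite eI in kI; split=> -[/kR h1 /kI h2].
Qed.

Lemma res_in c b f x : c < x < b -> res c b f x = f x. Proof. by rewrite /res => ->. Qed.
Lemma res_out c b f x : ~~ (c < x < b) -> res c b f x = 0. Proof. by rewrite /res => /negbTE ->. Qed.

Lemma aeeqP c b f g : aeeq c b f g <-> {ae mu, forall x, res c b f x = res c b g x}.
Proof.
split; apply: filterS => x h.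
  by rewrite /res; case: ifP => // xI; apply: h; rewrite in_itv.
by rewrite in_itv/= => xI; move: h; rewrite !res_in.
Qed.

Lemma measurable_ltb x : measurable_fun setT (fun t : X => ((t : R) < x)).
Proof. exact: measurable_fun_ltr. Qed.
Lemma measurable_geb x : measurable_fun setT (fun t : X => (x <= (t : R))).
Proof. exact: measurable_fun_ler. Qed.
Lemma measurable_gtb x : measurable_fun setT (fun t : X => (x < (t : R))).
Proof. exact: measurable_fun_ltr. Qed.

Lemma cintg_if (B : X -> bool) (f : X -> R[i]) : measurable_fun setT B -> cintg mu f ->
  cintg mu (fun t => if B t then f t else 0).
Proof.
move=> mB fi; apply: (cintg_le (h := fun t => n1 (f t))).
- have h := @cmeas_if _ X R B f (fun=> 0) mB fi.1 (cmeas_cst _ _).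
  exact: h.
- by move=> t; case: (B t); rewrite ?n1_0 ?n1_ge0.
- exact: cmeas_n1 fi.1.
- exact: fi.2.
Qed.

Lemma prim_diff phi x y : cintg mu phi -> x <= y ->
  prim phi y - prim phi x = cI mu (fun t => if (x <= t) && (t < y) then phi t else 0).
Proof.
move=> pi xy; rewrite /prim -cIB; try by apply: cintg_if => //; exact: measurable_ltb.
congr cI; apply/funext => t; case: (ltP t x) => /= tx; last by rewrite subr0.
by rewrite (lt_le_trans tx xy) subrr.
Qed.

Lemma n1_prim_diff phi x y : cintg mu phi -> x <= y ->
  ((n1 (prim phi y - prim phi x))%:E <=
   \int[mu]_t (if (x <= t)%R && (t < y)%R then n1 (phi t) else 0)%:E)%E.
Proof.
move=> pi xy; rewrite prim_diff//.
have mB := measurable_and (measurable_geb x) (measurable_ltb y).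
apply: (le_trans (@le_n1_cI _ X R mu _ (cintg_if mB pi).1)).
by rewrite le_eqVlt; apply/orP; left; apply/eqP; apply: eq_integral => t _; case: ifP; rewrite ?n1_0.
Qed.

Lemma cintg_Rn1 phi : cintg mu phi -> mu.-integrable setT (EFin \o (fun t => n1 (phi t))).
Proof.
move=> pi; apply/integrableP; split; first by apply/measurable_EFinP; exact: cmeas_n1 pi.1.
apply: le_lt_trans pi.2; rewrite le_eqVlt; apply/orP; left; apply/eqP.
by apply: eq_integral => t _ /=; rewrite ger0_norm ?n1_ge0.
Qed.

Lemma mu_itv x y : x <= y -> mu `[x, y[%classic = (y - x)%:E.
Proof.
move=> xy; rewrite lebesgue_measure_itv/= lte_fin lt_neqAle xy andbT.
by case: eqVneq => [->|_] /=; rewrite ?subrr.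
Qed.

Lemma prim_ac phi (e : R) : cintg mu phi -> 0 < e -> exists2 d : R, 0 < d &
  forall (N : nat) (u v : 'I_N -> R), (forall i, u i <= v i) ->
      (forall i j, i != j -> v i <= u j \/ v j <= u i) ->
      \sum_i (v i - u i) < d ->
      \sum_i n1 (prim phi (v i) - prim phi (u i)) < e.
Proof.
move=> pi e0; have [d [d0 H]] := integral_normr_continuous (cintg_Rn1 pi) e0.
exists d => // N u v uv dis lt.
(* Half-open intervals, so that adjacent ones are disjoint and the measure of their union is the sum
   of the lengths. *)
pose F i : set X := `[u i, v i[%classic.
have mF i : measurable (F i) by exact: measurable_itv.
pose A := \big[setU/set0]_(i < N) F i.
have mA : measurable A by exact: bigsetU_measurable.
have Fi i t : F i t <-> u i <= t < v i by rewrite /F /= in_itv.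
have tF : trivIset setT F.
  apply/trivIsetP => i j _ _ ij; rewrite /F -subset0 => t [] /=; rewrite !in_itv/= => /andP[t1 t2] /andP[t3 t4].
  by case: (dis i j ij) => h; lra.
have muA : (mu A < d%:E)%E.
  rewrite /A measure_bigsetU_ord// (eq_bigr (fun i => (v i - u i)%:E)) ?sumEFin ?lte_fin// => i _.
  exact: mu_itv.
have := H A mA muA; apply: le_lt_trans; rewrite -lee_fin -sumEFin.
have iA : mu.-integrable A (EFin \o (fun t => n1 (phi t))).
  exact: integrableS (cintg_Rn1 pi).
have -> : (Rintegral mu A (fun t => `|n1 (phi t)|))%:E = (\int[mu]_(t in A) (n1 (phi t))%:E)%E.
  rewrite fineK; last by apply: integrable_fin_num => //; exact: integrable_norm iA.
  by apply: eq_integral => t _; rewrite ger0_norm ?n1_ge0.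
rewrite integral_mkcond.
pose h i t := if (u i <= t) && (t < v i) then n1 (phi t) else 0.
have mh i : measurable_fun setT (fun t : X => (h i t)%:E).
  apply/measurable_EFinP; apply: measurable_fun_ifT => //; last exact: cmeas_n1 pi.1.
  exact: measurable_and (measurable_geb _) (measurable_ltb _).
have h0 i t : 0 <= h i t by rewrite /h; case: ifP => // _; exact: n1_ge0.
apply: (@le_trans _ _ (\sum_(i < N) \int[mu]_t (h i t)%:E)%E).
  by apply: lee_sum => i _; apply: n1_prim_diff.
rewrite -ge0_integral_sum//; last by move=> i t _; rewrite lee_fin.
apply: ge0_le_integral => //.
- by move=> t _; apply: sume_ge0 => i _; rewrite lee_fin.
- by apply: emeasurable_sum.
- apply/(measurable_restrictT _ mA); apply: measurable_funTS; apply/measurable_EFinP; exact: cmeas_n1 pi.1.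
move=> t _; rewrite sumEFin /patch; case: ifPn => [tA|tA].
- have [i0 ti] : exists i, F i t by move: tA; rewrite inE /A -bigcup_seq => -[i _ ti]; exists i.
  rewrite lee_fin (bigD1 i0)//= big1 ?addr0; first by rewrite /h; case: ifP => // _; rewrite n1_ge0.
  move=> j ji; rewrite /h; case: ifPn => // tj; move/trivIsetP: tF => /(_ i0 j I I).
  by rewrite eq_sym => /(_ ji) /seteqP[/(_ t) + _] => []; case; split => //; exact/Fi.
- change ((\sum_i h i t)%:E <= 0)%E.
  rewrite big1// => i _; rewrite /h; case: ifPn => // ti; exfalso.
  move/negP: tA; apply; rewrite inE /A -bigcup_seq; exists i; [exact: mem_index_enum|exact/Fi].
Qed.

Lemma prim_ccont phi A x : cintg mu phi -> ccont A (prim phi) x.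
Proof.
move=> pi e e0; have [d d0 H] := prim_ac pi e0; exists d => // t _ tx.
have e1 := H 1%N.
have [xt|tx'] := leP x t.
  have := e1 (fun=> x) (fun=> t); rewrite !big_ord1 => h; apply/ltW/h => //.
    by move=> i j; rewrite !ord1.
  by move: tx; rewrite ger0_norm ?subr_ge0.
have := e1 (fun=> t) (fun=> x); rewrite !big_ord1 -n1N opprB => h; apply/ltW/h => //.
- by move=> _; exact: ltW.
- by move=> i j; rewrite !ord1.
- by move: tx; rewrite ltr0_norm ?subr_lt0// opprB.
Qed.

Lemma prim_abs_cont c b phi z : cintg mu phi -> abs_cont c b (fun x => z + prim phi x).
Proof.
move=> pi e e0; have [d d0 H] := prim_ac pi e0; exists d => // N u v h1 h2 h3.
apply: le_lt_trans (H N u v _ h2 h3) => [|i]; last by have [_ [/ltW]] := h1 i.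
apply: ler_sum => i _; apply: le_trans (Re_norm_le _) _.
by rewrite opprD addrACA subrr add0r.
Qed.

Lemma prim_left c phi x : (forall t, t < c -> phi t = 0) -> x <= c -> prim phi x = 0.
Proof.
move=> p0 xc; rewrite /prim -[RHS](cI0 mu); congr cI; apply/funext => t.
by case: ifP => // tx; rewrite p0// (lt_le_trans tx).
Qed.

Lemma int_itv x y (e : R) : x <= y -> 0 <= e ->
  (\int[mu]_t (if (x <= t)%R && (t < y)%R then e else 0)%:E = (e * (y - x))%:E)%E.
Proof.
move=> xy e0.
rewrite [LHS](_ : _ = \int[mu]_t (e%:E * (\1_(`[x, y[%classic : set X) t)%:E))%E; last first.
  apply: eq_integral => t _; rewrite indicE mem_setE in_itv/=.
  by case: ifP => _; rewrite ?mule1 ?mule0.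
have mI : measurable (`[x, y[%classic : set X) by exact: measurable_itv.
rewrite ge0_integralZl//; last by apply/measurable_EFinP; exact: measurable_indic.
by rewrite integral_indic// setIT EFinM; congr (_ * _)%E; exact: mu_itv.
Qed.

Lemma n1_prim_diff_cst phi z (e : R) x y : cintg mu phi -> x <= y -> 0 <= e ->
  {ae mu, forall t, x <= t < y -> n1 (phi t - z) <= e} ->
  n1 (prim phi y - prim phi x - z * (y - x)%:C) <= e * (y - x).
Proof.
move=> pi xy e0 h; rewrite prim_diff//.
have mB := measurable_and (measurable_geb x) (measurable_ltb y).
have i1 : cintg mu (fun t => if (x <= t) && (t < y) then 1 else 0 : R[i]).
  apply: (cintg_le (h := fun t : X => (if (x <= t) && (t < y) then 1 else 0) : R)).
  - by apply: cmeas_if => //; exact: cmeas_cst.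
  - by move=> t; case: ifP => _; rewrite ?n1_0// (n1_real 1) normr1.
  - by apply: measurable_fun_ifT.
  - by rewrite int_itv// ltry.
have iz : cintg mu (fun t => if (x <= t) && (t < y) then z else 0).
  have -> : (fun t => if (x <= t) && (t < y) then z else 0) =
      (fun t => z * (if (x <= t) && (t < y) then 1 else 0)).
    by apply/funext => t; case: ifP => _; rewrite ?mulr1 ?mulr0.
  exact: cintgZl.
have -> : z * (y - x)%:C = cI mu (fun t => if (x <= t) && (t < y) then z else 0).
  have -> : (fun t => if (x <= t) && (t < y) then z else 0) =
      (fun t => z * (if (x <= t) && (t < y) then 1 else 0)).
    by apply/funext => t; case: ifP => _; rewrite ?mulr1 ?mulr0.
  rewrite cIZl//; congr (z * _); apply: complexP; rewrite ?Re_cI ?Im_cI /=; rewrite /Rintegral.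
    rewrite [RHS](_ : _ = fine (\int[mu]_t (if (x <= t)%R && (t < y)%R then 1%R else 0%R)%:E)%E).
      by rewrite int_itv// mul1r.
    by congr fine; apply: eq_integral => t _; case: ifP.
  rewrite -[LHS](@Rintegral_cst0 R); congr fine; apply: eq_integral => t _; by case: ifP.
rewrite -cIB//; last exact: cintg_if.
have iB := cintg_if mB pi.
rewrite -lee_fin; apply: (le_trans (@le_n1_cI _ X R mu _ (cintgB iB iz).1)).
rewrite -int_itv//; apply: ae_ge0_le_integral => //.
- by move=> t _; rewrite lee_fin n1_ge0.
- exact: cmeas_n1E (cintgB iB iz).1.
- by move=> t _; rewrite lee_fin; case: ifP.
- by apply/measurable_EFinP; apply: measurable_fun_ifT.
apply: filterS h => t h _; rewrite lee_fin; case: ifPn => k; last by rewrite subrr n1_0.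
exact: h.
Qed.

(** One-sided at the endpoints: inside (c,b) the integrand agrees with [g], and continuity of [g] on
    the closed interval controls the increments up to the boundary. *)
Lemma prim_cder c b phi g x : c <= x <= b -> cintg mu phi ->
  (forall t, c < t < b -> phi t = g t) -> ccont (`[c, b]%classic : set R) g x ->
  cder (`[c, b]%classic : set R) (prim phi) x (g x).
Proof.
move=> /andP[cx xb] pi pg gc e e0; have [r r0 hr] := gc e e0; exists r => // t.
rewrite /= in_itv/= => /andP[ct tb] tr.
have H y w : c <= y -> w <= b -> y <= w -> (forall s, y <= s <= w -> `|s - x| < r) ->
    n1 (prim phi w - prim phi y - g x * (w - y)%:C) <= e * (w - y).
  move=> cy wb yw hs; apply: n1_prim_diff_cst => //; first exact: ltW.
  apply: filterS (ae_neq c) => s sc /andP[ys sw].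
  have csb : c < s < b by rewrite lt_neqAle eq_sym sc (le_trans cy ys) (lt_le_trans sw wb).
  rewrite pg//; apply: hr; first by rewrite /= in_itv/= !ltW//; case/andP: csb.
  by apply: hs; rewrite ys ltW.
have [xt|tx] := leP x t.
  rewrite ger0_norm ?subr_ge0//; apply: H => // s /andP[h1 h2].
  by apply: le_lt_trans tr; rewrite !ger0_norm ?subr_ge0// lerD2r.
have := H t x ct xb (ltW tx).
rewrite ltr0_norm ?subr_lt0// opprB -n1N !opprB.
have -> : g x * (x - t)%:C + (prim phi t - prim phi x) = prim phi t - prim phi x - g x * (t - x)%:C.
  by rewrite !rmorphB/=; ring.
apply => s /andP[h1 h2]; apply: le_lt_trans tr; rewrite ler0_norm ?subr_le0//.
by rewrite ltr0_norm ?subr_lt0// lerN2 lerD2r.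
Qed.

Lemma is_derive_rder (f : R -> R) x (d : R) : derivable f x 1 -> derive1 f x = d -> rder f x d.
Proof.
rewrite /derivable => h; rewrite derive1E /derive => E.
have : h0^-1 *: (f (h0 *: (1 : R^o) + x) - f x) @[h0 --> 0^'] --> d by rewrite -E.
move=> /cvgrPdist_le H e e0; have := H e e0.
rewrite /dnbhs near_withinE => /nbhs_normP[r r0 hr]; exists r => // t tx.
have [->|tx0] := eqVneq t x; first by rewrite !subrr mulr0 subrr normr0 mulr0.
have := hr (t - x); rewrite /= sub0r normrN => /(_ tx); rewrite subr_eq0 => /(_ tx0).
rewrite scaler1 subrK => k.
have t0 : 0 < `|t - x| by rewrite normr_gt0 subr_eq0.
have -> : f t - f x - d * (t - x) = - ((d - (t - x)^-1 *: (f t - f x)) * (t - x)).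
  by rewrite mulrBl [_ *: _]mulrC divfK ?subr_eq0// opprB.
by rewrite normrN normrM ler_pM2r.
Qed.

Lemma rder_cder A f x d : rder (fun t => complex.Re (f t)) x (complex.Re d) ->
  rder (fun t => complex.Im (f t)) x (complex.Im d) -> cder A f x d.
Proof.
move=> h1 h2 e e0; have e2 : 0 < e / 2 by rewrite divr_gt0.
have [r r0 hr] := h1 _ e2; have [s s0 hs] := h2 _ e2.
exists (Num.min r s); first by rewrite lt_min r0.
move=> t _; rewrite lt_min => /andP[t1 t2]; rewrite (splitr e) mulrDl /n1 !ReImE/=.
by rewrite !mulr0 subr0 add0r lerD// ?hr ?hs.
Qed.

Lemma cder_rder c b f x d : c < x < b -> cder (`]c, b[%classic : set R) f x d ->
  rder (fun t => complex.Re (f t)) x (complex.Re d) /\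
  rder (fun t => complex.Im (f t)) x (complex.Im d).
Proof.
move=> /andP[cx xb] h; split=> e e0; have [r r0 hr] := h e e0.
all: exists (Num.min r (Num.min (x - c) (b - x))); first by rewrite !lt_min r0 !subr_gt0 cx.
all: move=> t; rewrite !lt_min => /and3P[t1 t2 t3].
all: have tI : (`]c, b[%classic : set R) t.
1,3: by rewrite /= in_itv/=; move: t2 t3; rewrite !ltr_norml => /andP[h1 h2] /andP[h3 h4]; apply/andP; split; lra.
all: apply: le_trans (hr t tI t1).
- by apply: le_trans (ler_Re_n1 _); rewrite !ReImE/= mulr0 subr0.
- by apply: le_trans (ler_Im_n1 _); rewrite !ReImE/= mulr0 add0r.
Qed.

Lemma itvP_oo (c b t : R) : t \in `]c, b[ -> c < t < b.
Proof. by rewrite in_itv. Qed.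

Lemma prim_ae_cder A phi : cintg mu phi -> {ae mu, forall x, cder A (prim phi) x (phi x)}.
Proof.
move=> pi.
have ft (p : R -> R) : mu.-integrable setT (EFin \o p) ->
    {ae mu, forall x, rder (fun x => Rintegral mu setT (fun t => if t < x then p t else 0)) x (p x)}.
  move=> ip; have mp : measurable_fun setT (p : X -> R).
    by apply/measurable_EFinP; exact: measurable_int ip.
  have lp : locally_integrable setT p.
    split=> //; first exact: openT.
    move=> K _ cK; have mK : measurable (K : set X) by apply: compact_measurable.
    have := integrableS measurableT mK (@subsetT _ _) ip.
    by move=> /integrableP[_].
  have iy (y : R) : (@lebesgue_measure R).-integrable [set` Interval -oo%O (BRight y)] (EFin \o p).
    by apply: (integrableS measurableT) => //; exact: measurable_itv.
  have FE : (fun x => Rintegral mu setT (fun t => if t < x then p t else 0)) =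
      (fun x => Rintegral mu [set` Interval -oo%O (BRight x)] p).
    apply/funext => x; rewrite -Rintegral_itv_bndo_bndc; last first.
      by apply: (integrableS measurableT) => //; exact: measurable_itv.
    rewrite [RHS]Rintegral_mkcond; congr Rintegral; apply/funext => t.
    by rewrite /patch mem_setE in_itv.
  have [A1 [A2 A3 A4]] := FTC1 iy lp.
  exists A1; split => // x /= nx; apply: A4 => /= h; apply: nx.
  have [h1 h2] := h (ltNyr x).
  by rewrite FE; apply: is_derive_rder.
have h1 := ft _ (cintg_Re pi); have h2 := ft _ (cintg_Im pi).
have eR : (fun x => complex.Re (prim phi x)) =
    (fun x => Rintegral mu setT (fun t => if t < x then complex.Re (phi t) else 0)).
  by apply/funext => x; congr Rintegral; apply/funext => t; case: ifP.
have eI : (fun x => complex.Im (prim phi x)) =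
    (fun x => Rintegral mu setT (fun t => if t < x then complex.Im (phi t) else 0)).
  by apply/funext => x; congr Rintegral; apply/funext => t; case: ifP.
by apply: filterS2 h1 h2 => x h1 h2; apply: rder_cder; rewrite ?eR ?eI.
Qed.

Lemma cont_L1 c b g : c < b -> (forall x, c <= x <= b -> ccont (`[c, b]%classic : set R) g x) -> L1 c b g.
Proof.
move=> cb gc; have [h1 h2] : ccontinuous (`[c, b]%classic : set R) g.
  by apply/ccontP => x; rewrite /= in_itv; exact: gc.
have sub : (`]c, b[%classic : set X) `<=` `[c, b]%classic by exact: subset_itv_oo_cc.
have mI : measurable (`]c, b[%classic : set X) by exact: measurable_itv.
have mJ : measurable (`[c, b]%classic : set X) by exact: measurable_itv.
by split; apply: (integrableS mJ mI sub); apply: continuous_compact_integrable => //; exact: segment_compact.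
Qed.

Lemma zero_der_cst c b f : c < b ->
  (forall x, c <= x <= b -> cder (`[c, b]%classic : set R) f x 0) ->
  forall x, c <= x <= b -> f x = f c.
Proof.
move=> cb fd x /andP[]; rewrite le_eqVlt => /orP[/eqP ->//|cx] xb.
have sub : (`]c, x[%classic : set R) `<=` `[c, b]%classic.
  move=> t /=; rewrite !in_itv/= => /andP[ct tx]; rewrite (ltW ct)/=; lra.
have fc : ccontinuous (`[c, x]%classic : set R) f.
  apply/ccontP => t; rewrite /= in_itv/= => /andP[ct tx].
  apply: (@ccont_sub _ (`[c, b]%classic)).
    by move=> s /=; rewrite !in_itv/= => /andP[-> h]/=; exact: le_trans h xb.
  by apply: cder_ccont; apply: fd; rewrite ct (le_trans tx xb).
have rd t : c < t < x -> rder (fun t => complex.Re (f t)) t 0 /\ rder (fun t => complex.Im (f t)) t 0.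
  move=> ctx; have h : cder (`]c, x[%classic : set R) f t 0.
    by apply: (cder_sub sub); apply: fd; case/andP: ctx => h1 h2; rewrite (ltW h1)/=; lra.
  exact: (cder_rder ctx h).
have idr (p : R -> R) t : rder p t 0 -> is_derive t 1 p 0.
  move=> h.
  have cv : h0^-1 *: (p (h0 *: (1 : R^o) + t) - p t) @[h0 --> 0^'] --> (0 : R).
    apply/cvgrPdist_le => e e0; have [r r0 hr] := h e e0.
    rewrite /dnbhs near_withinE; apply/nbhs_normP; exists r => // k /=.
    rewrite sub0r normrN => kr k0; rewrite sub0r normrN scaler1.
    have := hr (k + t); rewrite addrK => /(_ kr); rewrite mul0r subr0 => hk.
    rewrite [_ *: _]mulrC normrM normfV ler_pdivrMr// normr_gt0//.
  by split; [apply/cvg_ex; exists 0|exact: cvg_lim cv].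
apply: complexP.
- have [t _ h] := MVT_segment (ltW cx) (fun t tI => idr _ t (rd t (itvP_oo tI)).1) fc.1.
  by apply/eqP; rewrite -subr_eq0 [X in X == 0]h mul0r.
- have [t _ h] := MVT_segment (ltW cx) (fun t tI => idr _ t (rd t (itvP_oo tI)).2) fc.2.
  by apply/eqP; rewrite -subr_eq0 [X in X == 0]h mul0r.
Qed.

(** The difference of [f] and the primitive has zero derivative on [c,b], so the mean value theorem
    makes it constant. *)
Lemma C1_prim c b f g : c < b ->
  (forall x, c <= x <= b -> cder (`[c, b]%classic : set R) f x (g x)) ->
  (forall x, c <= x <= b -> ccont (`[c, b]%classic : set R) g x) ->
  forall x, c <= x <= b -> f x = f c + prim (res c b g) x.
Proof.
move=> cb fd gc x xI.
have gi : cintg mu (res c b g) by apply/L1P; exact: cont_L1.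
pose h t := f t + (-1) * prim (res c b g) t.
have hd t : c <= t <= b -> cder (`[c, b]%classic : set R) h t 0.
  move=> tI; rewrite -[0](_ : g t + (-1) * g t = 0); last by rewrite mulN1r subrr.
  apply: cderD; first exact: fd.
  by apply: cderZ; apply: prim_cder => //; [move=> s sI; exact: res_in|exact: gc].
have := zero_der_cst cb hd xI; rewrite /h (@prim_left c _ c)//; last first.
  by move=> t tc; rewrite res_out// negb_and -leNgt (ltW tc).
by rewrite mulr0 addr0 => <-; rewrite mulN1r subrK.
Qed.

(** The a.e. derivative [w] may be non-measurable; [phi] is an integrable version of it, extended by
    0, from which [f] is recovered. *)
Lemma ac_prim c b f w : c < b -> abs_cont c b f ->
  {ae mu, forall x, c < x < b -> cder (`]c, b[%classic : set R) f x (w x)} ->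
  exists phi, [/\ cintg mu phi, forall x, ~~ (c < x < b) -> phi x = 0,
    aeeq c b phi w & forall x, c <= x <= b -> f x = f c + prim phi x].
Proof.
move=> cb fac wd.
have acR : racf c b (fun x => complex.Re (f x)).
  move=> e e0; have [d d0 H] := fac e e0; exists d => // N u v h1 h2 h3.
  apply: le_lt_trans (H N u v h1 h2 h3); apply: ler_sum => i _.
  by rewrite -cReB ler_Re_norm.
have acI : racf c b (fun x => complex.Im (f x)).
  move=> e e0; have [d d0 H] := fac e e0; exists d => // N u v h1 h2 h3.
  apply: le_lt_trans (H N u v h1 h2 h3); apply: ler_sum => i _.
  by rewrite -cImB ler_Im_norm.
have rdR : {ae mu, forall x, c < x < b -> rder (fun x => complex.Re (f x)) x (complex.Re (w x))}.
  by apply: filterS wd => x h xI; have [] := cder_rder xI (h xI).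
have rdI : {ae mu, forall x, c < x < b -> rder (fun x => complex.Im (f x)) x (complex.Im (w x))}.
  by apply: filterS wd => x h xI; have [] := cder_rder xI (h xI).
have [P [iP P0 Pw fP]] := ac_int cb acR rdR.
have [Q [iQ Q0 Qw fQ]] := ac_int cb acI rdI.
pose phi x : R[i] := P x +i* Q x.
have pi : cintg mu phi by apply/cintgP.
exists phi; split => //.
- by move=> x xI; rewrite /phi P0// Q0.
- apply: filterS2 Pw Qw => x h1 h2; rewrite in_itv/= => xI.
  by apply: complexP => /=; [rewrite h1|rewrite h2].
- move=> x xI; apply/eqP; rewrite addrC -subr_eq; apply/eqP; apply: complexP.
  + rewrite cReB fP// /prim Re_cI; congr Rintegral; apply/funext => t; by case: ifP.
  + rewrite cImB fQ// /prim Im_cI; congr Rintegral; apply/funext => t; by case: ifP.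
Qed.

End Primitives.

(** * Fractional integrals *)

Section FractionalIntegrals.
Variable R : realType.
Local Notation mu := (@lebesgue_measure R).
Local Notation X := (measurableTypeR R).
Variables (a b : R).
Hypothesis ab : a < b.
Implicit Types (f g phi : R -> R[i]) (x y c : R) (z be ga : R[i]).

(** The cut-offs leave only arguments x - t <= b - a. The columns are therefore integrable over the
    line, although the power [kf be] is not integrable at infinity. *)
Definition rl_kernel be (x t : X) : R[i] := if (a < (t : R)) && ((x : R) < b) then kf be ((x : R) - (t : R)) else 0.

Definition cut_kf be (u : R) : R[i] := if u <= b - a then kf be u else 0.

Definition rl_bound be : R := fine (\int[mu]_u (n1 (cut_kf be u))%:E).

Lemma int_cut_kf be : 0 < complex.Re be -> (\int[mu]_u (n1 (cut_kf be u))%:E)%E = (rl_bound be)%:E.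
Proof.
move=> be0; rewrite /rl_bound fineK// ge0_fin_numE; last by apply: integral_ge0 => u _; rewrite lee_fin n1_ge0.
have d0 : 0 < b - a by rewrite subr_gt0.
apply: le_lt_trans (int_kf_fin be0 d0); rewrite le_eqVlt; apply/orP; left; apply/eqP.
by apply: eq_integral => u _; rewrite /cut_kf; case: ifP => // _; rewrite n1_0.
Qed.

Lemma rl_bound_ge0 be : 0 <= rl_bound be.
Proof. by apply: fine_ge0; apply: integral_ge0 => u _; rewrite lee_fin n1_ge0. Qed.

Lemma cmeas_cut_kf be : cmeas (cut_kf be : X -> _).
Proof.
apply: cmeas_if; [exact: measurable_fun_ler|exact: cmeas_kf|exact: cmeas_cst].
Qed.

Lemma kmeas_rl_kernel be : kmeas (rl_kernel be).
Proof.
apply: cmeas_if; [|exact: (kmeas_convk (cmeas_kf be))|exact: cmeas_cst].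
apply: measurable_and.
  by apply: measurable_fun_ltr => //; exact: measurable_snd.
by apply: measurable_fun_ltr => //; exact: measurable_fst.
Qed.

Lemma n1_rl_kernel be x t : n1 (rl_kernel be x t) <= n1 (convk (cut_kf be) x t).
Proof.
rewrite /rl_kernel /convk /cut_kf; case: ifPn => [/andP[h1 h2]|_]; last by rewrite n1_0 n1_ge0.
by rewrite ifT// lerB// ltW.
Qed.

Lemma bnd_rl_kernel be : 0 < complex.Re be -> bnd mu (rl_kernel be) (rl_bound be).
Proof.
move=> be0 t; have h : (\int[mu]_u (n1 (cut_kf be u))%:E <= (rl_bound be)%:E)%E by rewrite int_cut_kf.
have := bnd_convk (cmeas_cut_kf be) h t.
apply: le_trans; apply: ge0_le_integral => //.
- by move=> x _; rewrite lee_fin n1_ge0.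
- exact: cmeas_n1E (kmeas2 t (kmeas_rl_kernel be)).
- exact: cmeas_n1E (kmeas2 t (kmeas_convk (cmeas_cut_kf be))).
- by move=> x _; rewrite lee_fin n1_rl_kernel.
Qed.

Lemma conv_shift be ga x c : 0 < complex.Re be -> 0 < complex.Re ga ->
  cI mu (fun t => kf be (x - t) * kf ga (t - c)) = kf (be + ga) (x - c).
Proof.
move=> b0 g0; rewrite -kf_conv//.
rewrite -(cI_shift c (h := fun s => kf be (x - c - s) * kf ga s)).
  by congr cI; apply/funext => t /=; congr (kf _ _ * _); ring.
apply: cmeasM; last exact: cmeas_kf.
exact: (kmeas1 (x - c) (kmeas_convk (cmeas_kf be))).
Qed.

(* I_{a+}^be for be = 0 or Re be > 0; for f supported in (c,b), a <= c, this is
   I_{c+}^be on (c,b). *)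
Definition J be f : R -> R[i] := if be == 0 then f else Op mu (rl_kernel be) f.

Definition admissible be : Prop := be = 0 \/ 0 < complex.Re be.

Lemma Re_gt0_neq0 be : 0 < complex.Re be -> be != 0.
Proof. by apply: contraTneq => ->; rewrite /= ltxx. Qed.

Lemma J0 f : J 0 f = f. Proof. by rewrite /J eqxx. Qed.
Lemma JE be f : 0 < complex.Re be -> J be f = Op mu (rl_kernel be) f.
Proof. by move=> /Re_gt0_neq0 /negbTE b0; rewrite /J b0. Qed.

Lemma J_intg be f : admissible be -> cintg mu f -> cintg mu (J be f).
Proof.
case=> [->|b0] fi; first by rewrite J0.
by rewrite JE//; exact: (Op_intg (kmeas_rl_kernel be) (bnd_rl_kernel b0) (rl_bound_ge0 be) fi).
Qed.

Lemma J_ae be f g : admissible be -> cmeas (f : X -> _) -> cmeas (g : X -> _) ->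
  {ae mu, forall x, f x = g x} -> {ae mu, forall x, J be f x = J be g x}.
Proof.
case=> [->|b0] mf mg fg; first by rewrite !J0.
apply: filterS (fg) => x _.
by rewrite !JE//; apply: (Op_ae_eq _ (kmeas_rl_kernel be) mf mg).
Qed.

Lemma JD be f g : admissible be -> cintg mu f -> cintg mu g ->
  {ae mu, forall x, J be (fun t => f t + g t) x = J be f x + J be g x}.
Proof.
case=> [->|b0] fi gi; first by rewrite !J0; apply: filterS (ae_neq 0) => x _.
rewrite !JE//; exact: (ae_OpD (kmeas_rl_kernel be) (bnd_rl_kernel b0) (rl_bound_ge0 be) fi gi).
Qed.

Lemma JZ be z f : admissible be -> cintg mu f ->
  {ae mu, forall x, J be (fun t => z * f t) x = z * J be f x}.
Proof.
case=> [->|b0] fi; first by rewrite !J0; apply: filterS (ae_neq 0) => x _.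
rewrite !JE//; exact: (ae_OpZ z (kmeas_rl_kernel be) (bnd_rl_kernel b0) (rl_bound_ge0 be) fi).
Qed.

Lemma J_cst0 be x : J be (fun=> 0) x = 0.
Proof.
rewrite /J; case: ifP => // _; rewrite /Op -[RHS](cI0 mu); congr cI.
by apply/funext => t; rewrite mulr0.
Qed.

Lemma J_sum be (I : eqType) (s : seq I) (z : I -> R[i]) (F : I -> R -> R[i]) : admissible be ->
  (forall i, i \in s -> cintg mu (F i)) ->
  {ae mu, forall x, J be (fun t => \sum_(i <- s) z i * F i t) x = \sum_(i <- s) z i * J be (F i) x}.
Proof.
move=> b0; elim: s => [|i s IH] h.
  apply: filterS (ae_neq 0) => x _; rewrite big_nil -[RHS](J_cst0 be x); congr (J be _ x).
  by apply/funext => t; rewrite big_nil.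
have {}IH := IH (fun j js => h j (mem_behead (s := i :: s) js)).
have hi := h i (mem_head _ _).
have hs : cintg mu (fun t => \sum_(i <- s) z i * F i t).
  elim: s h {IH} => [|j s IHs] h.
    by under eq_fun do rewrite big_nil; exact: cintg0.
  under eq_fun do rewrite big_cons.
  apply: cintgD; first by apply: cintgZl; apply: h; rewrite !inE eqxx orbT.
  by apply: IHs => k; rewrite inE => /orP[/eqP ->|ks]; apply: h; rewrite !inE ?eqxx// ks !orbT.
apply: filterS3 IH (JZ (z i) b0 hi) (JD b0 (cintgZl (z i) hi) hs) => x e1 e2 e3.
rewrite big_cons -e1 -e2 -e3; congr (J be _ x).
by apply/funext => t; rewrite big_cons.
Qed.

(** The composed kernel is the convolution of [kf be] and [kf ga] shifted to xi. The cut-offs lose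
    nothing, because the product of the two factors vanishes unless xi < t < x. *)
Lemma J_J be ga f : admissible be -> admissible ga -> cintg mu f ->
  {ae mu, forall x, J be (J ga f) x = J (be + ga) f x}.
Proof.
move=> [->|b0] [->|g0] fi; try by apply: filterS (ae_neq 0) => x _; rewrite ?J0 ?add0r ?addr0 ?J0.
have bg0 : 0 < complex.Re (be + ga) by rewrite cReD addr_gt0.
rewrite !JE//.
apply: filterS (ae_OpOp (kmeas_rl_kernel be) (kmeas_rl_kernel ga) (bnd_rl_kernel b0) (bnd_rl_kernel g0) (rl_bound_ge0 be) (rl_bound_ge0 ga) fi) => x ->.
rewrite /Op; congr cI; apply/funext => xi; congr (_ * _).
rewrite {3}/rl_kernel; case: ifPn => [/andP[h1 h2]|h].
  rewrite -conv_shift//; congr cI; apply/funext => t; rewrite /rl_kernel h1 h2 andbT/=.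
  have [tb|bt] := ltP (t : R) b; have [at_|ta] := ltP a (t : R) => //=; rewrite ?mulr0 ?mul0r //.
  - by rewrite (kf_le0 ga) ?mulr0//; lra.
  - by rewrite (kf_le0 be) ?mul0r//; lra.
  - by rewrite (kf_le0 be) ?mul0r//; lra.
rewrite -[RHS](cI0 mu); congr cI; apply/funext => t; rewrite /rl_kernel.
move: h; rewrite negb_and => /orP[/negbTE ->|/negbTE ->]; first by rewrite mulr0.
by rewrite andbF mul0r.
Qed.

Definition pf c ga : R -> R[i] := res c b (fun t => kf ga (t - c)).

Lemma pf_intg c ga : a <= c -> 0 < complex.Re ga -> cintg mu (pf c ga).
Proof.
move=> ac g0; apply: (cintg_le (h := fun t : X => n1 (cut_kf ga ((t : R) - c)))).
- apply: cmeas_if; [|exact: (kmeas2 c (kmeas_convk (cmeas_kf ga)))|exact: cmeas_cst].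
  by apply: measurable_and; [exact: measurable_gtb|exact: measurable_ltb].
- move=> t; rewrite /pf /res; case: ifPn => [/andP[ct tb]|_]; last by rewrite n1_0 n1_ge0.
  by rewrite /cut_kf ifT//; lra.
- apply: cmeas_n1; exact: (kmeas2 c (kmeas_convk (cmeas_cut_kf ga))).
- rewrite (ge0_integral_shift c (cmeas_n1E (cmeas_cut_kf ga))) ?int_cut_kf ?ltry// => u.
  by rewrite lee_fin n1_ge0.
Qed.

Lemma J_pf be ga c x : admissible be -> 0 < complex.Re ga -> a <= c -> J be (pf c ga) x = pf c (be + ga) x.
Proof.
case=> [->|b0] g0 ac; first by rewrite J0 add0r.
rewrite JE// /Op /pf /res; case: ifPn => [/andP[cx xb]|h].
  rewrite -conv_shift//; congr cI; apply/funext => t; rewrite /rl_kernel xb andbT /res.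
  have [ct|tc] := ltP c t; last by rewrite mulr0 (kf_le0 ga) ?mulr0//; lra.
  rewrite (le_lt_trans ac ct) /=; case: ltP => // bt.
  by rewrite mulr0 (kf_le0 be) ?mul0r//; lra.
rewrite -[RHS](cI0 mu); congr cI; apply/funext => t; rewrite /rl_kernel /res.
case: ltP => at_ /=; last by rewrite mul0r.
case: ltP => xb /=; last by rewrite mul0r.
case: ltP => ct /=; last by rewrite mulr0.
move: h; rewrite xb andbT -leNgt => xc.
by rewrite (kf_le0 be) ?mul0r//; lra.
Qed.

Lemma J1 f x : (forall t, t <= a -> f t = 0) -> x < b -> J 1 f x = prim f x.
Proof.
move=> fa xb; rewrite JE ?ltr01// /Op /prim; congr cI; apply/funext => t.
rewrite /rl_kernel xb andbT; case: ltP => at_ /=; last by rewrite fa// mul0r if_same.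
case: ltP => tx; first by rewrite kf1 ?mul1r// subr_gt0.
by rewrite kf_le0 ?mul0r// subr_le0.
Qed.

Lemma J_supp be f c : a <= c -> (forall x, ~~ (c < x < b) -> f x = 0) ->
  forall x, ~~ (c < x < b) -> J be f x = 0.
Proof.
move=> ac f0 x xn; rewrite /J; case: ifP => _; first exact: f0.
rewrite /Op -[RHS](cI0 mu); congr cI; apply/funext => t.
have [tI|/f0 ->] := boolP (c < t < b); last by rewrite mulr0.
move: tI => /andP[ct tb]; rewrite /rl_kernel; case: ifPn => [/andP[at_ xb]|_]; last by rewrite mul0r.
move: xn; rewrite xb andbT -leNgt => xc.
by rewrite kf_le0 ?mul0r//; lra.
Qed.

(** [RLint] has the factor 1 / Gamma outside the integral and [J] has it inside; they agree where
    the integrand is integrable, that is a.e. The base point a replaces [c] because the argument is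
    cut to (c,b). *)
Lemma RLint_J be c f : admissible be -> a <= c -> L1 c b f -> aeeq c b (RLint c be f) (J be (res c b f)).
Proof.
move=> ok ac /L1P fi; case: (ok) => [->|b0].
  by rewrite J0 /RLint eqxx; apply: aeeq_all => x xI; rewrite res_in.
have := ae_Op_intg (kmeas_rl_kernel be) (bnd_rl_kernel b0) (rl_bound_ge0 be) fi.
apply: filterS => x ix; rewrite in_itv/= => /andP[cx xb].
rewrite /RLint (negbTE (Re_gt0_neq0 b0)) JE// /Op cint_cI.
pose h t := if (a < t) && (x < b) then pw be (x - t) * res c b f t else 0.
have e t : rl_kernel be x t * res c b f t = rGamma be * h t.
  by rewrite /rl_kernel /h; case: ifP => _; rewrite ?mul0r ?mulr0// /kf mulrA.
have hE : h = (fun t => (rGamma be)^-1 * (rl_kernel be x t * res c b f t)).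
  by apply/funext => t; rewrite e mulKf// rGamma_neq0.
have hi : cintg mu h by rewrite hE; exact: cintgZl.
rewrite (eq_cI _ e) cIZl//; congr (_ * cI mu _); apply/funext => t.
rewrite /h mem_setE in_itv/= xb andbT /res.
have [ct|tc] := ltP c t; last by rewrite mulr0 if_same.
rewrite (le_lt_trans ac ct) /=; have [tx|xt] := ltP t x.
  by rewrite (lt_trans tx xb) /pw subr_gt0 tx.
by rewrite /pw ltNge subr_le0 xt /= mul0r.
Qed.

Lemma prim_inj f c : a <= c -> c < b -> cintg mu f -> (forall x, ~~ (c < x < b) -> f x = 0) ->
  aeeq c b (prim f) (fun=> 0) -> {ae mu, forall x, f x = 0}.
Proof.
move=> ac cb fi f0 pf0.
have p0 x : c < x < b -> prim f x = 0.
  move=> xI; apply: (ccont_ae_eq pf0 xI); first exact: prim_ccont.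
  exact: ccont_cst.
apply: filterS (prim_ae_cder `]c, b[%classic fi) => x hx.
have [xI|/f0//] := boolP (c < x < b).
apply: (@cder_ae_uniq _ c b (prim f) (fun=> 0) x) => //; first exact: p0.
exact: cder_cst.
Qed.

(** Applying the integral of order 1 - be turns the hypothesis into the vanishing of the primitive
    of [f], whose a.e. derivative is [f]. *)
Lemma J_inj be f c : admissible be -> complex.Re be < 1 -> a <= c -> c < b -> cintg mu f ->
  (forall x, ~~ (c < x < b) -> f x = 0) -> aeeq c b (J be f) (fun=> 0) -> {ae mu, forall x, f x = 0}.
Proof.
move=> ok b1 ac cb fi f0 Jf0.
have J0' : {ae mu, forall x, J be f x = 0}.
  apply: filterS Jf0 => x; have [xI|xn] := boolP (c < x < b); first by rewrite in_itv/= xI; apply.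
  by rewrite (J_supp be ac f0 xn).
have ok1 : admissible (1 - be) by right; rewrite cReB/= subr_gt0.
apply: (prim_inj ac cb fi f0).
have h1 := J_J ok1 ok fi; rewrite subrK in h1.
have h2 := J_ae ok1 (J_intg ok fi).1 (cmeas_cst _ (0 : R[i])) J0'.
apply: filterS2 h1 h2 => x h1 h2; rewrite in_itv/= => /andP[cx xb].
rewrite -J1// -?h1 ?h2 ?J_cst0// => t ta; apply: f0.
by rewrite negb_and -leNgt (le_trans ta ac).
Qed.

End FractionalIntegrals.

(** * The Cauchy problem as an integral equation *)

Section Orders.
Variable R : realType.
Implicit Types (be al : R[i]) (u w y : R -> R[i]).

Lemma is_natC_nat (m : nat) : is_natC (m%:R : R[i]).
Proof. by rewrite /is_natC Re_nat natrK. Qed.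

(** At an integer order the fractional integral has order 0 and is the identity, so one formula, the
    derivative of order [RLorder be], covers both branches of [RLderiv]. *)
Lemma RLderivE (c b : R) be y w : is_natC be || (0 <= complex.Re be) ->
  RLderiv c b be y w <-> nth_deriv c b (RLorder be) (RLint c ((RLorder be)%:R - be) y) w.
Proof.
rewrite /RLderiv /RLorder; case: ifPn => [/eqP e _|_ /= -> //].
by rewrite [X in _ - X]e subrr /RLint eqxx.
Qed.

Lemma nth_deriv0 (c b : R) u w : nth_deriv c b 0 u w <-> aeeq c b u w.
Proof.
rewrite nth_derivE; split=> [[F [h1 h2 _ _]]|h]; first exact: aeeq_trans (aeeq_sym h1) h2.
by exists (fun=> u); split => //; exact: aeeq_all.
Qed.

Lemma admissible_order be : be = 0 \/ 0 < complex.Re be -> admissible ((RLorder be)%:R - be).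
Proof.
move=> h; rewrite /RLorder; case: ifPn => [/eqP {2}->|_]; first by left; rewrite subrr.
right; rewrite cReB Re_nat subr_gt0; exact: truncnS_gt.
Qed.

Section Alpha.
Variable al : R[i].
Local Notation n := (RLorder al).
Hypothesis al0 : 0 < complex.Re al.
Hypothesis hal : ~~ is_natC al -> n%:R - 1 < complex.Re al /\ complex.Re al < n%:R.

Lemma natal : is_natC al -> al = n%:R.
Proof. by rewrite /RLorder => h; rewrite h; exact/eqP. Qed.

Lemma order_Re : n%:R - 1 < complex.Re al /\ complex.Re al <= n%:R.
Proof.
have [/natal e|/hal[h1 h2]] := boolP (is_natC al); last by split => //; exact: ltW.
by have := congr1 (@complex.Re R) e; rewrite Re_nat => ->; split => //; lra.
Qed.

Lemma order_gt0 : (0 < n)%N.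
Proof.
have [_ h] := order_Re; rewrite lt0n; apply: contraTneq h => ->.
by rewrite -ltNge.
Qed.

(** This is the condition for (x-c)^(al-i) to be integrable at c. *)
Lemma order_exp i : (i <= n)%N -> 0 < complex.Re (al - i%:R + 1).
Proof.
move=> i_n; have [h _] := order_Re; rewrite cReD cReB Re_nat /=.
have : (i%:R : R) <= n%:R by rewrite ler_nat.
lra.
Qed.

Lemma order_ok : admissible (n%:R - al) /\ complex.Re (n%:R - al) < 1.
Proof.
rewrite cReB Re_nat; split; last by have [h _] := order_Re; lra.
have [/natal e|/hal[h1 h2]] := boolP (is_natC al); first by left; rewrite -e subrr.
by right; rewrite cReB Re_nat subr_gt0.
Qed.

(** All the data are read on successive derivatives of the single function I^(n-al) y; for k = n it
    is this function itself. *)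
Lemma RLderiv_init_order (c b : R) y w k : (1 <= k <= n)%N ->
  RLderiv c b (al - k%:R) y w <-> nth_deriv c b (n - k) (RLint c (n%:R - al) y) w.
Proof.
move=> /andP[k1 kn]; have [isn|nisn] := boolP (is_natC al).
  have e := natal isn.
  have e1 : al - k%:R = (n - k)%:R by rewrite {1}e natrB.
  have e2 : RLint c (n%:R - al) y = y by rewrite -e subrr /RLint eqxx.
  by rewrite e2 e1 /RLderiv is_natC_nat Re_nat natrK.
have [h1 h2] := hal nisn.
have nn : ~~ is_natC (al - k%:R).
  apply: contra nisn => /eqP h; have -> : al = (Num.truncn (complex.Re (al - k%:R)) + k)%:R.
    by rewrite natrD -h subrK.
  exact: is_natC_nat.
rewrite /RLderiv (negbTE nn) cReB Re_nat.
move: kn; rewrite leq_eqVlt => /orP[/eqP ->|kn].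
  rewrite subr_ge0 leNgt h2 /= subnn nth_deriv0 opprB.
  by split; exact: aeeq_sym.
have k1n : (k.+1%:R : R) <= n%:R by rewrite ler_nat.
rewrite -natr1 in k1n.
have -> : Num.truncn (complex.Re al - k%:R) = (n - k).-1.
  have nk : (0 < n - k)%N by rewrite subn_gt0.
  apply: truncn_def; rewrite prednK// -subn1 (natrB _ nk) (natrB _ (ltnW kn)).
  by apply/andP; split; lra.
rewrite ifT; last by rewrite subr_ge0; lra.
have nk : (0 < n - k)%N by rewrite subn_gt0.
rewrite (prednK nk).
have -> : (n - k)%:R - (al - k%:R) = n%:R - al :> R[i] by rewrite natrB 1?ltnW//; ring.
by [].
Qed.

End Alpha.
End Orders.

(** * Functions given by their data and their derivative of order alpha *)

Section Representation.
Variable R : realType.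
Local Notation mu := (@lebesgue_measure R).
Local Notation X := (measurableTypeR R).
Variables (a b c : R).
Hypotheses (ab : a < b) (ac : a <= c) (cb : c < b).
Implicit Types (be s : R[i]) (y w phi : R -> R[i]) (bb : nat -> R[i]).

Let I := (`]c, b[%classic : set R).
Let K := (`[c, b]%classic : set R).

Lemma KP x : K x <-> c <= x <= b. Proof. by rewrite /K /= in_itv. Qed.
Lemma IP x : I x <-> c < x < b. Proof. by rewrite /I /= in_itv. Qed.
Lemma IK : I `<=` K. Proof. exact: subset_itv_oo_cc. Qed.

Definition supp phi : Prop := forall x, ~~ (c < x < b) -> phi x = 0.

Lemma res_supp phi : supp phi -> res c b phi = phi.
Proof.
by move=> p0; apply/funext => x; rewrite /res; case: ifPn => // /p0.
Qed.

Lemma supp_res phi : supp (res c b phi).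
Proof. by move=> x /negbTE h; rewrite /res h. Qed.

(* For s = alpha - be, V is D^be of the function with data bb and D^alpha y = phi. *)
Definition V bb k s phi x : R[i] :=
  (\sum_(1 <= i < k.+1) bb i * pf b c (s - i%:R + 1) x) + J a b s phi x.

Lemma V_supp bb k s phi : supp phi -> supp (V bb k s phi).
Proof.
move=> p0 x xn; rewrite /V (@J_supp R a b s phi c ac p0 x xn) addr0 big1// => i _.
by rewrite /pf supp_res// mulr0.
Qed.

Lemma Vpow_intg bb k s : (forall i, (i <= k)%N -> 0 < complex.Re (s - i%:R + 1)) ->
  cintg mu (fun x => \sum_(1 <= i < k.+1) bb i * pf b c (s - i%:R + 1) x).
Proof.
move=> h; rewrite (_ : (fun x => _) = (fun x => \sum_(i < k) bb i.+1 * pf b c (s - i.+1%:R + 1) x)); last first.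
  by apply/funext => x; rewrite big_add1/= big_mkord.
by apply: cintg_sum => i; apply: cintgZl; apply: (pf_intg ab) => //; exact: h.
Qed.

Lemma V_intg bb k s phi : admissible s -> (forall i, (i <= k)%N -> 0 < complex.Re (s - i%:R + 1)) ->
  cintg mu phi -> cintg mu (V bb k s phi).
Proof. by move=> os h pi; apply: cintgD; [exact: Vpow_intg|exact: J_intg]. Qed.

(** Fractional integration only raises the order [s]: the powers go through the Beta integral, the
    density through the semigroup law. *)
Lemma J_V bb k s be phi : admissible be -> admissible s ->
  (forall i, (i <= k)%N -> 0 < complex.Re (s - i%:R + 1)) -> cintg mu phi ->
  {ae mu, forall x, J a b be (V bb k s phi) x = V bb k (be + s) phi x}.
Proof.
move=> ob os h pi.
have hs i : i \in index_iota 1 k.+1 -> cintg mu (pf b c (s - i%:R + 1)).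
  by rewrite mem_index_iota ltnS => /andP[_ ik]; apply: (pf_intg ab) => //; exact: h.
have h1 := J_sum (s := index_iota 1 k.+1) ab bb ob hs.
have h2 := JD ab ob (Vpow_intg bb h) (J_intg ab os pi).
apply: filterS3 h1 h2 (J_J ab ob os pi) => x e1 e2 e3.
rewrite {1}/V e2 e1 e3 /V; congr (_ + _); apply: eq_big_seq => i.
rewrite mem_index_iota ltnS => /andP[_ ik]; rewrite J_pf//; last exact: h.
by rewrite !addrA.
Qed.

Lemma V_ae bb k s phi psi : admissible s -> cmeas (phi : X -> _) -> cmeas (psi : X -> _) ->
  {ae mu, forall x, phi x = psi x} -> {ae mu, forall x, V bb k s phi x = V bb k s psi x}.
Proof. by move=> os m1 m2 /(J_ae a b os m1 m2); apply: filterS => x e; rewrite /V e. Qed.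

Lemma ae_aeeq (f g : R -> R[i]) : {ae mu, forall x, f x = g x} -> aeeq c b f g.
Proof. by apply: filterS => x ->. Qed.

Lemma pf_in s x : c < x < b -> pf b c s x = kf s (x - c).
Proof. by move=> h; rewrite /pf res_in. Qed.

Lemma nat_order_exp k i : (i <= k)%N -> 0 < complex.Re (k%:R - i%:R + 1 : R[i]).
Proof.
move=> ik; rewrite cReD cReB !Re_nat/=; have : (i%:R : R) <= k%:R by rewrite ler_nat.
lra.
Qed.

Lemma admissible_nat k : admissible (k%:R : R[i]).
Proof. by case: k => [|k]; [left|right; rewrite Re_nat ltr0n]. Qed.

(* G k stands for the representative of D^(alpha - k) y. *)
Lemma prim_chain bb n phi (G : nat -> R -> R[i]) : supp phi -> cintg mu phi ->
  (forall x, c < x < b -> G 0%N x = phi x) ->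
  (forall k, (k < n)%N -> L1 c b (G k)) ->
  (forall k x, (k < n)%N -> c < x < b -> G k.+1 x = bb k.+1 + prim (res c b (G k)) x) ->
  forall k, (k <= n)%N -> aeeq c b (G k) (V bb k k%:R phi).
Proof.
move=> p0 pi G0 GL GS; elim=> [_|k IH kn].
  apply: aeeq_all => x xI; rewrite /V big_geq// add0r J0; exact: G0.
have {}IH := IH (ltnW kn).
have Gi : cintg mu (res c b (G k)) by apply/L1P; exact: GL.
have Vi : cintg mu (V bb k k%:R phi) by apply: V_intg => //; [exact: admissible_nat|exact: nat_order_exp].
have ok1 : admissible (1 : R[i]) by exact: (admissible_nat 1).
have h1 : {ae mu, forall x, J a b 1 (res c b (G k)) x = J a b 1 (V bb k k%:R phi) x}.
  apply: (J_ae a b ok1 Gi.1 Vi.1); move/aeeqP: IH.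
  by apply: filterS => x ->; rewrite res_supp//; exact: V_supp.
have h2 := J_V bb ok1 (admissible_nat k) (@nat_order_exp k) pi.
apply: filterS2 h1 h2 => x h1 h2; rewrite in_itv/= => xI.
have xb : x < b by case/andP: xI.
rewrite GS// -(@J1 R a b (res c b (G k)))//; last first.
  by move=> t ta; rewrite supp_res// negb_and -leNgt (le_trans ta ac).
rewrite h1 h2 /V [in RHS]big_nat_recr//= addrA nat1r; congr (_ + _).
rewrite addrC; congr (_ + _).
by rewrite subrr add0r pf_in// kf1 ?mulr1// subr_gt0; case/andP: xI.
Qed.

Lemma rder_shift (f : R -> R) x d : rder f (x - c) d -> rder (fun t => f (t - c)) x d.
Proof.
move=> h e e0; have [r r0 hr] := h e e0; exists r => // t tr.
have := hr (t - c); have -> : t - c - (x - c) = t - x by ring.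
exact.
Qed.

Lemma is_derive_imp_rder (f : R -> R) (x d : R) : is_derive x 1 f d -> rder f x d.
Proof. by move=> [h1 h2]; apply: is_derive_rder => //; rewrite derive1E. Qed.

Lemma kf_cder z x : c < x -> cder I (fun t => kf z (t - c)) x (kf (z - 1) (x - c)).
Proof.
move=> cx; have u0 : 0 < x - c by rewrite subr_gt0.
have [d1 d2] := is_derive_kf z u0.
have h : cder I (fun t => rGamma z * cpow (t - c) (z - 1)) x (kf (z - 1) (x - c)).
  apply: rder_cder.
  - exact: (rder_shift (is_derive_imp_rder d1)).
  - exact: (rder_shift (is_derive_imp_rder d2)).
move=> e e0; have [r r0 hr] := h e e0; exists r => // t /[dup] /IP/andP[ct _] tI tr.
rewrite !(kf_pos z) ?subr_gt0//; exact: hr.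
Qed.

Lemma iter_J1_intg k psi : cintg mu psi -> cintg mu (iter k (J a b 1) psi).
Proof. by move=> pi; elim: k => //= k IH; apply: J_intg => //; exact: (admissible_nat 1). Qed.

Lemma iter_J1_supp k psi : supp psi -> supp (iter k (J a b 1) psi).
Proof. by move=> p0; elim: k => //= k IH; exact: J_supp. Qed.

Lemma iter_J1 k psi : cintg mu psi -> {ae mu, forall x, iter k (J a b 1) psi x = J a b k%:R psi x}.
Proof.
move=> pi; elim: k => [|k IH]; first by rewrite J0; apply: filterS (ae_neq 0) => x _.
have ok1 : admissible (1 : R[i]) by exact: (admissible_nat 1).
have h1 := J_ae a b ok1 (iter_J1_intg k pi).1 (J_intg ab (admissible_nat k) pi).1 IH.
apply: filterS2 h1 (J_J ab ok1 (admissible_nat k) pi) => x h1 h2.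
by rewrite /= h1 h2 nat1r.
Qed.

End Representation.

(** * Equivalence of the Cauchy problem with the integral equation *)

Section Equivalence.
Variable R : realType.
Local Notation mu := (@lebesgue_measure R).
Local Notation X := (measurableTypeR R).
Variables (a b c : R).
Hypotheses (ab : a < b) (ac : a <= c) (cb : c < b).
Variables (l : nat) (alpha : R[i]) (alphas : 'I_l.+1 -> R[i]) (aj : 'I_l.+1 -> R -> R[i]).
Local Notation n := (RLorder alpha).
Hypothesis al0 : 0 < complex.Re alpha.
Hypothesis hal : ~~ is_natC alpha -> n%:R - 1 < complex.Re alpha /\ complex.Re alpha < n%:R.
Hypothesis hj : forall j, alphas j = 0 \/ 0 < complex.Re (alphas j).
Hypothesis hlt : forall j, complex.Re (alphas j) < complex.Re alpha.
Implicit Types (be s : R[i]) (g y w phi : R -> R[i]) (bb : nat -> R[i]).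

Let I := (`]c, b[%classic : set R).
Let K := (`[c, b]%classic : set R).

Local Notation V := (V a b c).
Local Notation supp := (supp b c).

Lemma ok_alpha : admissible alpha. Proof. by right. Qed.

Lemma sum_kf_cder bb m s x : c < x ->
  cder I (fun t => \sum_(1 <= k < m) bb k * kf (s - k%:R + 1) (t - c)) x
    (\sum_(1 <= k < m) bb k * kf (s - 1 - k%:R + 1) (x - c)).
Proof.
move=> cx; apply: cder_sum => k _; apply: cderZ.
have -> : s - 1 - k%:R + 1 = s - k%:R + 1 - 1 by ring.
exact: kf_cder.
Qed.

(** I^(m-be) y is a sum of powers plus the m-fold primitive of I^(alpha-be) phi. The primitives lose
    one order at each differentiation, the last one a.e. The powers are differentiated pointwise on
    the open interval, where their exponents may become non-integrable at c. *)
Lemma low_deriv bb be y phi : be = 0 \/ 0 < complex.Re be -> complex.Re be < complex.Re alpha ->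
  supp phi -> cintg mu phi -> L1 c b y -> aeeq c b y (V bb n alpha phi) ->
  RLderiv c b be y (V bb n (alpha - be) phi).
Proof.
move=> hbe bea p0 pi Ly yV.
have okab : admissible (alpha - be) by right; rewrite cReB subr_gt0.
have hn i : (i <= n)%N -> 0 < complex.Re (alpha - i%:R + 1) by move=> h; exact: (order_exp hal).
apply/RLderivE.
  case: hbe => [->|h]; last by rewrite (ltW h) orbT.
  by rewrite -[0]/(0%:R) is_natC_nat.
set m := RLorder be; have okm : admissible (m%:R - be) by exact: admissible_order.
pose psi := J a b (alpha - be) phi.
have psii : cintg mu psi by exact: J_intg.
have psi0 : supp psi by exact: J_supp.
(* The order that remains after [i] differentiations: each one lowers it by 1, and [s m] is alpha -
   be. *)
pose s i : R[i] := m%:R - i%:R + (alpha - be).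
pose P i := iter (m - i) (J a b 1) psi.
pose F i x := \sum_(1 <= k < n.+1) bb k * kf (s i - k%:R + 1) (x - c) + P i x.
have sS i : s i - 1 = s i.+1 by rewrite /s -natr1; ring.
have Pprim i x : (i < m)%N -> c < x < b -> P i x = prim (P i.+1) x.
  move=> im /andP[cx xb]; have e : (m - i = (m - i.+1).+1)%N by rewrite subnSK.
  rewrite /P e /=; apply: J1 => // t ta.
  by apply: (iter_J1_supp ac) => //; rewrite negb_and -leNgt (le_trans ta ac).
have Pi i : cintg mu (P i) by exact: iter_J1_intg.
have FS i x : (i < m)%N -> c < x < b -> cder I (prim (P i.+1)) x (P i.+1 x) -> cder I (F i) x (F i.+1 x).
  move=> im xI h; apply: cderD.
    by rewrite -sS; apply: sum_kf_cder; case/andP: xI.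
  apply: (cder_ext _ _ h); first exact/IP.
  by move=> t /IP tI; rewrite (Pprim i).
apply/nth_derivE; exists F; split.
- have h1 := RLint_J ab okm ac Ly.
  have yi : cintg mu (res c b y) by apply/L1P.
  have Vi : cintg mu (V bb n alpha phi) by exact: (V_intg ab ac bb ok_alpha hn pi).
  have h2 : {ae mu, forall x, J a b (m%:R - be) (res c b y) x = J a b (m%:R - be) (V bb n alpha phi) x}.
    apply: (J_ae a b okm yi.1 Vi.1); move/aeeqP: yV.
    by apply: filterS => x ->; rewrite res_supp//; exact: V_supp.
  have h3 := J_V ab ac bb okm ok_alpha hn pi.
  have h4 := iter_J1 ab m psii.
  have h5 := J_J ab (admissible_nat R m) okab pi.
  apply: aeeq_trans (aeeq_sym h1).
  apply: filterS3 (filterI h2 h3) h4 h5 => x [h2x h3x] h4x h5x.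
  rewrite in_itv/= => xI; rewrite h2x h3x /F /V /P subn0 h4x h5x.
  have e : m%:R - be + alpha = m%:R + (alpha - be) by ring.
  rewrite e; congr (_ + _); apply: eq_bigr => i _.
  by rewrite pf_in// /s subr0.
- apply: aeeq_all => x xI; rewrite /F /V /P subnn; congr (_ + _); apply: eq_bigr => i _.
  by rewrite pf_in// /s subrr add0r.
- move=> i im x /IP xI; have im1 : (i.+1 < m)%N by move: im; case: (m).
  apply: FS => //; first exact: ltnW.
  rewrite (Pprim i.+1)//.
  have xK : c <= x <= b by case/andP: xI => h1 h2; rewrite !ltW.
  apply: (cder_sub (@IK _ b c)); apply: (prim_cder xK) => //.
    by move=> t tI; rewrite (Pprim i.+1).
  exact: prim_ccont.
- move=> m0; apply: filterS (prim_ae_cder I psii) => x hx xI.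
  have m1 : (m.-1 < m)%N by rewrite prednK.
  rewrite -{2}(prednK m0); apply: FS => //; rewrite /P prednK// subnn; exact: hx.
Qed.

Definition reduced g bb phi : Prop := [/\ cintg mu phi, supp phi &
  aeeq c b (fun x => phi x + \sum_j aj j x * V bb n (alpha - alphas j) phi x) g].

(** A reversal of indices: [G k] is integrated k times, whereas [nth_deriv] starts from the most
    integrated function, [G n]. *)
Lemma chain_nth_deriv (G : nat -> R -> R[i]) y k :
  (forall i x, (0 < i < n)%N -> c <= x <= b -> cder K (G i.+1) x (G i x)) ->
  {ae mu, forall x, c < x < b -> cder I (G 1%N) x (G 0%N x)} ->
  aeeq c b (G n) y -> (k <= n)%N -> nth_deriv c b (n - k) y (G k).
Proof.
move=> Gd G1 Gy kn; apply/nth_derivE; exists (fun i => G (n - i)%N).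
have Gd' i x : (k < n - i)%N -> (0 < k)%N || (1 < n - i)%N -> c < x < b ->
    cder I (G (n - i)%N) x (G (n - i.+1)%N x).
  move=> kni h xI; apply: (cder_sub (@IK _ b c)).
  rewrite subnS; set p := (n - i)%N in kni h *.
  have p0 : (0 < p)%N by apply: leq_ltn_trans kni.
  rewrite -{1}(prednK p0); apply: Gd; last by case/andP: xI => h1 h2; rewrite !ltW.
  rewrite prednK//; apply/andP; split; last exact: leq_subr.
  by lia.
split.
- by rewrite subn0.
- by rewrite subKn//; exact: aeeq_all.
- move=> i im x /IP xI; apply: Gd' => //.
    by lia.
  by lia.
- move=> nk; have [k0|k0] := posnP k.
    have -> : (n - (n - k).-1 = 1)%N by lia.
    have -> : (n - (n - k) = 0)%N by lia.
    exact: G1.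
  apply: filterS (ae_neq 0) => x _ xI.
  rewrite -{2}(prednK nk); apply: Gd' => //; last by rewrite k0.
  by lia.
Qed.

Let n0 : (0 < n)%N. Proof. exact: (order_gt0 al0 hal). Qed.
Let hn i : (i <= n)%N -> 0 < complex.Re (alpha - i%:R + 1).
Proof. by move=> h; exact: (order_exp hal). Qed.
Let del : R[i] := n%:R - alpha.
Let okd : admissible del. Proof. exact: (order_ok hal).1. Qed.
Let del1 : complex.Re del < 1. Proof. exact: (order_ok hal).2. Qed.

Lemma Vn_intg bb phi : cintg mu phi -> cintg mu (V bb n alpha phi).
Proof. exact: (V_intg ab ac bb ok_alpha hn). Qed.

Lemma J_del_V bb phi : cintg mu phi ->
  {ae mu, forall x, J a b del (V bb n alpha phi) x = V bb n n%:R phi x}.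
Proof.
by move=> pi; have := J_V ab ac bb okd ok_alpha hn pi; rewrite /del subrK.
Qed.

Lemma reduced_solution g bb phi y : reduced g bb phi -> aeeq c b y (V bb n alpha phi) -> L1 c b y ->
  cauchy_solution alpha alphas aj c b g bb y.
Proof.
move=> [pi p0 eqg] yV Ly.
(* Successive primitives of the density with the data as constants. For k >= 1 the value of [G k] at
   c is then the k-th datum, and [G n] is the representative of I^(n-alpha) y that lies in AC^n. *)
pose G := fix G k := if k is k'.+1 then (fun x => bb k'.+1 + prim (res c b (G k')) x) else phi.
have GcK k x : (forall j, (j <= k)%N -> cintg mu (res c b (G j))) -> ccont K (G k.+1) x.
  by move=> h; apply: ccontD; [exact: ccont_cst|apply: prim_ccont; exact: h].
have GL k : cintg mu (res c b (G k)).
  elim/ltn_ind: k => -[_|k IH]; first by rewrite res_supp.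
  by apply/L1P; apply: cont_L1 => // x _; apply: GcK => j jk; exact: IH.
have GV k : aeeq c b (G k) (V bb k k%:R phi).
  apply: (prim_chain ab ac (n := k) p0 pi (G := G)) => // j _; exact/L1P.
have Gd i x : (0 < i < n)%N -> c <= x <= b -> cder K (G i.+1) x (G i x).
  case: i => // i _ xK; rewrite -[d in cder _ _ _ d]add0r; apply: cderD; first exact: cder_cst.
  apply: (prim_cder xK (GL i.+1)); last exact: GcK.
  by move=> t tI; rewrite res_in.
have G1 : {ae mu, forall x, c < x < b -> cder I (G 1%N) x (G 0%N x)}.
  apply: filterS (prim_ae_cder I (GL 0%N)) => x hx xI.
  rewrite -[G 0%N x]add0r; apply: cderD; first exact: cder_cst.
  by rewrite -[G 0%N x](res_in (c := c) (b := b)).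
have Gn : aeeq c b (G n) (RLint c del y).
  have yi : cintg mu (res c b y) by apply/L1P.
  have h1 := RLint_J ab okd ac Ly.
  have h2 : {ae mu, forall x, J a b del (res c b y) x = J a b del (V bb n alpha phi) x}.
    apply: (J_ae a b okd yi.1 (Vn_intg bb pi).1); move/aeeqP: yV.
    by apply: filterS => x ->; rewrite res_supp//; exact: V_supp.
  apply: aeeq_trans (aeeq_sym h1); apply: aeeq_trans (GV n) _.
  by apply: filterS2 h2 (J_del_V bb pi) => x -> ->.
have Gnth k : (k <= n)%N -> nth_deriv c b (n - k) (RLint c del y) (G k) by exact: chain_nth_deriv.
have Gc k : G k.+1 c = bb k.+1.
  rewrite /= (@prim_left _ c) ?addr0// => t tc.
  by rewrite supp_res// negb_and -leNgt (ltW tc).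
split.
- split=> //; exists (G n) => //; exists (fun i => G (n - i)%N); split.
  + by move=> x _; rewrite subn0.
  + move=> i im; apply/ccontP => x _.
    by rewrite (_ : (n - i = (n - i.+1).+1)%N); [exact: GcK|lia].
  + move=> i im x xK; apply/cderivP.
    rewrite (_ : (n - i = (n - i.+1).+1)%N); last by lia.
    by apply: Gd; [lia|rewrite in_itv in xK].
  + rewrite (_ : (n - n.-1 = 1)%N); last by lia.
    by apply: (@prim_abs_cont R c b (res c b phi) (bb 1%N)); exact: (GL 0%N).
- exists phi, (fun j => V bb n (alpha - alphas j) phi); split => //.
  + apply/RLderivE; first by rewrite (ltW al0) orbT.
    by have := Gnth 0%N (leq0n _); rewrite subn0.
  + by move=> j; exact: low_deriv.
- move=> k k1n; exists (G k).
    by apply/(RLderiv_init_order hal) => //; apply: Gnth; case/andP: k1n.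
  case: k k1n => // k _; apply/ccvg_rightP => e e0.
  have cK : ccont K (G k.+1) c by exact: GcK.
  have [r r0 hr] := cK e e0; exists (Num.min r (b - c)).
    by rewrite lt_min r0 subr_gt0.
  move=> t ct; rewrite -ltrBlDl lt_min => /andP[t1 t2].
  rewrite -(Gc k); apply: hr.
    by apply/KP; rewrite (ltW ct)/=; lra.
  by rewrite gtr0_norm ?subr_gt0.
Qed.

Lemma solution_reduced g bb y : cauchy_solution alpha alphas aj c b g bb y ->
  exists2 phi, reduced g bb phi & aeeq c b y (V bb n alpha phi).
Proof.
move=> [[Ly [F0 [F [FF0 Fc Fd Fac]] F0u]] [w [v [hw hv hg]]] hinit].
set u := RLint c (n%:R - alpha) y in F0u.
have Fu : aeeq c b (F 0%N) u.
  apply: aeeq_trans F0u; apply: aeeq_all => x xI; apply: FF0.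
  by rewrite in_itv/= !ltW//; case/andP: xI.
have {}Fd i x : (i.+1 < n)%N -> c <= x <= b -> cder K (F i) x (F i.+1 x).
  by move=> im xK; apply/cderivP; apply: Fd => //; rewrite in_itv.
have {}Fc i x : (i < n)%N -> c <= x <= b -> ccont K (F i) x.
  by move=> im xK; have /ccontP := Fc i im; apply; exact/KP.
have IK' x : I x -> c <= x <= b by move=> /IP/andP[h1 h2]; rewrite !ltW.
have FdI i x : (i.+1 < n)%N -> I x -> cder I (F i) x (F i.+1 x).
  by move=> im xI; apply: (cder_sub (@IK _ b c)); apply: Fd => //; exact: IK'.
have hw' : nth_deriv c b n u w by apply/RLderivE => //; rewrite (ltW al0) orbT.
have Fw : {ae mu, forall x, c < x < b -> cder I (F n.-1) x (w x)}.
  apply: (nth_deriv_trans (F := F) n0 hw' Fu).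
    by move=> i im x xI; apply: FdI => //; lia.
  by move=> x xI; apply: (ccont_sub (@IK _ b c)); apply: Fc; [lia|exact: IK'].
have [phi [pi p0 phw Fphi]] := ac_prim cb Fac Fw.
pose G k := if k == 0%N then phi else F (n - k)%N.
have Gd i x : (0 < i < n)%N -> c <= x <= b -> cder K (G i.+1) x (G i x).
  case: i => // i im xK; have e : (n - i.+1 = (n - i.+2).+1)%N by rewrite subnSK.
  by rewrite /G/= e; apply: Fd => //; rewrite -e ltn_subrL.
have G1 : {ae mu, forall x, c < x < b -> cder I (G 1%N) x (G 0%N x)}.
  apply: filterS2 Fw phw => x h1 h2 xI; rewrite /G/= subn1 h2 ?in_itv//; exact: h1.
have Gn : aeeq c b (G n) u by rewrite /G subnn; case: eqP => // e; move: n0; rewrite {1}e.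
have Gc k x : (k < n)%N -> c <= x <= b -> ccont K (G k.+1) x.
  by move=> kn xK; rewrite /G/=; apply: Fc => //; rewrite ltn_subrL.
have Gnth k : (k <= n)%N -> nth_deriv c b (n - k) u (G k) by exact: chain_nth_deriv.
have Gb k : (k < n)%N -> G k.+1 c = bb k.+1.
  move=> kn; have [w' hw1 /ccvg_rightP hw2] := hinit k.+1 kn.
  have {}hw1 : nth_deriv c b (n - k.+1) u w' by apply/(RLderiv_init_order hal).
  have e := nth_deriv_uniq (Gnth k.+1 kn) hw1.
  apply: (climr_ae_uniq cb e _ hw2) => d d0.
  have [r r0 hr] := Gc k c kn (introT andP (conj (lexx c) (ltW cb))) d d0.
  exists (Num.min r (b - c)); first by rewrite lt_min r0 subr_gt0.
  move=> t ct; rewrite -ltrBlDl lt_min => /andP[t1 t2]; apply: hr.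
    by apply/KP; rewrite (ltW ct)/=; lra.
  by rewrite gtr0_norm ?subr_gt0.
have GL k : (k <= n)%N -> L1 c b (G k).
  case: k => [|k] kn; first by apply/L1P; rewrite res_supp.
  by apply: cont_L1 => // x; exact: Gc.
have GS k x : (k < n)%N -> c < x < b -> G k.+1 x = bb k.+1 + prim (res c b (G k)) x.
  move=> kn xI; have xK := IK' x (iffRL (IP _ _ _) xI); rewrite -Gb//.
  case: k kn => [|k] kn; first by rewrite [res _ _ _]res_supp// /G/= subn1; exact: Fphi.
  apply: (C1_prim cb) => // t tK; first by apply: Gd.
  by apply: Gc => //; exact: ltnW.
have GV := prim_chain ab ac (n := n) p0 pi (fun _ _ => erefl) (fun k h => GL k (ltnW h)) GS (leqnn n).
have yi : cintg mu (res c b y) by apply/L1P.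
have Vi := Vn_intg bb pi.
have yV : aeeq c b y (V bb n alpha phi).
  apply/aeeqP; rewrite (res_supp (V_supp ac bb n alpha p0)).
  (* [y] and the candidate have the same fractional integral of order n - alpha, whose real part is
     below 1; injectivity identifies them. *)
  pose dif x := res c b y x + (-1) * V bb n alpha phi x.
  have di : cintg mu dif by apply: cintgD => //; exact: cintgZl.
  have d0 x : ~~ (c < x < b) -> dif x = 0.
    by move=> xn; rewrite /dif supp_res// (V_supp ac bb n alpha p0 xn) mulr0 addr0.
  have h := J_inj ab okd del1 ac cb di d0.
  suff /h : aeeq c b (J a b del dif) (fun=> 0).
    by apply: filterS => x; rewrite /dif mulN1r => /subr0_eq.
  have h1 := JD ab okd yi (cintgZl (-1) Vi).
  have h2 := JZ ab (-1) okd Vi.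
  have h3 := J_del_V bb pi.
  have h4 := aeeq_trans (aeeq_sym Gn) GV.
  have h5 := aeeq_trans (aeeq_sym (RLint_J ab okd ac Ly)) h4.
  apply: filterS2 (filterI h1 h2) (filterI h3 h5) => x [h1x h2x] [h3x h5x] xI.
  by rewrite h1x h2x h3x h5x// mulN1r subrr.
exists phi => //; split => //.
have hvV j : aeeq c b (v j) (V bb n (alpha - alphas j) phi).
  have h := low_deriv (hj j) (hlt j) p0 pi Ly yV.
  have ok : is_natC (alphas j) || (0 <= complex.Re (alphas j)).
    by case: (hj j) => [->|/ltW ->]; [rewrite -[0]/(0%:R) is_natC_nat|rewrite orbT].
  by move: (hv j) h => /(RLderivE _ _ _ _ ok) k1 /(RLderivE _ _ _ _ ok); exact: (nth_deriv_uniq k1).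
apply: aeeq_trans hg.
have hvall : {ae mu, forall x, forall j, x \in `]c, b[ -> v j x = V bb n (alpha - alphas j) phi x}.
  have : {ae mu, forall x, forall j, j \in enum 'I_l.+1 -> x \in `]c, b[ -> v j x = V bb n (alpha - alphas j) phi x}.
    elim: (enum _) => [|j s IH]; first by apply: filterS (ae_neq 0) => x _ j.
    apply: filterS2 IH (hvV j) => x h1 h2 k; rewrite inE => /orP[/eqP ->//|]; exact: h1.
  by apply: filterS => x h j; apply: h; rewrite mem_enum.
apply: filterS2 phw hvall => x h1 h2 xI; rewrite h1//; congr (_ + _).
by apply: eq_bigr => j _; rewrite h2.
Qed.

End Equivalence.

(** * The Volterra kernel *)

Section Kernel.
Variable R : realType.
Local Notation mu := (@lebesgue_measure R).
Local Notation X := (measurableTypeR R).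
Variables (a b : R).
Hypothesis ab : a < b.
Variables (l : nat) (aj : 'I_l.+1 -> R -> R[i]) (be : 'I_l.+1 -> R[i]).
Hypothesis haj : forall j, ccontinuous (`[a, b]%classic : set R) (aj j).
Hypothesis be0 : forall j, 0 < complex.Re (be j).
Implicit Types (f g phi : R -> R[i]) (x t xi : R).

Definition vker (x t : X) : R[i] := \sum_j res a b (aj j) x * rl_kernel a b (be j) x t.

Lemma aj_bound j : exists2 M : R, 0 <= M & forall x, a <= x <= b -> n1 (aj j x) <= M.
Proof.
have [h1 h2] := haj j.
have bd (f : R -> R) : {within (`[a, b]%classic : set R), continuous f} ->
    exists2 M : R, 0 <= M & forall x, a <= x <= b -> `|f x| <= M.
  move=> cf; have cn : {within (`[a, b]%classic : set R), continuous (fun x => `|f x|)}.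
    by move=> x; apply: continuous_comp; [exact: cf|exact: norm_continuous].
  have [c _ hc] := EVT_max (ltW ab) cn; by exists `|f c| => // x xI; apply: hc.
have [M M0 hM] := bd _ h1; have [N N0 hN] := bd _ h2; exists (M + N); first exact: addr_ge0.
by move=> x xI; apply: lerD; [exact: hM|exact: hN].
Qed.

Lemma aj_L1 c j : a <= c < b -> L1 c b (aj j).
Proof.
move=> /andP[ac cb]; apply: cont_L1 => // x /andP[cx xb].
have sub : (`[c, b]%classic : set R) `<=` `[a, b]%classic.
  by move=> t /=; rewrite !in_itv/= => /andP[ct ->]; rewrite (le_trans ac ct).
apply: (ccont_sub sub); have /ccontP := haj j; apply; rewrite /= in_itv/= xb andbT.
exact: le_trans cx.
Qed.

Lemma resM c (f g : R -> R[i]) : res c b (fun x => f x * g x) = (fun x => res c b f x * res c b g x).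
Proof. by apply/funext => x; rewrite /res; case: ifP; rewrite ?mul0r. Qed.

Lemma n1_res_aj j : exists2 M : R, 0 <= M & forall c x, a <= c -> n1 (res c b (aj j) x) <= M.
Proof.
have [M M0 hM] := aj_bound j; exists M => // c x ac.
rewrite /res; case: ifPn => [/andP[h1 h2]|_]; last by rewrite n1_0.
by apply: hM; rewrite !ltW// (le_lt_trans ac).
Qed.

Lemma L1_ajM c j f : a <= c < b -> L1 c b f -> L1 c b (fun x => aj j x * f x).
Proof.
move=> /andP[ac cb] /L1P fi; apply/L1P; rewrite resM.
have [M M0 hM] := n1_res_aj j.
have /L1P ai := aj_L1 j (introT andP (conj ac cb)).
apply: (cintg_le (h := fun x : X => M * n1 (res c b f x))).
- exact: cmeasM ai.1 fi.1.
- by move=> x; apply: le_trans (n1M _ _) _; apply: ler_wpM2r; [exact: n1_ge0|exact: hM].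
- by apply: measurable_funM => //; exact: cmeas_n1 fi.1.
- under eq_integral do rewrite EFinM.
  rewrite ge0_integralZl//; last 2 first.
    exact: cmeas_n1E fi.1.
    by move=> x _; rewrite lee_fin n1_ge0.
  by rewrite lte_mul_pinfty ?lee_fin//; exact: fi.2.
Qed.

Lemma kmeas_vker : kmeas vker.
Proof.
apply: cmeas_sum => j; apply: cmeasM; last exact: kmeas_rl_kernel.
have /L1P ai := aj_L1 j (introT andP (conj (lexx a) ab)).
by apply: (@cmeas_comp _ _ R _ _ (fun p : X * X => p.1) (res a b (aj j))); [exact: measurable_fst|exact: ai.1].
Qed.

Lemma vker_out x t : ~~ ((a < t) && (t < x) && (x < b)) -> vker x t = 0.
Proof.
move=> h; apply: big1 => j _; rewrite /rl_kernel; case: ifPn => [/andP[h1 h2]|_]; last by rewrite mulr0.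
by rewrite kf_le0 ?mulr0// subr_le0 leNgt; move: h; rewrite h1 h2 andbT.
Qed.

(** A majorant by a difference kernel, integrable on the line: bounds on the coefficients times
    truncated powers. It controls all columns at once, with and without the exponential weight. *)
Lemma vker_dom : exists h : R -> R, [/\ forall u, 0 <= h u, forall u, u <= 0 -> h u = 0,
  measurable_fun setT (h : X -> R), (\int[mu]_u (h u)%:E < +oo)%E &
  forall x t, n1 (vker x t) <= h (x - t)].
Proof.
have /choice[M hM] : forall j, exists M : R, 0 <= M /\ forall c x, a <= c -> n1 (res c b (aj j) x) <= M.
  by move=> j; have [M M0 h] := n1_res_aj j; exists M.
have mc j : measurable_fun setT (fun u : X => n1 (cut_kf a b (be j) u)).
  exact: cmeas_n1 (cmeas_cut_kf a b (be j)).
exists (fun u => \sum_j M j * n1 (cut_kf a b (be j) u)); split.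
- by move=> u; apply: sumr_ge0 => j _; rewrite mulr_ge0 ?n1_ge0//; exact: (hM j).1.
- move=> u u0; apply: big1 => j _; rewrite /cut_kf; case: ifP => _; rewrite ?kf_le0// n1_0 mulr0//.
- by apply: measurable_sum => j; apply: measurable_funM.
- under eq_integral do rewrite -sumEFin.
  rewrite ge0_integral_sum//; first last.
    by move=> j x _; rewrite lee_fin mulr_ge0 ?n1_ge0//; exact: (hM j).1.
    by move=> j; apply/measurable_EFinP; apply: measurable_funM.
  apply: lte_sum_pinfty => j _; under eq_integral do rewrite EFinM.
  rewrite ge0_integralZl//; last 3 first.
    by apply/measurable_EFinP.
    by move=> x _; rewrite lee_fin n1_ge0.
    by rewrite lee_fin; exact: (hM j).1.
  by rewrite (int_cut_kf ab (be0 j)) -EFinM ltry.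
- move=> x t; apply: le_trans (n1_sum _ _ _) _; apply: ler_sum => j _.
  apply: le_trans (n1M _ _) _; apply: ler_pM; rewrite ?n1_ge0//; first by apply: (hM j).2.
  exact: n1_rl_kernel.
Qed.

(* The exponential weight makes the Volterra operator a contraction. *)
Lemma vker_weight : exists w : R -> R, exists2 w0 : R, 0 < w0 &
  [/\ measurable_fun setT (w : X -> R), forall x, w0 <= w x, forall x, w x <= 1 & COL mu w vker 2^-1].
Proof.
have [h [h0 hneg mh ih hK]] := vker_dom.
have cv : (\int[mu]_u (expR (- (N%:R * u)) * h u)%:E @[N --> \oo] --> 0)%E.
  pose F (N : nat) := fun u : R => (expR (- (N%:R * u)) * h u)%:E.
  have mF N : measurable_fun setT (F N : X -> \bar R).
    apply/measurable_EFinP; apply: measurable_funM => //; apply: measurableT_comp => //.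
    by apply: measurableT_comp => //; apply: measurable_funM.
  have iH : mu.-integrable setT (EFin \o h).
    apply/integrableP; split; first exact/measurable_EFinP.
    by under eq_integral do rewrite /= ger0_norm//.
  have cvF : {ae mu, forall u, setT u -> F ^~ u @ \oo --> (fun=> 0%:E) u}.
    apply: filterS (ae_neq 0) => u _ _; have [u0|u0] := leP u 0.
      by apply: cvg_near_cst; apply: nearW => N; rewrite /F hneg// mulr0.
    apply/fine_cvgP; split; first exact: nearW.
    rewrite -[X in _ --> X](mul0r (h u)); apply: cvgM; last exact: cvg_cst.
    have -> : (fun N => expR (- (N%:R * u))) = (fun N => (expR (- u)) ^+ N).
      by apply/funext => N; rewrite -expRM_natl mulrN.
    apply: cvg_expr; rewrite ger0_norm ?expR_ge0// expR_lt1; lra.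
  have dF : {ae mu, forall u, forall N, setT u -> (`|F N u| <= (EFin \o h) u)%E}.
    apply: filterS (ae_neq 0) => u _ N _; rewrite /F /= lee_fin normrM (ger0_norm (h0 u)).
    have [u0|u0] := leP u 0; first by rewrite hneg// mulr0.
    rewrite ger0_norm ?expR_ge0// -[leRHS]mul1r ler_wpM2r// -expR0 ler_expR oppr_le0.
    by rewrite mulr_ge0// ltW.
  have [_ _ DC] := @dominated_convergence _ X R mu setT measurableT F (fun=> 0%:E) _ mF
    (measurable_cst _) cvF iH dF.
  by rewrite integral0 in DC.
have nb : nbhs (0 : \bar R) [set y : \bar R | (y < (2^-1)%:E)%E].
  by apply: open_nbhs_nbhs; split; [exact: open_ereal_lt_ereal|rewrite /= lte_fin invr_gt0].
have [N _ HN] := cv _ nb; have {HN} := HN N (leqnn N); rewrite /= => HN.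
(* The weight is set to 1 outside (a,b), where the kernel vanishes, so that it stays between a
   positive constant and 1 on the whole line. *)
pose w x := if (a < x) && (x < b) then expR (- (N%:R * (x - a))) else 1.
have mexp : measurable_fun setT (fun u : X => expR (- (N%:R * (u : R)))).
  by apply: measurableT_comp => //; apply: measurableT_comp => //; apply: measurable_funM.
exists w; exists (expR (- (N%:R * (b - a)))); first exact: expR_gt0.
split.
- apply: measurable_fun_ifT => //; first by apply: measurable_and; [exact: measurable_gtb|exact: measurable_ltb].
  apply: measurableT_comp => //; apply: measurableT_comp => //.
  by apply: measurable_funM => //; exact: measurable_funB.
- move=> x; rewrite /w; case: ifPn => [/andP[h1 h2]|_].
    by rewrite ler_expR lerN2 ler_wpM2l// lerB// ltW.
  by rewrite -expR0 ler_expR oppr_le0 mulr_ge0// subr_ge0 ltW.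
- move=> x; rewrite /w; case: ifPn => // /andP[h1 h2].
  by rewrite -expR0 ler_expR oppr_le0 mulr_ge0// subr_ge0 ltW.
move=> t; have w0 x : 0 <= w x by rewrite /w; case: ifP => // _; exact: expR_ge0.
pose G u : R := expR (- (N%:R * u)) * h u.
have G0 u : 0 <= G u by rewrite mulr_ge0 ?expR_ge0.
have mG : measurable_fun setT (fun u : X => (G u)%:E).
  by apply/measurable_EFinP; apply: measurable_funM.
have mgker : measurable_fun setT (fun x : X => (G ((x : R) - t))%:E).
  have ms : measurable_fun setT (fun x : X => (x : R) - t : X) by exact: measurable_funB.
  exact: (measurableT_comp mG ms).
(* Since e^(-N(x-a)) = e^(-N(t-a)) e^(-N(x-t)), the weighted column at [t] is at most [w t] times
   the integral of e^(-Nu) h(u), and [N] was chosen to make that integral smaller than 1/2. *)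
apply: (@le_trans _ _ (\int[mu]_x ((w t)%:E * (G (x - t))%:E))%E).
  apply: ge0_le_integral => //.
  - by move=> x _; rewrite lee_fin mulr_ge0// n1_ge0.
  - apply/measurable_EFinP; apply: measurable_funM; last exact: cmeas_n1 (kmeas2 t kmeas_vker).
    apply: measurable_fun_ifT => //; first by apply: measurable_and; [exact: measurable_gtb|exact: measurable_ltb].
    apply: measurableT_comp => //; apply: measurableT_comp => //.
    by apply: measurable_funM => //; exact: measurable_funB.
  - by apply: emeasurable_funM.
  move=> x _; rewrite -EFinM lee_fin.
  have [/andP[/andP[at_ tx] xb]|nI] := boolP ((a < t) && (t < x) && (x < b)); last first.
    by rewrite vker_out// n1_0 mulr0 mulr_ge0.
  have ax : a < x by lra.
  have tb : t < b by lra.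
  rewrite /w ax xb at_ tb /G mulrA -expRD.
  rewrite (_ : - (N%:R * (t - a)) + - (N%:R * (x - t)) = - (N%:R * (x - a))); last by ring.
  by rewrite ler_wpM2l ?expR_ge0.
rewrite ge0_integralZl//; [|by move=> x _; rewrite lee_fin|by rewrite lee_fin].
rewrite (ge0_integral_shift t mG); last by move=> u; rewrite lee_fin.
by rewrite mulrC EFinM lee_wpmul2l ?lee_fin// ltW.
Qed.

Lemma vker_bnd : exists2 C : R, 0 <= C & bnd mu vker C.
Proof.
have [h [h0 hneg mh ih hK]] := vker_dom.
have hE : (\int[mu]_u (h u)%:E = (fine (\int[mu]_u (h u)%:E))%:E)%E.
  by rewrite fineK// ge0_fin_numE//; apply: integral_ge0 => u _; rewrite lee_fin.
exists (fine (\int[mu]_u (h u)%:E)).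
  by apply: fine_ge0; apply: integral_ge0 => u _; rewrite lee_fin.
move=> t; rewrite -hE.
have mhE : measurable_fun setT (fun u : X => (h u)%:E) by apply/measurable_EFinP.
rewrite -(ge0_integral_shift t mhE); last by move=> u; rewrite lee_fin.
apply: ge0_le_integral => //.
- by move=> x _; rewrite lee_fin n1_ge0.
- exact: cmeas_n1E (kmeas2 t kmeas_vker).
- have ms : measurable_fun setT (fun x : X => (x : R) - t : X) by exact: measurable_funB.
  exact: (measurableT_comp mhE ms).
- by move=> x _; rewrite lee_fin; exact: hK.
Qed.

Local Notation N := (neumann mu vker).

Lemma neu_intg f : cintg mu f -> cintg mu (N f).
Proof.
have [w [w0 w00 [mw wge wle cw]]] := vker_weight.
by apply: (neumann_intg kmeas_vker mw w00 wge wle _ _ cw); lra.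
Qed.

Lemma neu_eq f : cintg mu f -> {ae mu, forall x, N f x + Op mu vker (N f) x = f x}.
Proof.
have [w [w0 w00 [mw wge wle cw]]] := vker_weight; have [C C0 bC] := vker_bnd.
by apply: (neumann_eq kmeas_vker mw w00 wge wle _ _ cw C0 bC); lra.
Qed.

Lemma vker_unique f : cintg mu f -> {ae mu, forall x, f x + Op mu vker f x = 0} -> {ae mu, forall x, f x = 0}.
Proof.
have [w [w0 w00 [mw wge wle cw]]] := vker_weight.
by apply: (volterra_unique kmeas_vker mw w00 wge wle _ _ cw); lra.
Qed.

(** The constant is the same for all [f]; applied to the columns of the Volterra kernel, it bounds
    those of the resolvent kernel uniformly. *)
Lemma neu_bound : exists2 D : R, 0 <= D & forall f, cintg mu f ->
  (\int[mu]_x (n1 (N f x))%:E <= (D * fine (\int[mu]_x (n1 (f x))%:E))%:E)%E.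
Proof.
have [w [w0 w00 [mw wge wle cw]]] := vker_weight.
exists (w0^-1 / (1 - 2^-1)).
  by rewrite divr_ge0 ?invr_ge0 ?(ltW w00)//; lra.
by move=> f; apply: (neumann_n1 kmeas_vker mw w00 wge wle _ _ cw); lra.
Qed.

Lemma iter_intg f k : cintg mu f -> cintg mu (iterOp mu vker k f).
Proof.
have [w [w0 w00 [mw wge wle cw]]] := vker_weight.
by move=> fi; apply: (iterOp_intg kmeas_vker mw w00 wge wle _ cw fi); lra.
Qed.

Lemma neu_partial f : cintg mu f -> exists D : R, forall k,
  (\int[mu]_x (n1 (N f x - \sum_(i < k) (-1) ^+ i * iterOp mu vker i f x))%:E <= (D * 2^-1 ^+ k)%:E)%E.
Proof.
have [w [w0 w00 [mw wge wle cw]]] := vker_weight.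
move=> fi; exists (w0^-1 / (1 - 2^-1) * fine (\int[mu]_x (n1 (f x))%:E)) => k.
by apply: (neumann_partial kmeas_vker mw w00 wge wle _ _ cw fi); lra.
Qed.

Lemma csum0 (z : nat -> R[i]) : (forall k, z k = 0) -> csum z = 0.
Proof.
move=> z0; apply: n1_eq0; apply/le_anti; rewrite n1_ge0 andbT -lee_fin.
have zz : (\sum_(k <oo) (n1 (z k))%:E = 0)%E by apply: eseries0 => k _ _; rewrite z0 n1_0.
have := @csum_tail R z 0%N; rewrite zz big_ord0 subr0 => /(_ (ltry _)) h.
exact: h.
Qed.

Lemma Op_vker_supp c f : a <= c -> supp b c f -> supp b c (Op mu vker f).
Proof.
move=> ac f0 x xn; rewrite /Op -[RHS](cI0 mu); congr cI; apply/funext => t.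
have [/andP[ct tb]|/f0 ->] := boolP (c < t < b); last by rewrite mulr0.
rewrite vker_out ?mul0r//; apply: contra xn => /andP[/andP[_ tx] ->].
by rewrite (lt_trans ct tx).
Qed.

(** Causality: the kernel vanishes unless t < x, so no iterate leaves (c,b). This is why the
    operator based at a also solves the problems based at any c between a and b. *)
Lemma neu_supp c f : a <= c -> supp b c f -> supp b c (N f).
Proof.
move=> ac f0 x xn; apply: csum0 => k.
suff -> : iterOp mu vker k f x = 0 by rewrite mulr0.
by elim: k x xn => [|k IH] x xn; [exact: f0|exact: (Op_vker_supp ac)].
Qed.

End Kernel.

(** * Solutions, series and the Green's function *)

Section Problem.
Variable R : realType.
Local Notation mu := (@lebesgue_measure R).
Local Notation X := (measurableTypeR R).
Variables (a b : R).
Hypothesis ab : a < b.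
Variables (l : nat) (alpha : R[i]) (alphas : 'I_l.+1 -> R[i]) (aj : 'I_l.+1 -> R -> R[i]).
Local Notation n := (RLorder alpha).
Hypothesis al0 : 0 < complex.Re alpha.
Hypothesis hal : ~~ is_natC alpha -> n%:R - 1 < complex.Re alpha /\ complex.Re alpha < n%:R.
Hypothesis hj : forall j, alphas j = 0 \/ 0 < complex.Re (alphas j).
Hypothesis hlt : forall j, complex.Re (alphas j) < complex.Re alpha.
Hypothesis haj : forall j, ccontinuous (`[a, b]%classic : set R) (aj j).
Implicit Types (be s : R[i]) (g y w phi : R -> R[i]) (bb : nat -> R[i]) (c x xi : R).

Let be j := alpha - alphas j.
Let be0 j : 0 < complex.Re (be j).
Proof. by rewrite /be cReB subr_gt0. Qed.
Let admissible_be j : admissible (be j). Proof. by right. Qed.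
Let okal : admissible alpha. Proof. by right. Qed.

Local Notation K := (vker a b aj be).
Local Notation N := (neumann mu K).
Local Notation coef c i x := (\sum_j coef_power alpha alphas aj c i j x).
Local Notation red c := (reduced a b c alpha alphas aj).
Local Notation sol c := (cauchy_solution alpha alphas aj c b).

Let n0 : (0 < n)%N. Proof. exact: (order_gt0 al0 hal). Qed.
Let hn i : (i <= n)%N -> 0 < complex.Re (alpha - i%:R + 1).
Proof. by move=> h; exact: (order_exp hal). Qed.

Lemma ae_all_fin (I : finType) (P : I -> R -> Prop) :
  (forall i, {ae mu, forall x, P i x}) -> {ae mu, forall x, forall i, P i x}.
Proof.
move=> h; have : {ae mu, forall x, forall i, i \in enum I -> P i x}.
  elim: (enum I) => [|i s IH]; first by apply: filterS (ae_neq 0) => x _ i.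
  apply: filterS2 IH (h i) => x h1 h2 k; rewrite inE => /orP[/eqP ->//|]; exact: h1.
by apply: filterS => x k i; apply: k; rewrite mem_enum.
Qed.

Lemma vker_op c phi : a <= c -> cintg mu phi ->
  aeeq c b (Op mu K phi) (fun x => \sum_j aj j x * J a b (be j) phi x).
Proof.
move=> ac pi.
have h j := ae_Op_intg (kmeas_rl_kernel a b (be j)) (bnd_rl_kernel ab (be0 j)) (rl_bound_ge0 a b (be j)) pi.
apply: filterS (ae_all_fin h) => x hx; rewrite in_itv/= => /andP[cx xb].
rewrite /Op /vker.
rewrite (eq_cI mu (g := fun t => \sum_j res a b (aj j) x * (rl_kernel a b (be j) x t * phi t))); last first.
  by move=> t; rewrite mulr_suml; apply: eq_bigr => j _; rewrite mulrA.
rewrite cI_sum; last by move=> j; apply: cintgZl; exact: hx.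
apply: eq_bigr => j _; rewrite cIZl; last exact: hx.
by rewrite (JE a b phi (be0 j)) res_in// xb (le_lt_trans ac cx).
Qed.

Lemma coef_powerE c i j x : c < x < b ->
  coef_power alpha alphas aj c i j x = aj j x * pf b c (be j - i%:R + 1) x.
Proof.
move=> xI; rewrite pf_in// kf_pos ?subr_gt0//; last by case/andP: xI.
by rewrite addrK /coef_power [cpow _ _ * _]mulrC.
Qed.

(** Exchanging the sums over i and j gathers the data into the coefficient functions and leaves the
    Volterra operator acting on the density alone. *)
Lemma reduced_eq c g bb phi : a <= c -> cintg mu phi -> supp b c phi ->
  red c g bb phi <->
  aeeq c b (fun x => phi x + Op mu K phi x + \sum_(1 <= i < n.+1) bb i * coef c i x) g.
Proof.
move=> ac pi p0.
have e : aeeq c b (fun x => phi x + Op mu K phi x + \sum_(1 <= i < n.+1) bb i * coef c i x)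
    (fun x => phi x + \sum_j aj j x * V a b c bb n (alpha - alphas j) phi x).
  apply: filterS (vker_op ac pi) => x h xI; rewrite h//; move: xI; rewrite in_itv/= => xI.
  rewrite -addrA; congr (_ + _).
  transitivity (\sum_j (aj j x * (\sum_(1 <= i < n.+1) bb i * pf b c (be j - i%:R + 1) x) +
      aj j x * J a b (be j) phi x)); last by apply: eq_bigr => j _; rewrite -mulrDr.
  rewrite big_split/= addrC; congr (_ + _).
  under [RHS]eq_bigr do rewrite mulr_sumr.
  rewrite exchange_big/=; apply: eq_bigr => i _; rewrite mulr_sumr; apply: eq_bigr => j _.
  by rewrite coef_powerE// mulrCA.
split=> [[_ _ h]|h]; first exact: aeeq_trans e h.
by split => //; exact: aeeq_trans (aeeq_sym e) h.
Qed.

Lemma Volterra_zero c d : a <= c -> cintg mu d -> supp b c d ->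
  aeeq c b (fun x => d x + Op mu K d x) (fun=> 0) -> {ae mu, forall x, d x = 0}.
Proof.
move=> ac di d0 h; apply: (vker_unique ab haj be0 di).
apply: filterS h => x hx; have [xI|xn] := boolP (c < x < b).
  by apply: hx; rewrite in_itv.
by rewrite d0// add0r (Op_vker_supp aj be ac d0).
Qed.

Lemma Op_vker_D f g : cintg mu f -> cintg mu g ->
  {ae mu, forall x, Op mu K (fun t => f t + g t) x = Op mu K f x + Op mu K g x}.
Proof.
have [C C0 bC] := vker_bnd ab haj be0.
exact: (ae_OpD (kmeas_vker ab be haj) bC C0).
Qed.

Lemma Op_vker_Z z f : cintg mu f -> {ae mu, forall x, Op mu K (fun t => z * f t) x = z * Op mu K f x}.
Proof.
have [C C0 bC] := vker_bnd ab haj be0.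
exact: (ae_OpZ z (kmeas_vker ab be haj) bC C0).
Qed.

Lemma V_ae_eq c bb phi psi : cintg mu phi -> cintg mu psi -> {ae mu, forall x, phi x = psi x} ->
  aeeq c b (V a b c bb n alpha phi) (V a b c bb n alpha psi).
Proof. by move=> pi si h; apply: ae_aeeq; apply: V_ae => //; [exact: pi.1|exact: si.1]. Qed.

Lemma Volterra_eq c (phi psi f : R -> R[i]) : a <= c -> cintg mu phi -> cintg mu psi ->
  supp b c phi -> supp b c psi ->
  aeeq c b (fun x => phi x + Op mu K phi x) f -> aeeq c b (fun x => psi x + Op mu K psi x) f ->
  {ae mu, forall x, phi x = psi x}.
Proof.
move=> ac pi si p0 s0 h1 h2.
pose d x := phi x + (-1) * psi x.
have di : cintg mu d by apply: cintgD => //; exact: cintgZl.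
have d0 : supp b c d by move=> x xn; rewrite /d p0// s0// mulr0 addr0.
suff : {ae mu, forall x, d x = 0}.
  by apply: filterS => x; rewrite /d mulN1r => /subr0_eq.
apply: (Volterra_zero ac di d0).
have e1 := Op_vker_D pi (cintgZl (-1) si); have e2 := Op_vker_Z (-1) si.
apply: filterS2 (filterI e1 e2) (filterI h1 h2) => x [e1x e2x] [h1x h2x] xI.
rewrite e1x e2x /d addrACA -mulrDr h2x// h1x// mulN1r subrr//.
Qed.

Lemma uniqueness c g bb y y' : a <= c < b -> sol c g bb y -> sol c g bb y' -> aeeq c b y y'.
Proof.
move=> /andP[ac cb] /(solution_reduced ab ac cb al0 hal hj hlt)[phi [pi p0 h] yV].
move=> /(solution_reduced ab ac cb al0 hal hj hlt)[psi [si s0 k] yV'].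
apply: aeeq_trans yV (aeeq_trans _ (aeeq_sym yV')).
apply: V_ae_eq => //.
have h' : red c g bb phi by []. have k' : red c g bb psi by [].
move: h' k' => /(reduced_eq _ _ ac pi p0) h' /(reduced_eq _ _ ac si s0) k'.
apply: (Volterra_eq (f := fun x => g x - \sum_(1 <= i < n.+1) bb i * coef c i x) ac) => //.
  by apply: filterS h' => x hx xI; rewrite -hx// addrK.
by apply: filterS k' => x hx xI; rewrite -hx// addrK.
Qed.

Lemma neu_reduced c g bb : a <= c < b ->
  L1 c b (fun x => g x - \sum_(1 <= i < n.+1) bb i * coef c i x) ->
  red c g bb (N (res c b (fun x => g x - \sum_(1 <= i < n.+1) bb i * coef c i x))).
Proof.
move=> /andP[ac cb] /L1P Li; set f := res _ _ _ in Li *.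
have Nf0 : supp b c (N f) by apply: neu_supp => //; exact: supp_res.
apply/(reduced_eq _ _ ac (neu_intg ab haj be0 Li) Nf0).
apply: filterS (neu_eq ab haj be0 Li) => x -> ; rewrite in_itv/= => xI.
by rewrite /f res_in// subrK.
Qed.

Lemma V_solution c g bb phi : a <= c < b -> red c g bb phi -> sol c g bb (V a b c bb n alpha phi).
Proof.
move=> /andP[ac cb] h; have [pi p0 _] := h.
apply: (reduced_solution ab ac cb al0 hal hj hlt h) => //; first exact: aeeq_all.
apply/L1P; rewrite (res_supp (V_supp ac bb n alpha p0)).
exact: (V_intg ab ac bb okal hn pi).
Qed.

Lemma existence c g bb : a <= c < b ->
  L1 c b (fun x => g x - \sum_(1 <= i < n.+1) bb i * coef c i x) -> exists y, sol c g bb y.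
Proof. by move=> cI h; eexists; apply: (V_solution cI); exact: neu_reduced. Qed.

Lemma L1_cst0 c : L1 c b (fun=> 0).
Proof.
apply/L1P; have -> : res c b (fun=> 0 : R[i]) = fun=> 0 by apply/funext => x; rewrite /res if_same.
exact: cintg0.
Qed.

Lemma L1_D c f g : L1 c b f -> L1 c b g -> L1 c b (fun x => f x + g x).
Proof.
move=> /L1P fi /L1P gi; apply/L1P; have := cintgD fi gi; congr cintg.
by apply/funext => x; rewrite /res; case: ifP; rewrite ?addr0.
Qed.

Lemma L1_Z c z f : L1 c b f -> L1 c b (fun x => z * f x).
Proof.
move=> /L1P fi; apply/L1P; have := cintgZl z fi; congr cintg.
by apply/funext => x; rewrite /res; case: ifP; rewrite ?mulr0.
Qed.

Lemma L1_sum c (I : eqType) (s : seq I) (F : I -> R -> R[i]) :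
  (forall i, i \in s -> L1 c b (F i)) -> L1 c b (fun x => \sum_(i <- s) F i x).
Proof.
elim: s => [|i s IH] h.
  by under eq_fun do rewrite big_nil; exact: L1_cst0.
under eq_fun do rewrite big_cons.
apply: L1_D; first by apply: h; rewrite mem_head.
by apply: IH => j js; apply: h; rewrite inE js orbT.
Qed.

(** [L1] asks for measurability of the function [RLint] itself and not of a representative, so the
    a.e. equality with [J] does not provide it; a parameter integral does. *)
Lemma RLint_cmeas c z f : admissible z -> c < b -> L1 c b f -> cmeas (res c b (RLint c z f) : X -> _).
Proof.
case=> [->|z0] cb /L1P fi; first by rewrite /RLint eqxx; exact: fi.1.
pose F (p : X * X) : R[i] := pw z ((p.1 : R) - (p.2 : R)) * res c b f p.2.
have mF : cmeas F.
  apply: cmeasM; first exact: (kmeas_convk (cmeas_pw z)).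
  exact: (@cmeas_comp _ _ R _ _ (fun p : X * X => p.2) (res c b f) measurable_snd fi.1).
have -> : res c b (RLint c z f) = (fun x => if (c < x) && (x < b) then rGamma z * cI mu (fun t => F (x, t)) else 0).
  apply/funext => x; rewrite /res; case: ifPn => // /andP[cx xb].
  rewrite /RLint (negbTE (Re_gt0_neq0 z0)) cint_cI; congr (_ * _); congr cI; apply/funext => t.
  rewrite /F /= mem_setE in_itv/= /res.
  have [ct|tc] := ltP c t; last by rewrite mulr0.
  have [tx|xt] /= := ltP t x; first by rewrite (lt_trans tx xb) /pw subr_gt0 tx.
  by rewrite /pw ltNge subr_le0 xt /= mul0r.
apply: cmeas_if; [|apply: cmeasM; [exact: cmeas_cst|exact: cmeas_param]|exact: cmeas_cst].
by apply: measurable_and; [exact: measurable_gtb|exact: measurable_ltb].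
Qed.

Lemma RLint_L1 c z f : admissible z -> a <= c < b -> L1 c b f -> L1 c b (RLint c z f).
Proof.
move=> ok /andP[ac cb] fi; apply/L1P; move/L1P: (fi) => fi'.
apply: (ae_cintg (RLint_cmeas ok cb fi) (J_intg ab ok fi')).
have h := RLint_J ab ok ac fi; move/aeeqP: h; apply: filterS => x ->.
by rewrite res_supp//; apply: J_supp => //; exact: supp_res.
Qed.

Lemma sum_op_L1 c phi : a <= c < b -> L1 c b phi -> L1 c b (sum_op alpha alphas aj c phi).
Proof.
move=> acb Lp; apply: L1_sum => j _; apply: (L1_ajM ab haj j acb).
exact: (RLint_L1 (admissible_be j) acb Lp).
Qed.

Lemma sum_op_ae c phi : a <= c < b -> L1 c b phi ->
  {ae mu, forall x, res c b (sum_op alpha alphas aj c phi) x = Op mu K (res c b phi) x}.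
Proof.
move=> /andP[ac cb] Lp; have /L1P pi := Lp.
have h j := RLint_J ab (admissible_be j) ac Lp.
apply: filterS2 (ae_all_fin h) (vker_op ac pi) => x hx; rewrite in_itv/= => kx.
rewrite /res -/(res c b phi); case: ifPn => xI.
  by rewrite kx// /sum_op; apply: eq_bigr => j _; rewrite hx ?in_itv.
by rewrite (Op_vker_supp aj be ac (supp_res _) xI).
Qed.

Lemma iter_sum_op c f k : a <= c < b -> L1 c b f -> L1 c b (iter k (sum_op alpha alphas aj c) f) /\
  {ae mu, forall x, res c b (iter k (sum_op alpha alphas aj c) f) x = iterOp mu K k (res c b f) x}.
Proof.
move=> acb Lf; elim: k => [|k [L IH]]; first by split=> //; apply: filterS (ae_neq 0) => x _.
split; first exact: sum_op_L1.
have /L1P fi := Lf; have /L1P ki := L.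
apply: filterS (sum_op_ae acb L) => x /= ->.
apply: (Op_ae_eq _ (kmeas_vker ab be haj) ki.1 (iter_intg ab haj be0 k fi).1 IH).
Qed.

Lemma power_funE c i x : c < x < b -> power_fun alpha c i x = pf b c (alpha - i%:R + 1) x.
Proof.
move=> xI; rewrite pf_in// kf_pos ?subr_gt0//; last by case/andP: xI.
by rewrite addrK /power_fun mulrC.
Qed.

Lemma delta_sym i : (fun k : nat => (i == k)%:R : R[i]) = fun k => (k == i)%:R.
Proof. by apply/funext => k; rewrite eq_sym. Qed.

Lemma sum_delta (F : nat -> R[i]) i : (1 <= i <= n)%N ->
  \sum_(1 <= k < n.+1) (k == i)%:R * F k = F i.
Proof.
move=> /andP[i1 i_n]; rewrite (bigD1_seq i)/= ?iota_uniq//; last by rewrite mem_index_iota i1.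
rewrite eqxx mul1r big1 ?addr0// => k /negbTE ->; exact: mul0r.
Qed.

Lemma V_delta c i phi x : (1 <= i <= n)%N ->
  V a b c (fun k => (k == i)%:R) n alpha phi x = pf b c (alpha - i%:R + 1) x + J a b alpha phi x.
Proof. by move=> hi; rewrite /V sum_delta. Qed.

(** The density of a solution with unit datum at index i solves the Volterra equation with
    right-hand side minus the coefficient function, hence is minus its Neumann series. The base
    point is general, to cover both the fundamental system and the Green's function. *)
Lemma canonical_phi c i Y : a <= c < b -> (1 <= i <= n)%N ->
  (forall j, L1 c b (coef_power alpha alphas aj c i j)) ->
  sol c (fun=> 0) (fun k => (k == i)%:R) Y ->
  aeeq c b (fun x => Y x - power_fun alpha c i x)
    (J a b alpha (fun x => (-1) * N (res c b (fun x => coef c i x)) x)).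
Proof.
move=> acb hi Lc; have /andP[ac cb] := acb.
move=> /(solution_reduced ab ac cb al0 hal hj hlt)[phi [pi p0 h] yV].
have h' : red c (fun=> 0) (fun k => (k == i)%:R) phi by [].
move: h' => /(reduced_eq _ _ ac pi p0) h'.
have /L1P fi : L1 c b (fun x => coef c i x) by apply: L1_sum => j _; exact: Lc.
set f := res c b _ in fi *.
have Ni := neu_intg ab haj be0 fi.
have Ni' : cintg mu (fun x => (-1) * N f x) by exact: cintgZl.
have Ns : supp b c (N f) by apply: neu_supp => //; exact: supp_res.
have Ns' : supp b c (fun x => (-1) * N f x) by move=> x xn; rewrite Ns// mulr0.
have e : {ae mu, forall x, phi x = (-1) * N f x}.
  apply: (Volterra_eq (f := fun x => (-1) * f x) ac pi Ni' p0 Ns').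
    apply: filterS h' => x hx; rewrite in_itv/= => xI.
    move: (hx); rewrite in_itv/= sum_delta// => /(_ xI) e.
    by rewrite /f res_in// mulN1r; apply/eqP; rewrite -addr_eq0 e.
  apply: filterS2 (Op_vker_Z (-1) Ni) (neu_eq ab haj be0 fi) => x h1 h2 _.
  by rewrite h1 -mulrDr h2.
have e2 := J_ae a b okal pi.1 Ni'.1 e.
apply: filterS2 yV e2 => x h1 h2; rewrite in_itv/= => xI.
by rewrite h1 ?in_itv// V_delta// power_funE// -h2 addrAC subrr add0r.
Qed.

Lemma measurable_Re_norm (f : X -> R[i]) : cmeas f -> measurable_fun setT (fun x => complex.Re `|f x|).
Proof.
move=> [mR mI]; rewrite (_ : (fun x => _) = (fun x => Num.sqrt (complex.Re (f x) ^+ 2 + complex.Im (f x) ^+ 2))); last first.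
  by apply/funext => x; rewrite normc_def.
apply: (@measurableT_comp _ _ _ _ _ _ (@Num.sqrt R)).
  by apply: continuous_measurable_fun; exact: sqrt_continuous.
by apply: measurable_funD; apply: measurable_funX.
Qed.

(** The M-th remainder is, up to sign, the fractional integral of order alpha of the remainder of
    the Neumann series. Its L1 norm is at most the norm of that integral times a constant over
    2^M. *)
Lemma series_conv c i Y : a <= c < b -> (1 <= i <= n)%N ->
  (forall j, L1 c b (coef_power alpha alphas aj c i j)) ->
  sol c (fun=> 0) (fun k => (k == i)%:R) Y ->
  L1_series c b (series_term alpha alphas aj c i) (fun x => Y x - power_fun alpha c i x).
Proof.
move=> acb hi Lc hY; have /andP[ac cb] := acb.
have YJ := canonical_phi acb hi Lc hY.
have Lf : L1 c b (fun x => coef c i x) by apply: L1_sum => j _; exact: Lc.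
have /L1P fi := Lf.
set f := res c b _ in fi YJ.
have Lit k : L1 c b (iter k (sum_op alpha alphas aj c) (fun x => coef c i x)) := (iter_sum_op k acb Lf).1.
have Lu k : L1 c b (series_term alpha alphas aj c i k) by apply: L1_Z; exact: RLint_L1.
have Ls : L1 c b (fun x => Y x - power_fun alpha c i x).
  have [[LY _] _ _] := hY.
  have /andP[_ i_n] := hi.
  have Lp : L1 c b (power_fun alpha c i).
    apply/L1P; have := pf_intg ab ac (hn i_n); congr cintg.
    by apply/funext => x; rewrite [RHS]/res; case: ifPn => xI; rewrite ?power_funE// /pf res_out.
  have := L1_D LY (L1_Z (-1) Lp); congr L1; apply/funext => x; by rewrite mulN1r.
split => //.
pose P M x := N f x - \sum_(k < M) (-1) ^+ k * iterOp mu K k f x.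
have Ni := neu_intg ab haj be0 fi.
have iti k : cintg mu (iterOp mu K k f) := iter_intg ab haj be0 k fi.
have si M : cintg mu (fun x => \sum_(k < M) (-1) ^+ k * iterOp mu K k f x).
  by apply: cintg_sum => k; apply: cintgZl.
have Pi M : cintg mu (P M) by exact: cintgB.
have uJ M : aeeq c b (fun x => (Y x - power_fun alpha c i x) - \sum_(k < M) series_term alpha alphas aj c i k x)
    (fun x => (-1) * J a b alpha (P M) x).
  have e1 := JZ ab (-1) okal Ni.
  have e2 : {ae mu, forall x, J a b alpha (P M) x = J a b alpha (N f) x -
      J a b alpha (fun x => \sum_(k < M) (-1) ^+ k * iterOp mu K k f x) x}.
    have h1 := JD ab okal Ni (cintgN (si M)); have h2 := JZ ab (-1) okal (si M).
    apply: filterS2 h1 h2 => x h1x h2x; rewrite /P h1x; congr (_ + _).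
    rewrite -[RHS]mulN1r -h2x; congr (J a b alpha _ x); by apply/funext => t; rewrite mulN1r.
  have e3 := J_sum (s := index_enum 'I_M) ab (fun k => (-1) ^+ k) okal (fun k _ => iti k).
  have e4 k : aeeq c b (RLint c alpha (iter k (sum_op alpha alphas aj c) (fun x => coef c i x)))
      (J a b alpha (iterOp mu K k f)).
    apply: aeeq_trans (RLint_J ab okal ac (Lit k)) _; apply: ae_aeeq.
    have /L1P Li := Lit k.
    exact: J_ae okal Li.1 (iti k).1 (iter_sum_op k acb Lf).2.
  have e5 := ae_all_fin (fun k : 'I_M => e4 k).
  apply: filterS3 (filterI e1 e2) (filterI e3 e5) YJ => x [e1x e2x] [e3x e5x] h xI.
  rewrite h// e1x e2x e3x mulrBr; congr (_ + _).
  rewrite mulN1r opprK -sumrN; apply: eq_bigr => k _.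
  by rewrite /series_term e5x// exprS mulN1r mulNr opprK.
have [D hD] := neu_partial ab haj be0 fi.
pose B M : R := rl_bound a b alpha * (D * 2^-1 ^+ M).
have B0 : (B M)%:E @[M --> \oo] --> (0%:E : \bar R).
  apply/fine_cvgP; split; first exact: nearW.
  have -> : (0 : R) = rl_bound a b alpha * (D * 0) by rewrite !mulr0.
  apply: cvgM; [exact: cvg_cst|apply: cvgM; [exact: cvg_cst|]].
  by apply: cvg_expr; rewrite ger0_norm//; lra.
apply: (squeeze_cvge _ (cvg_cst (0%:E : \bar R)) B0).
apply: nearW => M; apply/andP; split.
  by apply: integral_ge0 => x _; rewrite lee_fin Re_norm_ge0.
have Ldif : L1 c b (fun x => (Y x - power_fun alpha c i x) - \sum_(k < M) series_term alpha alphas aj c i k x).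
  have h : L1 c b (fun x => \sum_(k < M) series_term alpha alphas aj c i k x) by apply: L1_sum.
  have := L1_D Ls (L1_Z (-1) h); congr L1; apply/funext => x; by rewrite mulN1r.
have /L1P di := Ldif.
have mI : measurable (`]c, b[%classic : set X) by exact: measurable_itv.
rewrite integral_mkcond.
apply: (@le_trans _ _ (\int[mu]_x (n1 (J a b alpha (P M) x))%:E)%E).
  have e : ((fun x => (complex.Re `|Y x - power_fun alpha c i x - \sum_(k < M) series_term alpha alphas aj c i k x|)%:E) \_ `]c, b[)
     = (fun x => (complex.Re `|res c b (fun x => Y x - power_fun alpha c i x - \sum_(k < M) series_term alpha alphas aj c i k x) x|)%:E).
    have z0 : complex.Re `|0 : R[i]| = 0 by rewrite normr0.
    apply/funext => x; rewrite /patch mem_setE in_itv/= /res; case: ifP => // _.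
    exact: (congr1 EFin (esym z0)).
  rewrite e; apply: ae_ge0_le_integral => //.
  - by move=> x _; rewrite lee_fin Re_norm_ge0.
  - by apply/measurable_EFinP; exact: measurable_Re_norm di.1.
  - by move=> x _; rewrite lee_fin n1_ge0.
  - exact: cmeas_n1E (J_intg ab okal (Pi M)).1.
  apply: filterS (uJ M) => x hx _; rewrite lee_fin /res; case: ifPn => [xI|_].
    rewrite hx ?in_itv// mulN1r; apply: le_trans (Re_norm_le _) _; by rewrite n1N.
  by rewrite normr0 n1_ge0.
rewrite (JE a b (P M) al0).
apply: le_trans (Op_n1 (kmeas_rl_kernel a b alpha) (bnd_rl_kernel ab al0) (rl_bound_ge0 a b alpha) (Pi M).1) _.
by rewrite /B EFinM; apply: lee_wpmul2l; [rewrite lee_fin rl_bound_ge0|exact: hD].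
Qed.

Lemma aeeq_L1 c f g : (forall x, c < x < b -> f x = g x) -> L1 c b f -> L1 c b g.
Proof.
move=> fg /L1P fi; apply/L1P; rewrite (_ : res c b g = res c b f)//.
by apply/funext => x; rewrite /res; case: ifP => // xI; rewrite fg.
Qed.

(** At index 1 the exponent alpha - alpha_j - 1 has real part above -1, so the Green's function
    series has integrable coefficients at every base point. *)
Lemma coef1_L1 c j : a <= c < b -> L1 c b (coef_power alpha alphas aj c 1 j).
Proof.
move=> acb; have /andP[ac cb] := acb.
apply: (aeeq_L1 (f := fun x => aj j x * pf b c (be j - 1%:R + 1) x)).
  by move=> x xI; rewrite coef_powerE.
apply: (L1_ajM ab haj j acb); apply/L1P; rewrite res_supp; last exact: supp_res.
by rewrite subrK; exact: (pf_intg ab ac (be0 j)).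
Qed.

(** With s = alpha - alpha_j - i nonzero, lowering the index multiplies the function by the bounded
    factor (x-a)/s, because 1/Gamma(s) = s/Gamma(s+1). At s = 0 the function of index i+1 is zero
    and tells nothing, but that of index i is the continuous coefficient itself. *)
Lemma coef_L1_down i j : L1 a b (coef_power alpha alphas aj a i.+1 j) ->
  L1 a b (coef_power alpha alphas aj a i j).
Proof.
pose s := be j - i%:R; have abI : a <= a < b by rewrite lexx.
have e1 x : a < x < b -> coef_power alpha alphas aj a i j x = aj j x * (cpow (x - a) s * rGamma (s + 1)) by [].
have e2 x : a < x < b -> coef_power alpha alphas aj a i.+1 j x = aj j x * (cpow (x - a) (s - 1) * rGamma s).
  move=> xI; rewrite /coef_power; have -> : alpha - alphas j - i.+1%:R = s - 1 by rewrite /s /be -natr1; ring.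
  by rewrite subrK.
have [s0|s0] := eqVneq s 0 => L.
  apply: aeeq_L1 (aj_L1 haj j abI) => x xI.
  rewrite e1// s0 add0r rGamma1 cpow0 !mulr1//.
have cu : forall i0 : 'I_1, ccontinuous (`[a, b]%classic : set R) ((fun (_ : 'I_1) x => (x - a)%:C) i0).
  move=> _; split; rewrite /reals /imags /=.
    by apply: continuous_subspaceT => x; apply: cvgB; [exact: cvg_id|exact: cvg_cst].
  by apply: continuous_subspaceT => x; exact: cvg_cst.
have h := L1_Z (s^-1) (L1_ajM ab cu ord0 abI L).
apply: aeeq_L1 h => x xI; rewrite e1// e2// [rGamma s]rGammaS.
have xa : 0 < x - a by rewrite subr_gt0; case/andP: xI.
have -> : cpow (x - a) s = (x - a)%:C * cpow (x - a) (s - 1).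
  exact: cpowS.
by field.
Qed.

Lemma coef_L1 k0 i : (1 <= i <= k0)%N -> (forall j, L1 a b (coef_power alpha alphas aj a k0 j)) ->
  forall j, L1 a b (coef_power alpha alphas aj a i j).
Proof.
move=> /andP[_ ik] L j; rewrite -(subKn ik); elim: (k0 - i)%N => [|m IH]; first by rewrite subn0.
have [mk|km] := ltnP m k0.
  by apply: coef_L1_down; rewrite subnSK.
have e : (k0 - m.+1 = k0 - m)%N.
  by apply/eqP; rewrite (eqP km) subn_eq0 leqW.
by rewrite e.
Qed.

(** * Resolvent kernel, Green's function and its integral against the right-hand side *)

Definition rker (x xi : X) : R[i] := (-1) * N (K ^~ xi) x.
Definition gker (x xi : X) : R[i] := rl_kernel a b alpha x xi + Op mu (rl_kernel a b alpha) (rker ^~ xi) x.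

Let mK : kmeas K := kmeas_vker ab be haj.

Lemma K_intg xi : cintg mu (K ^~ xi).
Proof.
have [C C0 bC] := vker_bnd ab haj be0.
by split; [exact: (kmeas2 xi mK)|apply: le_lt_trans (bC xi) _; exact: ltry].
Qed.

Lemma kmeas_rker : kmeas rker.
Proof. by apply: cmeasM; [exact: cmeas_cst|exact: kmeas_neumann]. Qed.

Lemma rker_intg xi : cintg mu (rker ^~ xi).
Proof. by apply: cintgZl; apply: neu_intg => //; exact: K_intg. Qed.

Lemma bnd_rker : exists2 C : R, 0 <= C & bnd mu rker C.
Proof.
have [C C0 bC] := vker_bnd ab haj be0; have [D D0 hD] := neu_bound ab haj be0.
exists (D * C); first exact: mulr_ge0.
move=> xi; have := hD _ (K_intg xi).
have -> : (\int[mu]_x (n1 (N (K ^~ xi) x))%:E = \int[mu]_x (n1 (rker x xi))%:E)%E.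
  by apply: eq_integral => x _; rewrite /rker mulN1r n1N.
move=> h; apply: le_trans h _; rewrite lee_fin ler_wpM2l// -lee_fin fineK; first exact: bC.
rewrite ge0_fin_numE; first exact: (K_intg xi).2.
by apply: integral_ge0 => u _; rewrite lee_fin n1_ge0.
Qed.

Lemma K_supp xi : a <= xi -> supp b xi (K ^~ xi).
Proof.
move=> axi x xn; apply: vker_out; apply: contra xn => /andP[/andP[_ h1] h2].
by rewrite h1.
Qed.

Lemma rker_supp xi : a <= xi -> supp b xi (rker ^~ xi).
Proof. by move=> axi x xn; rewrite /rker (neu_supp aj be axi (K_supp axi) xn) mulr0. Qed.

Lemma rker_eq xi : {ae mu, forall x, rker x xi + K x xi + Op mu K (rker ^~ xi) x = 0}.
Proof.
have Ki := K_intg xi; have Ni := neu_intg ab haj be0 Ki.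
apply: filterS2 (neu_eq ab haj be0 Ki) (Op_vker_Z (-1) Ni) => x h1 h2.
by rewrite h2 -[K x xi]h1 /rker !mulN1r; ring.
Qed.

(** On (xi,b) the column of the Volterra kernel at xi is the sum of the coefficient functions of
    index 1 based at xi. The resolvent equation is thus the reduced equation with zero right-hand
    side and datum 1 at k = 1. *)
Lemma rker_red xi : a < xi < b -> red xi (fun=> 0) (fun k => (k == 1)%N%:R) (rker ^~ xi).
Proof.
move=> /andP[axi' xib]; have axi := ltW axi'.
apply/(reduced_eq _ _ axi (rker_intg xi) (rker_supp axi)).
apply: filterS (rker_eq xi) => x h; rewrite in_itv/= => xI.
rewrite sum_delta ?n0// -[RHS]h addrAC; congr (_ + _ + _); apply: eq_bigr => j _.
rewrite coef_powerE// subrK pf_in//.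
move: xI => /andP[h1 h2].
have ax := le_lt_trans axi h1.
by rewrite res_in ?ax// /rl_kernel h2 andbT axi'.
Qed.

Lemma gkerE xi x : a < xi -> xi < x -> x < b ->
  gker x xi = V a b xi (fun k => (k == 1)%N%:R) n alpha (rker ^~ xi) x.
Proof.
move=> axi xix xb; rewrite V_delta ?n0// subrK /gker (JE a b _ al0) pf_in ?xix//.
by rewrite /rl_kernel axi xb.
Qed.

Lemma gker_left xi x : a < xi -> x <= xi -> gker x xi = 0.
Proof.
move=> axi xxi; rewrite /gker -(JE a b _ al0) (J_supp alpha (ltW axi) (rker_supp (ltW axi))).
  rewrite /rl_kernel; case: ifP => _; rewrite ?addr0// kf_le0 ?addr0// subr_le0//.
by rewrite negb_and -leNgt xxi.
Qed.

Lemma gker_sol xi : a < xi < b -> sol xi (fun=> 0) (fun k => (k == 1)%N%:R) (gker ^~ xi).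
Proof.
move=> axib; have /andP[axi xib] := axib; have axi' := ltW axi.
have e x : xi < x < b -> V a b xi (fun k => (k == 1)%N%:R) n alpha (rker ^~ xi) x = gker x xi.
  by move=> /andP[h1 h2]; rewrite gkerE.
apply: (reduced_solution ab axi' xib al0 hal hj hlt (rker_red axib)).
  by apply: aeeq_all => x xI; rewrite e.
apply: (aeeq_L1 e); apply/L1P; rewrite (res_supp (V_supp axi' _ n alpha (rker_supp axi'))).
exact: (V_intg ab axi' _ okal hn (rker_intg xi)).
Qed.

Lemma kmeas_gker : kmeas gker.
Proof.
by apply: cmeasD; [exact: kmeas_rl_kernel|apply: kmeas_Op; [exact: kmeas_rl_kernel|exact: kmeas_rker]].
Qed.

Lemma gker_green : green_function alpha alphas aj a b gker.
Proof.
split; [exact: measurable_funTS kmeas_gker.1|exact: measurable_funTS kmeas_gker.2|].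
by move=> xi; rewrite in_itv/=; exact: gker_sol.
Qed.

Let bT (p : X * X) : bool := [&& a < (p.2 : R), (p.2 : R) < (p.1 : R) & (p.1 : R) < b].

(** A Green's function is constrained on the triangle a < xi < x < b only; extension by 0 makes it
    measurable on the plane, as Tonelli requires. *)
Definition cutT (G : R -> R -> R[i]) (p : X * X) : R[i] := if bT p then G p.1 p.2 else 0.

Lemma measurable_bT : measurable_fun setT bT.
Proof.
apply: measurable_and; last apply: measurable_and.
- by apply: measurable_fun_ltr => //; exact: measurable_snd.
- by apply: measurable_fun_ltr; [exact: measurable_snd|exact: measurable_fst].
- by apply: measurable_fun_ltr => //; exact: measurable_fst.
Qed.

Lemma cmeas_cutT G : green_function alpha alphas aj a b G -> cmeas (cutT G).
Proof.
move=> [m1 m2 _].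
set T := [set p : X * X | a < (p.2 : R) /\ (p.2 : R) < (p.1 : R) /\ (p.1 : R) < b] in m1 m2.
have TE p : (p \in T) = bT p.
  by apply/idP/idP; rewrite inE /T /bT /=; [move=> [-> [-> ->]]|move=> /and3P[-> -> ->]].
have mT : measurable T.
  have := measurable_bT measurableT (I : measurable [set true]); rewrite setTI.
  congr measurable; apply/seteqP; split=> p /=; first by rewrite -TE => /set_mem.
  by move=> pT; rewrite -TE; exact: mem_set.
have e (q : R[i] -> R) : q 0 = 0 -> measurable_fun T (fun p : X * X => q (G p.1 p.2)) ->
    measurable_fun setT (fun p => q (cutT G p)).
  move=> q0 /(measurable_restrictT _ mT); congr measurable_fun; apply/funext => p.
  by rewrite /patch TE /cutT; case: ifP.
by split; apply: e.
Qed.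

(** Uniqueness gives, for each xi, equality at a.e. x; [ae_swap] converts this into equality at a.e.
    xi for a.e. x. *)
Lemma green_ae G : green_function alpha alphas aj a b G ->
  {ae mu, forall x, {ae mu, forall xi, bT (x, xi) -> G x xi = gker x xi}}.
Proof.
move=> hG; have mG := cmeas_cutT hG; have mgker := cmeas_cutT gker_green.
pose h (p : X * X) := n1 (cutT G p - cutT gker p).
have mh : measurable_fun setT h by apply: cmeas_n1; exact: cmeasB.
have h0 p : 0 <= h p by exact: n1_ge0.
have H : {ae mu, forall xi, {ae mu, forall x, h (x, xi) = 0}}.
  apply: filterS (ae_neq 0) => xi _.
  have [axib|nxi] := boolP (a < xi < b); last first.
    apply: filterS (ae_neq 0) => x _; rewrite /h /cutT /bT /=.
    case: ifPn => [/and3P[h1 h2 h3]|_]; last by rewrite subrr n1_0.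
    by move: nxi; rewrite h1 (lt_trans h2 h3).
  have [_ _ hsol] := hG; have axib' : xi \in `]a, b[ by rewrite in_itv.
  have xxb : a <= xi < b by case/andP: axib => h1 ->; rewrite ltW.
  have := uniqueness xxb (hsol xi axib') (gker_sol axib).
  apply: filterS => x hx; rewrite /h /cutT /bT /=; case: ifPn => [/and3P[h1 h2 h3]|_].
    by rewrite hx ?in_itv/= ?h2// subrr n1_0.
  by rewrite subrr n1_0.
apply: filterS (ae_swap (m1 := mu) (m2 := mu) mh h0 H) => x; apply: filterS => xi hh bx.
by have /n1_eq0/subr0_eq := hh; rewrite /cutT bx.
Qed.

Section GreenIntegral.
Variable g : R -> R[i].
Hypothesis Lg : L1 a b g.
Let g' := res a b g.
Let gi : cintg mu g'. Proof. exact/L1P. Qed.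

Lemma gker_intg : {ae mu, forall x, cintg mu (fun xi => gker x xi * g' xi)}.
Proof.
have [C C0 bC] := bnd_rker.
have bcomp := bnd_comp (kmeas_rl_kernel a b alpha) kmeas_rker (bnd_rl_kernel ab al0) bC (rl_bound_ge0 a b alpha).
have mcomp := kmeas_Op mu (kmeas_rl_kernel a b alpha) kmeas_rker.
have h1 := ae_Op_intg (kmeas_rl_kernel a b alpha) (bnd_rl_kernel ab al0) (rl_bound_ge0 a b alpha) gi.
have h2 := ae_Op_intg mcomp bcomp (mulr_ge0 (rl_bound_ge0 a b alpha) C0) gi.
apply: filterS2 h1 h2 => x h1 h2; have := cintgD h1 h2; congr cintg.
by apply/funext => xi; rewrite mulrDl.
Qed.

Definition dens x : R[i] := g' x + Op mu rker g' x.

Lemma dens_intg : cintg mu dens.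
Proof.
have [C C0 bC] := bnd_rker.
by apply: cintgD => //; exact: (Op_intg kmeas_rker bC C0 gi).
Qed.

Lemma dens_supp : supp b a dens.
Proof.
move=> x xn; rewrite /dens /g' supp_res// add0r /Op -[RHS](cI0 mu); congr cI; apply/funext => xi.
have [/andP[h1 h2]|h] := boolP (a < xi < b); last by rewrite supp_res// mulr0.
rewrite (rker_supp (ltW h1)) ?mul0r//; apply: contra xn => /andP[k1 k2].
by rewrite (lt_trans h1 k1).
Qed.

(** The resolvent equation r + K + K r = 0, multiplied by g and integrated in xi. It is known for
    each xi at a.e. x, so [ae_swap] comes first; [ae_OpOp] then identifies the integral of K r with
    K applied to r g. *)
Lemma dens_eq : {ae mu, forall x, dens x + Op mu K dens x = g' x}.
Proof.
have [C C0 bC] := bnd_rker; have [D D0 bD] := vker_bnd ab haj be0.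
have mcomp := kmeas_Op mu mK kmeas_rker.
have bcomp := bnd_comp mK kmeas_rker bD bC D0.
pose h (p : X * X) := n1 (rker p.1 p.2 + K p.1 p.2 + Op mu K (rker ^~ p.2) p.1).
have mh : measurable_fun setT h.
  by apply: cmeas_n1; apply: cmeasD; [apply: cmeasD; [exact: kmeas_rker|exact: mK]|exact: mcomp].
have H : {ae mu, forall xi, {ae mu, forall x, h (x, xi) = 0}}.
  apply: filterS (ae_neq 0) => xi _; apply: filterS (rker_eq xi) => x e.
  by rewrite /h /= e n1_0.
have {}H := ae_swap (m1 := mu) (m2 := mu) mh (fun p => n1_ge0 _) H.
have Ri := Op_intg kmeas_rker bC C0 gi.
have h1 := ae_Op_intg kmeas_rker bC C0 gi.
have h2 := ae_Op_intg mK bD D0 gi.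
have h3 := ae_Op_intg mcomp bcomp (mulr_ge0 D0 C0) gi.
have h4 := ae_OpOp mK kmeas_rker bD bC D0 C0 gi.
have h5 := Op_vker_D gi Ri.
apply: filterS3 (filterI h1 h2) (filterI h3 h4) (filterI h5 H) => x [k1 k2] [k3 k4] [k5 k6].
suff e : Op mu rker g' x + Op mu K g' x + Op mu (fun x xi => Op mu K (rker ^~ xi) x) g' x = 0.
  by rewrite /dens k5 k4 -addrA [Op mu rker g' x + _]addrA e addr0.
rewrite /Op -cID// -cID//; last exact: cintgD.
rewrite -[RHS](cI0 mu); apply: ae_eq_cI.
- exact: (cintgD (cintgD k1 k2) k3).1.
- exact: cmeas_cst.
apply: filterS k6 => xi /n1_eq0 e; rewrite -!mulrDl.
by rewrite [X in X * _](_ : _ = 0) ?mul0r// -[RHS]e.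
Qed.

Lemma J_dens : {ae mu, forall x, Op mu gker g' x = J a b alpha dens x}.
Proof.
have [C C0 bC] := bnd_rker.
have mcomp := kmeas_Op mu (kmeas_rl_kernel a b alpha) kmeas_rker.
have bcomp := bnd_comp (kmeas_rl_kernel a b alpha) kmeas_rker (bnd_rl_kernel ab al0) bC (rl_bound_ge0 a b alpha).
have h1 := ae_Op_intg (kmeas_rl_kernel a b alpha) (bnd_rl_kernel ab al0) (rl_bound_ge0 a b alpha) gi.
have h2 := ae_Op_intg mcomp bcomp (mulr_ge0 (rl_bound_ge0 a b alpha) C0) gi.
have h4 := ae_OpOp (kmeas_rl_kernel a b alpha) kmeas_rker (bnd_rl_kernel ab al0) bC (rl_bound_ge0 a b alpha) C0 gi.
have Ri := Op_intg kmeas_rker bC C0 gi.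
have h5 := JD ab okal gi Ri.
apply: filterS2 (filterI h1 h2) (filterI h4 h5) => x [k1 k2] [k4 k5].
rewrite k5 !(JE a b _ al0) k4 /Op -cID//; congr cI; apply/funext => xi.
by rewrite mulrDl.
Qed.

(** At almost every x the integrand agrees for a.e. xi with that of the explicit kernel [gker],
    whose integral is known from [J_dens]. The cut-off version of [G] supplies the measurability in
    xi that [L1] asks for. *)
Lemma green_integral G : green_function alpha alphas aj a b G ->
  {ae mu, forall x, x \in `]a, b[ -> L1 a x (fun xi => G x xi * g xi) /\
    cint `]a, x[%classic (fun xi => G x xi * g xi) = J a b alpha dens x}.
Proof.
move=> hG; have mG := cmeas_cutT hG.
apply: filterS3 (green_ae hG) gker_intg J_dens => x hx ix <-; rewrite in_itv/= => /andP[ax xb].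
have e xi : res a x (fun xi => G x xi * g xi) xi = cutT G (x, xi) * g' xi.
  rewrite /res /cutT /bT /g' /res /= xb andbT.
  have [axi|] /= := ltP a xi; last by rewrite mul0r.
  by case: ltP => [xix|]; rewrite ?mul0r// (lt_trans xix xb).
have mres : cmeas (res a x (fun xi => G x xi * g xi) : X -> _).
  rewrite (_ : res _ _ _ = fun xi => cutT G (x, xi) * g' xi); last exact/funext.
  by apply: cmeasM; [exact: (cmeas_sec1 x mG)|exact: gi.1].
have ae_e : {ae mu, forall xi, res a x (fun xi => G x xi * g xi) xi = gker x xi * g' xi}.
  apply: filterS hx => xi hxi; rewrite e /cutT; case: ifPn => [/[dup] bx /hxi ->//|nb].
  rewrite mul0r; have [axi|xia] := ltP a xi.
    have [xix|xxi] := ltP xi x; last by rewrite gker_left// mul0r.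
    by move: nb; rewrite /bT /= axi xix xb.
  by rewrite /g' res_out ?mulr0// negb_and -leNgt xia.
split; first by apply/L1P; exact: (ae_cintg mres ix ae_e).
rewrite cint_cI /Op; apply: eq_trans (ae_eq_cI mres ix.1 ae_e).
by congr cI; apply/funext => xi; rewrite /res mem_setE in_itv.
Qed.

End GreenIntegral.

Lemma Op_vker_sum (s : seq nat) (z : nat -> R[i]) (F : nat -> R -> R[i]) :
  (forall i, i \in s -> cintg mu (F i)) ->
  cintg mu (fun x => \sum_(i <- s) z i * F i x) /\
  {ae mu, forall x, Op mu K (fun t => \sum_(i <- s) z i * F i t) x = \sum_(i <- s) z i * Op mu K (F i) x}.
Proof.
elim: s => [|i s IH] h.
  split; first by under eq_fun do rewrite big_nil; exact: cintg0.
  apply: filterS (ae_neq 0) => x _; rewrite big_nil /Op -[RHS](cI0 mu); congr cI.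
  by apply/funext => t; rewrite big_nil mulr0.
have [hs {}IH] := IH (fun j js => h j (mem_behead (s := i :: s) js)).
have hi := h i (mem_head _ _).
split; first by under eq_fun do rewrite big_cons; apply: cintgD => //; exact: cintgZl.
apply: filterS3 IH (Op_vker_Z (z i) hi) (Op_vker_D (cintgZl (z i) hi) hs) => x e1 e2 e3.
rewrite big_cons -e1 -e2 -e3; congr (Op mu K _ x).
by apply/funext => t; rewrite big_cons.
Qed.

Lemma sum_cut (k0 : nat) bb (F : nat -> R[i]) : (k0 <= n)%N ->
  \sum_(1 <= i < n.+1) (if (i <= k0)%N then bb i else 0) * F i = \sum_(1 <= i < k0.+1) bb i * F i.
Proof.
move=> kn; rewrite (@big_cat_nat _ _ _ k0.+1)//=.
have -> : \sum_(k0.+1 <= i < n.+1) (if (i <= k0)%N then bb i else 0) * F i = 0.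
  by rewrite big_nat big1// => i /andP[h _]; rewrite leqNgt h mul0r.
by rewrite addr0 big_nat [RHS]big_nat; apply: eq_bigr => i /andP[_]; rewrite ltnS => ->.
Qed.

(** By linearity the combination of the densities of the Y_i with the density [dens g] solves the
    same Volterra equation as the density of y; uniqueness identifies them, and applying I^alpha
    gives the formula. *)
Lemma representation g bb (k0 : nat) y (Y : nat -> R -> R[i]) (G : R -> R -> R[i]) :
  L1 a b g -> (k0 <= n)%N ->
  (forall i, (1 <= i <= k0)%N -> forall j, L1 a b (coef_power alpha alphas aj a i j)) ->
  sol a g (fun k => if (k <= k0)%N then bb k else 0) y ->
  canonical_system alpha alphas aj a b k0 Y -> green_function alpha alphas aj a b G ->
  aeeq a b y (fun x => \sum_(1 <= i < k0.+1) bb i * Y i x +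
                       cint `]a, x[%classic (fun xi => G x xi * g xi)).
Proof.
move=> Lg kn Lc /(solution_reduced ab (lexx a) ab al0 hal hj hlt)[phi [pi p0 hr] yV] hY hG.
pose bb' (k : nat) : R[i] := if (k <= k0)%N then bb k else 0.
rewrite -/bb' in hr yV; have abI : a <= a < b by rewrite lexx.
have : red a g bb' phi by []. move=> /(reduced_eq _ _ (lexx a) pi p0) {}hr.
pose f i := res a b (fun x => coef a i x).
pose M i x := (-1) * N (f i) x.
have fi i : (1 <= i <= k0)%N -> cintg mu (f i).
  by move=> ik; apply/L1P; apply: L1_sum => j _; exact: Lc.
have Mi i : (1 <= i <= k0)%N -> cintg mu (M i).
  by move=> ik; apply: cintgZl; apply: neu_intg => //; exact: fi.
have Ms i : supp b a (M i).
  by move=> x xn; rewrite /M (neu_supp aj be (lexx a) (supp_res _) xn) mulr0.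
have inI i : i \in index_iota 1 k0.+1 -> (1 <= i <= k0)%N by rewrite mem_index_iota ltnS.
pose S x := \sum_(1 <= i < k0.+1) bb i * M i x.
have [Si OpS] := Op_vker_sum (s := index_iota 1 k0.+1) bb (fun i h => Mi i (inI i h)).
have Di := dens_intg Lg; have Dis : supp b a (dens g) by exact: dens_supp.
pose psi x := S x + dens g x.
have psii : cintg mu psi by exact: cintgD.
have psis : supp b a psi.
  move=> x xn; rewrite /psi Dis// addr0 /S big1// => i _; by rewrite Ms// mulr0.
have Meq i : (1 <= i <= k0)%N -> {ae mu, forall x, M i x + Op mu K (M i) x = - f i x}.
  move=> ik; have Ni := neu_intg ab haj be0 (fi i ik).
  apply: filterS2 (Op_vker_Z (-1) Ni) (neu_eq ab haj be0 (fi i ik)) => x h1 h2.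
  by rewrite h1 /M -mulrDr h2 mulN1r.
have Mall : {ae mu, forall x, forall i : 'I_k0.+1, (1 <= i)%N -> M i x + Op mu K (M i) x = - f i x}.
  apply: ae_all_fin => i; have [i1|i0] := boolP (1 <= i)%N.
    by apply: filterS (Meq i (introT andP (conj i1 (ltn_ord i : (i <= k0)%N)))) => x e _.
  by apply: filterS (ae_neq 0) => x _.
have phipsi : {ae mu, forall x, phi x = psi x}.
  apply: (Volterra_eq (f := fun x => g x - \sum_(1 <= i < n.+1) bb' i * coef a i x) (lexx a)) => //.
    by apply: filterS hr => x hx xI; rewrite -hx// addrK.
  apply: filterS3 (filterI OpS (Op_vker_D Si Di)) Mall (dens_eq Lg) => x [e1 e2] e3 e4.
  rewrite in_itv/= => xI; rewrite e2 e1 /psi addrACA e4 -big_split/= res_in// addrC.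
  congr (_ + _); rewrite sum_cut// -sumrN big_nat [RHS]big_nat; apply: eq_bigr => i /andP[i1 ik].
  by rewrite -mulrDr (e3 (Ordinal ik) i1) /= mulrN /f res_in.
have JS := J_sum (s := index_iota 1 k0.+1) ab bb okal (fun i h => Mi i (inI i h)).
have Jpsi := JD ab okal Si Di.
have VV := V_ae_eq a bb' pi psii phipsi.
have Yall : {ae mu, forall x, forall i : 'I_k0.+1, (1 <= i)%N -> x \in `]a, b[ ->
    Y i x - power_fun alpha a i x = J a b alpha (M i) x}.
  apply: ae_all_fin => i; have [i1|i0] := boolP (1 <= i)%N; last first.
    by apply: filterS (ae_neq 0) => x _.
  have ik : (1 <= i <= k0)%N by rewrite i1 -ltnS ltn_ord.
  have i_n : (1 <= i <= n)%N by case/andP: ik => -> h; exact: leq_trans h kn.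
  have hYi := hY i ik; rewrite delta_sym in hYi.
  have h := canonical_phi abI i_n (Lc i ik) hYi.
  by move: h; apply: filterS => x e _.
apply: filterS3 (filterI yV VV) (filterI JS Jpsi) (filterI Yall (green_integral Lg hG)).
move=> x [e1 e2] [e3 e4] [e5 e6] xI.
rewrite e1// e2// (e6 xI).2 /V e4 e3 sum_cut// addrA -big_split/=; congr (_ + _).
rewrite big_nat [RHS]big_nat; apply: eq_bigr => i /andP[i1 ik].
have xI' : a < x < b by move: xI; rewrite in_itv.
by rewrite -mulrDr -(e5 (Ordinal ik) i1 xI) /= power_funE// addrC subrK.
Qed.

End Problem.

Theorem theorem3p7 (R : realType) (a b : R) (hab : a < b) (l : nat)
    (alpha : R[i]) (alphas : 'I_l.+1 -> R[i])
    (halpha0 : alphas ord0 = 0)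
    (halphas : forall i j : 'I_l.+1, (i < j)%N ->
      complex.Re (alphas i) < complex.Re (alphas j))
    (halpha : complex.Re (alphas ord_max) < complex.Re alpha)
    (n : nat) (hn : n = RLorder alpha)
    (hnat : ~~ is_natC alpha ->
      n%:R - 1 < complex.Re alpha /\ complex.Re alpha < n%:R)
    (aj : 'I_l.+1 -> R -> R[i])
    (haj : forall j, ccontinuous `[a, b] (aj j))
    (g : R -> R[i]) (hg : L1 a b g)
    (bb : nat -> R[i])
    (k0 : nat) (hk0 : largest_index alpha alphas aj a b k0) :
  let solution := cauchy_solution alpha alphas aj a b g
                    (fun k => if (k <= k0)%N then bb k else 0) in
  (exists2 y, solution y & forall y', solution y' -> aeeq a b y' y) /\
  (exists Y, canonical_system alpha alphas aj a b k0 Y) /\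
  (exists G, green_function alpha alphas aj a b G) /\
  forall (y : R -> R[i]) (Y : nat -> R -> R[i]) (G : R -> R -> R[i]),
    solution y ->
    canonical_system alpha alphas aj a b k0 Y ->
    green_function alpha alphas aj a b G ->
    [/\ forall i : nat, (1 <= i <= k0)%N ->
          L1_series a b (series_term alpha alphas aj a i)
            (fun x => Y i x - power_fun alpha a i x),
        forall xi : R, xi \in `]a, b[ ->
          L1_series xi b (series_term alpha alphas aj xi 1)
            (fun x => G x xi - power_fun alpha xi 1 x),
        {ae @lebesgue_measure R, forall x, x \in `]a, b[ ->
          L1 a x (fun xi => G x xi * g xi)} &
        aeeq a b y (fun x => \sum_(1 <= i < k0.+1) bb i * Y i x +
                             cint `]a, x[ (fun xi => G x xi * g xi))].
Proof.
have R0 : complex.Re (alphas ord0) = 0 by rewrite halpha0.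
have hj j : alphas j = 0 \/ 0 < complex.Re (alphas j).
  have [->|j0] := eqVneq j ord0; first by left.
  by right; rewrite -R0; apply: halphas; rewrite lt0n.
have hlt j : complex.Re (alphas j) < complex.Re alpha.
  have [->//|jm] := eqVneq j ord_max.
  apply: lt_trans halpha; apply: halphas; rewrite ltn_neqAle -ltnS ltn_ord andbT.
  by apply: contra jm => /eqP e; apply/eqP/val_inj.
have al0 : 0 < complex.Re alpha by rewrite -R0.
subst n; have [[/andP[k1 kn] Lk0] _] := hk0.
have abI : a <= a < b by rewrite lexx.
(* Integrability at the index [k0] propagates to all smaller indices. *)
have Lc i : (1 <= i <= k0)%N -> forall j, L1 a b (coef_power alpha alphas aj a i j).
  by move=> ik; apply: (coef_L1 hab haj ik).
have i_n i : (1 <= i <= k0)%N -> (1 <= i <= RLorder alpha)%N.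
  by case/andP => -> h; exact: leq_trans h kn.
have hY : exists Y, canonical_system alpha alphas aj a b k0 Y.
  have /choice[Y hY] : forall i : nat, exists y, (1 <= i <= k0)%N ->
      cauchy_solution alpha alphas aj a b (fun=> 0) (fun k => (i == k)%:R) y.
    (* Outside 1..k0 the family is unconstrained and is filled with 0. *)
    move=> i; have [ik|nik] := boolP (1 <= i <= k0)%N; last by exists (fun=> 0).
    have [|y hy] := existence hab al0 hnat hj hlt haj abI (g := fun=> 0) (bb := fun k => (k == i)%:R); last by exists y => _; rewrite delta_sym.
    apply: (aeeq_L1 (f := fun x => -1 * \sum_j coef_power alpha alphas aj a i j x)).
      by move=> x _; rewrite sum_delta ?i_n// sub0r mulN1r.
    by apply: L1_Z; apply: L1_sum => j _; exact: Lc.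
  by exists Y.
(* The cut at [k0] leaves only integrable coefficient functions on the right-hand side, as
   [existence] requires. *)
have Lsol : L1 a b (fun x => g x - \sum_(1 <= i < (RLorder alpha).+1)
    (if (i <= k0)%N then bb i else 0) * \sum_j coef_power alpha alphas aj a i j x).
  apply: (aeeq_L1 (f := fun x => g x + -1 * \sum_(1 <= i < k0.+1) bb i * \sum_j coef_power alpha alphas aj a i j x)).
    by move=> x _; rewrite mulN1r sum_cut.
  apply: L1_D => //; apply: L1_Z; apply: L1_sum => i; rewrite mem_index_iota ltnS => ik.
  by apply: L1_Z; apply: L1_sum => j _; exact: Lc.
have [y hy] := existence hab al0 hnat hj hlt haj abI Lsol.
have hG := gker_green hab al0 hnat hj hlt haj.
split; first by exists y => // y' hy'; exact: uniqueness abI hy' hy.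
split=> //; split; first by eexists; exact: hG.
move=> {hG hY y hy} y Y G hy hY hG; split.
- move=> i ik; apply: (series_conv hab al0 hnat hj hlt haj abI (i_n i ik) (Lc i ik)).
  by rewrite -delta_sym; exact: hY.
- move=> xi; rewrite in_itv/= => /[dup] xiab /andP[axi xib].
  have xiI : a <= xi < b by rewrite (ltW axi).
  have n1 : (1 <= 1 <= RLorder alpha)%N by rewrite (leq_trans k1 kn).
  apply: (series_conv hab al0 hnat hj hlt haj xiI n1).
    by move=> j; exact: (coef1_L1 hab hlt haj j xiI).
  by have [_ _] := hG; apply; rewrite in_itv.
- by apply: filterS (green_integral hab al0 hnat hj hlt haj hg hG) => x h xI; have [] := h xI.
- exact: (representation hab al0 hnat hj hlt haj hg kn Lc hy hY hG).
Qed.
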